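(* Let $A^2_\nu$ be a Zen space, with associated weight $w(t)=2\pi\int_0^\infty e^{-2rt}\,d\tilde\nu(r)$, for which the Laplace transform $\mathfrak{L}:L^2_w(0,\infty)\to A^2_\nu$ is surjective. Let $h:\mathbb{C}_+\to\mathbb{C}$ and $\varphi:\mathbb{C}_+\to\mathbb{C}_+$ be holomorphic, and suppose that the weighted composition operator $W_{h,\varphi}F:=h\cdot(F\circ\varphi)$ is bounded and causal on $A^2_\nu$. Then there exists $\alpha'\ge 0$ such that for each $\alpha\ge\alpha'$ the operator $W_{h,\varphi}$ is bounded on the weighted Bergman space $\mathcal{B}^2_\alpha(\mathbb{C}_+)$, and $$\|W_{h,\varphi}\|_{\mathcal{B}^2_\alpha(\mathbb{C}_+)}\le\|W_{h,\varphi}\|_{A^2_\nu}.$$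
   Context: $\mathbb{C}_+=\{z\in\mathbb{C}:\operatorname{Re}(z)>0\}$ and $\overline{\mathbb{C}_+}=[0,\infty)\times i\mathbb{R}$. Zen spaces: let $\tilde\nu$ be a positive regular Borel measure on $[0,\infty)$ with $0<\tilde\nu[0,r)<\infty$ for all $r>0$, satisfying $\sup_{r>0}\tilde\nu[0,2r)/\tilde\nu[0,r)<\infty$. Let $\lambda$ be Lebesgue measure on $i\mathbb{R}$ and $\nu:=\tilde\nu\otimes\lambda$ on $\overline{\mathbb{C}_+}$. The Zen space $A^2_\nu$ is the space of analytic $F:\mathbb{C}_+\to\mathbb{C}$ with $\|F\|^2_{A^2_\nu}:=\sup_{\varepsilon>0}\int_{\overline{\mathbb{C}_+}}|F(z+\varepsilon)|^2\,d\nu(z)<\infty$. For a positive measurable $w$ on $(0,\infty)$, $L^2_w(0,\infty)$ is the space of measurable $f:(0,\infty)\to\mathbb{C}$ with $\|f\|^2=\int_0^\infty|f(t)|^2w(t)\,dt<\infty$. It is known that, for $w$ as in the claim, the Laplace transform $\mathfrak{L}f(z)=\int_0^\infty e^{-tz}f(t)\,dt$ is an isometry from $L^2_w(0,\infty)$ into $A^2_\nu$. Causality: an operator $A:L^2_w(0,\infty)\to L^2_w(0,\infty)$ is causal if for each $T>0$ the closed subspace $L^2_w(T,\infty)$ (functions vanishing a.e. on $(0,T)$) is invariant for $A$. An operator $B:A^2_\nu\to A^2_\nu$ is causal if $\mathfrak{L}^{-1}B\mathfrak{L}$ is causal on $L^2_w(0,\infty)$. For $\alpha>-1$, $\mathcal{B}^2_\alpha(\mathbb{C}_+)$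 is the space of analytic $F:\mathbb{C}_+\to\mathbb{C}$ with $\|F\|^2_{\mathcal{B}^2_\alpha}:=\frac1\pi\int_{\mathbb{C}_+}(\operatorname{Re}z)^\alpha|F(z)|^2\,dA(z)<\infty$, where $dA$ is area (planar Lebesgue) measure. *)

(* Defs.v *)
From mathcomp Require Import all_boot all_order all_algebra.
From mathcomp Require Import complex.
From mathcomp Require Import all_classical all_reals all_analysis.

Set Implicit Arguments.
Unset Strict Implicit.
Unset Printing Implicit Defensive.

Import Order.TTheory GRing.Theory Num.Theory.
Import numFieldNormedType.Exports.

Local Open Scope classical_set_scope.
Local Open Scope ring_scope.
Local Open Scope complex_scope.

(** A function on the right half-plane is a total function [R[i] -> R[i]] of
    which only the values on [rhp] are ever used; likewise a function on (0, oo)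
    is a total function on [R].  Equality in the function spaces is equality on
    [rhp], resp. almost everywhere on (0, oo). *)

Section Operators.
Context {R : realType} {U : Type}.
Local Open Scope ereal_scope.

Definition bounded_operator (X : set U) (N : U -> \bar R) (A : U -> U) : Prop :=
  (forall u, X u -> X (A u)) /\
  (exists2 M : R, (0 <= M)%R & forall u, X u -> N (A u) <= M%:E * N u).

Definition operator_norm (X : set U) (N : U -> \bar R) (A : U -> U) : \bar R :=
  ereal_sup [set N (A u) | u in [set u | X u /\ N u <= 1]].

End Operators.

Section HalfPlane.
Context (R : realType).

Definition rhp : set R[i] := [set z | 0 < complex.Re z].

(** [derivable] is taken over the scalar field [R[i]]: this is complex, not real,
    differentiability. *)
Definition holomorphic_rhp (F : R[i] -> R[i]) : Prop :=
  forall z, rhp z -> derivable (F : R[i]^o -> R[i]^o) z 1.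

Definition weighted_composition (h phi : R[i] -> R[i]) (F : R[i] -> R[i]) :
  R[i] -> R[i] := fun z => h z * F (phi z).

Definition cexp (z : R[i]) : R[i] :=
  (expR (complex.Re z) * cos (complex.Im z)) +i*
  (expR (complex.Re z) * sin (complex.Im z)).

Definition laplace (f : R -> R[i]) (z : R[i]) : R[i] :=
  let g (t : R) : R[i] := cexp (- (t%:C * z)) * f t in
  (\int[@lebesgue_measure R]_(t in `]0, +oo[%classic) complex.Re (g t)) +i*
  (\int[@lebesgue_measure R]_(t in `]0, +oo[%classic) complex.Im (g t)).

End HalfPlane.

Section Zen.
Context {R : realType}.
Local Open Scope ereal_scope.

Definition regular_measure
    (nu : {measure set (measurableTypeR R) -> \bar R}) : Prop :=
  forall E : set R, measurable E ->
    nu E = ereal_inf [set nu V | V in [set V : set R | open V /\ E `<=` V]] /\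
    nu E = ereal_sup [set nu K | K in [set K : set R | compact K /\ K `<=` E]].

(** A Borel measure on [0, oo) is a Borel measure on [R] for which the negative
    half-line is null; regularity means the same for both. *)
Definition zen_measure
    (nu : {measure set (measurableTypeR R) -> \bar R}) : Prop :=
  [/\ nu `]-oo, 0%R[%classic = 0,
      regular_measure nu,
      (forall r : R, (0 < r)%R -> 0 < nu `[0%R, r[%classic < +oo) &
      ereal_sup [set nu `[0%R, (2 * r)%R[%classic / nu `[0%R, r[%classic
                | r in [set r : R | (0 < r)%R]] < +oo].

Variable nu : {measure set (measurableTypeR R) -> \bar R}.

Definition zen_norm (F : R[i] -> R[i]) : \bar R :=
  sqrte (ereal_sup
    [set \int[nu \x (@lebesgue_measure R)]_(p in `[0%R, +oo[%classic `*` setT)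
           (ComplexField.Normc.normc (F ((p.1 + eps)%R +i* p.2)) ^+ 2)%:E
    | eps in [set eps : R | (0 < eps)%R]]).

Definition zen_space : set (R[i] -> R[i]) :=
  [set F | holomorphic_rhp F /\ zen_norm F < +oo].

Definition zen_weight (t : R) : \bar R :=
  (2 * pi)%:E * \int[nu]_(r in `[0%R, +oo[%classic) (expR (- (2 * r * t)))%:E.

Definition L2w_norm (f : R -> R[i]) : \bar R :=
  sqrte (\int[@lebesgue_measure R]_(t in `]0%R, +oo[%classic)
           ((ComplexField.Normc.normc (f t) ^+ 2)%:E * zen_weight t)).

Definition L2w : set (R -> R[i]) :=
  [set f | [/\ measurable_fun (`]0%R, +oo[%classic : set R) (fun t => complex.Re (f t)),
               measurable_fun (`]0%R, +oo[%classic : set R) (fun t => complex.Im (f t)) &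
               L2w_norm f < +oo]].

Definition L2w_from (T : R) : set (R -> R[i]) :=
  [set f | L2w f /\
           {ae @lebesgue_measure R, forall t, (0 < t < T)%R -> f t = 0%R}].

Definition causal_L2w (A : (R -> R[i]) -> (R -> R[i])) : Prop :=
  forall T : R, (0 < T)%R -> forall f, L2w_from T f -> L2w_from T (A f).

Definition laplace_surjective : Prop :=
  forall F, zen_space F ->
    exists2 f, L2w f & (forall z, rhp z -> laplace f z = F z).

(** A preimage of [F] in [L2w]; the Laplace transform being injective there, it
    is unique up to almost everywhere equality.  Junk value [0] if there is
    none. *)
Definition laplace_inv (F : R[i] -> R[i]) : R -> R[i] :=
  xget (fun=> 0%R) [set f | L2w f /\ (forall z, rhp z -> laplace f z = F z)].

Definition causal_zen (B : (R[i] -> R[i]) -> (R[i] -> R[i])) : Prop :=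
  causal_L2w (fun f => laplace_inv (B (laplace f))).

End Zen.

Section Bergman.
Context {R : realType}.
Local Open Scope ereal_scope.
Variable alpha : R.

Definition bergman_norm (F : R[i] -> R[i]) : \bar R :=
  sqrte ((pi^-1)%:E *
    \int[(@lebesgue_measure R) \x (@lebesgue_measure R)]_
      (p in `]0%R, +oo[%classic `*` setT) (p.1 `^ alpha * ComplexField.Normc.normc (F (p.1 +i* p.2)) ^+ 2)%:E).

Definition bergman_space : set (R[i] -> R[i]) :=
  [set F | holomorphic_rhp F /\ bergman_norm F < +oo].

End Bergman.

(* Main.v *)
(** By Plancherel on vertical lines and Tonelli, the Laplace transform is an
isometry from the functions of finite L^2_w norm into the Zen space, and from
those square integrable against v(t) = c t^-(alpha+1) into the Bergman space.
The doubling condition makes t^C w(t) nondecreasing for some C, so that v/w is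
nonincreasing as soon as C <= alpha.  Let A be the conjugate of W under the
Laplace transform and M the norm of W.  Causality applied to f 1_(0,T) gives
int_0^T |A f|^2 w <= M^2 int_0^T |f|^2 w for every T, and integrating this over
the superlevel sets of v/w, which are initial segments, replaces w by v.

A general F in the Bergman space is reached as follows.  The function
F n / (n + z) is a Laplace transform by a Paley-Wiener argument: Goursat's
theorem moves the inversion integral from one vertical line to another, and
Abel summation inverts the Fourier transform.  Truncations of its preimage have
finite L^2_w norm, and Fatou's lemma passes to the limit twice. *)
Require Import Defs.
From HB Require Import structures.
From mathcomp Require Import all_boot all_order all_algebra.
From mathcomp Require Import complex.
From mathcomp Require Import all_classical all_reals all_analysis.
From mathcomp Require Import measurable_realfun ring lra.
Import Order.TTheory GRing.Theory Num.Theory.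
Import numFieldNormedType.Exports.
Local Open Scope classical_set_scope.
Local Open Scope ring_scope.
Set Implicit Arguments.
Unset Strict Implicit.
Unset Printing Implicit Defensive.

(** * Integrals over the real line *)

Section RealIntegrals.
Context {R : realType}.
Notation mu := (@lebesgue_measure R).

Implicit Types (f g : R -> R) (c : R).

(** The weighted composition acts pointwise, so pointwise convergence passes through it, while its
    continuity on the Bergman space is not known beforehand; hence both limits are taken by Fatou's
    lemma, from pointwise convergence and uniform norm bounds. There are two limits because there
    are two separate defects. A Bergman function is square integrable on almost every vertical line
    but in general not integrable there, so its inversion integral may diverge; [n / (n + z)] is
    square integrable on vertical lines, has modulus at most 1 and tends to 1. The preimage so
    obtained is square integrable against [v] only, and [v / w] tends to 0 at infinity; on [(0, k)]
    it stays above its value at [k], so truncation lands in [L2w]. The conjugate [A] is built by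
    choosing preimages, so it is additive only almost everywhere, through injectivity of the Laplace
    transform. Plancherel's identity is the Abel mean of the autocorrelation at 0, and the same Abel
    means give the inversion in the Paley-Wiener argument: one kernel computation serves both. *)

Definition L1 (f : R -> R) : Prop := mu.-integrable setT (EFin \o f).
Definition RI (f : R -> R) : R := \int[mu]_x f x.

Lemma L1_measurable f : L1 f -> measurable_fun setT f.
Proof. by move=> /measurable_int /measurable_EFinP. Qed.

Lemma L1_le f g : measurable_fun setT f -> (forall x, `|f x| <= g x) ->
  L1 g -> L1 f.
Proof.
move=> mf fg; apply: le_integrable => //; first exact/measurable_EFinP.
by move=> x _ /=; rewrite lee_fin (le_trans (fg x)) // ler_norm.
Qed.

Lemma L1D f g : L1 f -> L1 g -> L1 (fun x => f x + g x).
Proof. by move=> f1 g1; exact: (integrableD measurableT f1 g1). Qed.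

Lemma L1B f g : L1 f -> L1 g -> L1 (fun x => f x - g x).
Proof. by move=> f1 g1; exact: (integrableB measurableT f1 g1). Qed.

Lemma L1Z c f : L1 f -> L1 (fun x => c * f x).
Proof. by move=> f1; exact: (integrableZl measurableT c f1). Qed.

Lemma L1_norm f : L1 f -> L1 (fun x => `|f x|).
Proof. by move=> f1; rewrite /L1; exact: integrable_norm. Qed.

Lemma eq_L1 f g : (forall x, f x = g x) -> L1 f -> L1 g.
Proof. by move=> fg; rewrite (funext fg). Qed.

Lemma L1_mul_bounded f g c : measurable_fun setT g -> (forall x, `|g x| <= c) ->
  L1 f -> L1 (fun x => f x * g x).
Proof.
move=> mg gc f1; apply: (@L1_le _ (fun x => c * `|f x|)).
- by apply: measurable_funM => //; exact: L1_measurable.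
- by move=> x; rewrite normrM mulrC ler_wpM2r.
- by apply: L1Z; exact: L1_norm.
Qed.

Lemma L1_ge0P f : measurable_fun setT f -> (forall x, 0 <= f x) ->
  L1 f <-> (\int[mu]_x (f x)%:E < +oo)%E.
Proof.
move=> mf f0; have e : (\int[mu]_x `|(EFin \o f) x| = \int[mu]_x (f x)%:E)%E.
  by apply: eq_integral => x _ /=; rewrite ger0_norm.
split; first by move/integrableP => [_]; rewrite e.
by move=> foo; apply/integrableP; split; [exact/measurable_EFinP|rewrite e].
Qed.

Lemma RIE f : L1 f -> (\int[mu]_x (f x)%:E)%E = (RI f)%:E.
Proof. by move=> f1; rewrite /RI /Rintegral fineK //; exact: integrable_fin_num. Qed.

Lemma eq_RI f g : (forall x, f x = g x) -> RI f = RI g.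
Proof. by move=> fg; rewrite (funext fg). Qed.

Lemma RID f g : L1 f -> L1 g -> RI (fun x => f x + g x) = RI f + RI g.
Proof. by move=> f1 g1; exact: RintegralD. Qed.

Lemma RIB f g : L1 f -> L1 g -> RI (fun x => f x - g x) = RI f - RI g.
Proof. by move=> f1 g1; exact: RintegralB. Qed.

Lemma RIZ c f : L1 f -> RI (fun x => c * f x) = c * RI f.
Proof. by move=> f1; exact: RintegralZl. Qed.

Lemma RIN f : L1 f -> RI (fun x => - f x) = - RI f.
Proof.
move=> f1; rewrite -mulN1r -RIZ //.
by apply: eq_RI => x; rewrite mulN1r.
Qed.

Lemma le_RI f g : L1 f -> L1 g -> (forall x, f x <= g x) -> RI f <= RI g.
Proof. by move=> f1 g1 fg; apply: le_Rintegral. Qed.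

Lemma RI_ge0 f : (forall x, 0 <= f x) -> 0 <= RI f.
Proof. by move=> f0; apply: Rintegral_ge0. Qed.

Lemma norm_RI f : L1 f -> `|RI f| <= RI (fun x => `|f x|).
Proof. by move=> f1; exact: le_normr_Rintegral. Qed.

Lemma norm_RI_le f g : L1 f -> L1 g -> (forall x, `|f x| <= g x) ->
  `|RI f| <= RI g.
Proof.
by move=> f1 g1 fg; apply: le_trans (norm_RI f1) _; apply: le_RI => //; exact: L1_norm.
Qed.

Lemma measurable_shift (c : R) : measurable_fun setT (fun x : R => x + c).
Proof. exact: measurable_funD. Qed.

(** Uniqueness of the Lebesgue measure reduces invariance to half-open intervals, whose preimages
    are intervals of the same length. *)
Lemma lebesgue_measure_shift (c : R) (A : set R) : measurable A ->
  pushforward mu ((fun x => x + c) : R -> measurableTypeR R) A = mu A.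
Proof.
have mc := measurable_shift c.
move=> mA; apply/esym/lebesgue_measure_unique => //= _ [[a b]] _ <-.
rewrite /pushforward (_ : _ @^-1` _ = `](a - c), (b - c)]%classic).
  by rewrite !lebesgue_measure_itv/= !lte_fin ltrBlDr subrK opprB -!EFinD addrA subrK.
by apply/seteqP; split => x /=; rewrite !in_itv/= ltrBlDr lerBrDr.
Qed.

Lemma ge0_integral_shift (c : R) (f : R -> \bar R) : measurable_fun setT f ->
  (forall x, 0 <= f x)%E -> (\int[mu]_x f (x + c)%R = \int[mu]_x f x)%E.
Proof.
move=> mf f0; have mc := measurable_shift c.
transitivity (\int[mu]_(x in ((fun x : R => x + c)%R : R -> measurableTypeR R) @^-1` setT) (f \o (fun x => x + c)%R) x)%E => //.
rewrite -ge0_integral_pushforward //=.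
by apply: eq_measure_integral => A mA _; exact: lebesgue_measure_shift.
Qed.

Lemma L1_shift c f : L1 f -> L1 (fun x => f (x + c)).
Proof.
move=> /integrableP[/measurable_EFinP mf ioo]; apply/integrableP; split.
  apply/measurable_EFinP.
  by apply: (measurableT_comp mf); exact: measurable_shift.
rewrite (ge0_integral_shift c (f := fun x => `|(f x)%:E|)%E) //.
by do 2 apply: measurableT_comp => //.
Qed.

Lemma RI_shift c f : L1 f -> RI (fun x => f (x + c)) = RI f.
Proof.
move=> f1; have mc := measurable_shift c.
rewrite /RI /Rintegral; congr fine.
transitivity (\int[mu]_(x in ((fun x : R => x + c)%R : R -> measurableTypeR R) @^-1` setT) ((EFin \o f) \o (fun x => x + c)%R) x)%E => //.
rewrite -integral_pushforward //=.
- by apply: eq_measure_integral => A mA _; exact: lebesgue_measure_shift.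
- exact: measurable_int f1.
- exact: (L1_shift c f1).
Qed.

Lemma ae_mono (P Q : R -> Prop) : (forall x, P x -> Q x) ->
  {ae mu, forall x, P x} -> {ae mu, forall x, Q x}.
Proof.
move=> PQ [N [mN N0 sub]]; exists N; split => //.
by move=> x /= nQ; apply: sub => /= Px; apply: nQ; exact: PQ.
Qed.

Lemma RI_dct_ae (f_ : nat -> R -> R) (f g : R -> R) :
  (forall n, measurable_fun setT (f_ n)) -> measurable_fun setT f -> L1 g ->
  (forall n x, `|f_ n x| <= g x) ->
  {ae mu, forall x, f_ n x @[n --> \oo] --> f x} ->
  L1 f /\ RI (f_ n) @[n --> \oo] --> RI f.
Proof.
move=> mf_ mf g1 fg cf.
have L1f_ n : L1 (f_ n) by exact: L1_le (mf_ n) (fg n) g1.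
have mE n : measurable_fun setT (EFin \o f_ n) by exact/measurable_EFinP.
have mfE : measurable_fun setT (EFin \o f) by exact/measurable_EFinP.
have [||L1f _ H2] := @dominated_convergence _ _ _ mu setT measurableT
    (fun n => EFin \o f_ n) (EFin \o f) (EFin \o g) mE mfE _ g1 _.
- apply: ae_mono cf => x cfx _; apply: cvg_EFin; [exact: nearW|exact: cfx].
- by apply: aeW => x n _; rewrite lee_fin.
split=> //.
by apply: fine_cvg; rewrite -/(RI f) -RIE.
Qed.

Lemma RI_dct (f_ : nat -> R -> R) (f g : R -> R) :
  (forall n, measurable_fun setT (f_ n)) -> L1 g ->
  (forall n x, `|f_ n x| <= g x) ->
  (forall x, f_ n x @[n --> \oo] --> f x) ->
  L1 f /\ RI (f_ n) @[n --> \oo] --> RI f.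
Proof.
move=> mf g1 fg cf; apply: (@RI_dct_ae f_ f g) => //; last exact: aeW.
by apply: (measurable_fun_cvg (h := f_)) => // x _; exact: cf.
Qed.

Section Fubini.
Variable (f : R * R -> R).

(** [RI] of a section is the [fine] part of the extended integral, so it is guaranteed to agree with
    [fubini_F] and [fubini_G] only where the section is integrable, which is almost everywhere;
    Fubini's theorem is transported along these almost everywhere equalities. *)
Lemma RI_fubini :
  measurable_fun setT f ->
  (\int[mu]_x \int[mu]_y `|f (x, y)|%:E < +oo)%E ->
  [/\ RI (fun x => RI (fun y => f (x, y))) = RI (fun y => RI (fun x => f (x, y))),
      {ae mu, forall x, L1 (fun y => f (x, y))},
      {ae mu, forall y, L1 (fun x => f (x, y))} &
      mu.-integrable setT (EFin \o (fun x => RI (fun y => f (x, y)))) ].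
Proof.
move=> mf foo.
have mE : measurable_fun setT (EFin \o f) by exact/measurable_EFinP.
have If : (mu \x mu)%E.-integrable setT (EFin \o f) by apply/integrable12ltyP.
have ae1 := ae_integrable1 If; have ae2 := ae_integrable2 If.
have F1 := integrable_fubini_F If; have mG := measurable_fubini_G If.
have eF : ae_eq mu setT (fubini_F mu (EFin \o f))
    (EFin \o (fun x => RI (fun y => f (x, y)))).
  by apply: filterS ae1 => x fx _; rewrite /fubini_F /= -RIE.
have eG : ae_eq mu setT (fubini_G mu (EFin \o f))
    (EFin \o (fun y => RI (fun x => f (x, y)))).
  by apply: filterS ae2 => x fx _; rewrite /fubini_G /= -RIE.
have mRF : measurable_fun setT (EFin \o (fun x => RI (fun y => f (x, y)))).
  rewrite (_ : _ \o _ = EFin \o (fun x => fine (fubini_F mu (EFin \o f) x))) //.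
  apply/measurable_EFinP; apply: measurableT_comp => //.
  by have := measurable_int _ F1.
have mRG : measurable_fun setT (EFin \o (fun y => RI (fun x => f (x, y)))).
  rewrite (_ : _ \o _ = EFin \o (fun x => fine (fubini_G mu (EFin \o f) x))) //.
  apply/measurable_EFinP; apply: measurableT_comp => //.
have eFi : (\int[mu]_x fubini_F mu (EFin \o f) x = \int[mu]_x (RI (fun y => f (x, y)))%:E)%E.
  apply: (@ae_eq_integral _ _ _ mu) => //; exact: measurable_int F1.
have eGi : (\int[mu]_x fubini_G mu (EFin \o f) x = \int[mu]_y (RI (fun x => f (x, y)))%:E)%E.
  exact: (@ae_eq_integral _ _ _ mu).
have IF : mu.-integrable setT (EFin \o (fun x => RI (fun y => f (x, y)))).
  have /integrableP[mF Foo] := F1.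
  apply/integrableP; split; first exact: mRF.
  rewrite (le_lt_trans _ Foo) // le_eqVlt; apply/orP; left; apply/eqP.
  apply: ae_eq_integral; first by [].
  - by apply: measurableT_comp; [exact: abse_measurable|exact: mRF].
  - by apply: measurableT_comp; [exact: abse_measurable|exact: mF].
  - apply: filterS eF => x e xT; congr (`|_|)%E; exact/esym/e.
split; [|exact: ae1|exact: ae2|exact: IF].
rewrite {1}/RI {2}/RI /Rintegral; congr fine.
by rewrite -eFi -eGi integral12_prod_meas1 // integral21_prod_meas1.
Qed.

End Fubini.

(** Integrability of the second marginal is that of the first one for the transposed function;
    Tonelli transfers the finiteness assumption. *)
Lemma RI_fubini2 (f : R * R -> R) :
  measurable_fun setT f ->
  (\int[mu]_x \int[mu]_y `|f (x, y)|%:E < +oo)%E ->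
  [/\ RI (fun x => RI (fun y => f (x, y))) = RI (fun y => RI (fun x => f (x, y))),
      L1 (fun x => RI (fun y => f (x, y))) &
      L1 (fun y => RI (fun x => f (x, y)))].
Proof.
move=> mf foo; have [e _ _ I1] := RI_fubini mf foo.
have mfn : measurable_fun setT (fun z => `|f z|%:E).
  by apply/measurable_EFinP; exact: measurableT_comp.
have foo' : (\int[mu]_x \int[mu]_y `|f (y, x)|%:E < +oo)%E.
  by rewrite -(fubini_tonelli (m1 := mu) (m2 := mu) (fun z => `|f z|%:E)).
have mf' : measurable_fun setT (fun z : R * R => f (z.2, z.1)).
  by apply: (measurableT_comp mf); exact: measurable_fun_pair.
by have [_ _ _] := RI_fubini mf' foo'.
Qed.
End RealIntegrals.

(** * Derivatives of real functions, in pointwise form *)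

Section RealDerivatives.
Context {R : realType}.
Implicit Types (f g : R -> R) (x : R).

Lemma der_cst (c : R) x : is_derive x 1 (fun=> c) 0.
Proof. exact: is_derive_cst. Qed.

Lemma derD f g x df dg : is_derive x 1 f df -> is_derive x 1 g dg ->
  is_derive x 1 (fun y => f y + g y) (df + dg).
Proof. by move=> Df Dg; exact: is_deriveD. Qed.

Lemma derN f x df : is_derive x 1 f df -> is_derive x 1 (fun y => - f y) (- df).
Proof. by move=> Df; exact: is_deriveN. Qed.

Lemma derM f g x df dg : is_derive x 1 f df -> is_derive x 1 g dg ->
  is_derive x 1 (fun y => f y * g y) (df * g x + f x * dg).
Proof.
move=> Df Dg; apply: is_derive_eq (is_deriveM Df Dg) _.
by rewrite /GRing.scale /= addrC (mulrC (g x)).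
Qed.

Lemma derZ (c : R) f x df : is_derive x 1 f df ->
  is_derive x 1 (fun y => c * f y) (c * df).
Proof. by move=> Df; exact: is_deriveZ. Qed.

Lemma der_comp f g x df dg : is_derive x 1 g dg -> is_derive (g x) 1 f df ->
  is_derive x 1 (fun y => f (g y)) (df * dg).
Proof. by move=> Dg Df; exact: is_derive1_comp. Qed.

Lemma der_lin (c : R) x : is_derive x 1 (fun y => c * y) c.
Proof. by rewrite -[X in is_derive _ _ _ X]mulr1; apply: derZ; exact: is_derive_id. Qed.

Lemma der_continuous f : (forall x, exists d, is_derive x 1 f d) -> continuous f.
Proof.
move=> Df x; have [d Dx] := Df x.
by apply/differentiable_continuous/derivable1_diffP; case: Dx.
Qed.

End RealDerivatives.

(** * Abel means and Plancherel's identity *)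

Section AbelKernel.
Context {R : realType}.
Notation mu := (@lebesgue_measure R).
Implicit Types (f g : R -> R) (x : R).

(** Integrals over (0, oo) are written as integrals over the line of the function extended by zero,
    so that one set of lemmas on [L1] and [RI] serves both. *)
Definition on_pos f : R -> R := f \_ `]0, +oo[.

Lemma on_posE f x : on_pos f x = if 0 < x then f x else 0.
Proof. by rewrite /on_pos patchE mem_setE in_itv /= andbT. Qed.

Lemma measurable_on_pos f : measurable_fun (`]0, +oo[%classic : set R) f ->
  measurable_fun setT (on_pos f).
Proof. by move=> mf; exact/(measurable_restrictT f (measurable_itv _)). Qed.

(** Nonnegativity lets the fundamental theorem be read in the extended reals, so integrability
    follows from the existence of the limit [l]. *)
Lemma L1_FTC f (F : R -> R) (l : R) : (forall x, 0 <= f x) -> continuous f ->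
  (forall x, is_derive x 1 F (f x)) -> F x @[x --> +oo%R] --> l ->
  L1 (on_pos f) /\ RI (on_pos f) = l - F 0.
Proof.
move=> f0 cf DF Fl.
have cF : continuous F by apply: der_continuous => x; exists (f x).
have mf : measurable_fun setT f by exact: continuous_measurable_fun.
have H : (\int[mu]_(x in `[0%R, +oo[) (f x)%:E = l%:E - (F 0)%:E)%E.
  apply: ge0_continuous_FTC2y => //.
  - exact: continuous_subspaceT.
  - by apply: cvg_at_right_filter; exact: cF.
  - by move=> x _; rewrite derive1E; have [_ ->] := DF x.
have H' : (\int[mu]_x (on_pos f x)%:E = (l - F 0)%:E)%E.
  rewrite EFinB -H -integral_itv_obnd_cbnd; last exact/measurable_EFinP/measurable_funTS.
  by rewrite [RHS]integral_mkcond restrict_EFin.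
have L : L1 (on_pos f).
  apply/L1_ge0P; last by rewrite H' ltry.
    by apply: measurable_on_pos; exact: measurable_funTS.
  by move=> x; rewrite on_posE; case: ifP.
by split=> //; apply: EFin_inj; rewrite -RIE.
Qed.

Lemma cvg_expRNM (e : R) : 0 < e -> expR (- (e * x)) @[x --> +oo%R] --> (0 : R).
Proof.
move=> e0; apply: (@cvg_comp _ _ _ (fun x => e * x) (fun x => expR (- x)) _ +oo%R); last exact: cvgr_expR.
by apply: gt0_cvgMry => //; exact: cvg_id.
Qed.

(** The integrand with the cosine changes sign, so [L1_FTC] does not apply to it; it is applied to
    [expR (- (e * y))] and to [expR (- (e * y)) * (1 + cos (u * y))], and the difference is
    taken. *)
Lemma RI_exp_cos (e u : R) : 0 < e ->
  [/\ L1 (on_pos (fun y => expR (- (e * y)))),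
  L1 (on_pos (fun y => expR (- (e * y)) * cos (u * y))) &
  RI (on_pos (fun y => expR (- (e * y)) * cos (u * y))) = e / (e ^+ 2 + u ^+ 2)].
Proof.
move=> e0.
have e2u2 : e ^+ 2 + u ^+ 2 != 0 by rewrite gt_eqF // ltr_wpDr ?sqr_ge0 // exprn_gt0.
have en0 : e != 0 by rewrite gt_eqF.
have Dexp x : is_derive x 1 (fun y : R => expR (- (e * y))) (expR (- (e * x)) * (- e)).
  by apply: der_comp; apply: derN; exact: der_lin.
have Dcos x : is_derive x 1 (fun y : R => cos (u * y)) (- sin (u * x) * u).
  by apply: (der_comp (f := cos)); exact: der_lin.
have Dsin x : is_derive x 1 (fun y : R => sin (u * y)) (cos (u * x) * u).
  by apply: (der_comp (f := sin)); exact: der_lin.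
have [L1e RIe] : L1 (on_pos (fun y => expR (- (e * y)))) /\
   RI (on_pos (fun y => expR (- (e * y)))) = 0 - (- e^-1 * expR (- (e * 0))).
  apply: (@L1_FTC _ (fun y => - e^-1 * expR (- (e * y)))).
  - by move=> x; exact: expR_ge0.
  - by apply: der_continuous => x; eexists; exact: Dexp.
  - by move=> x; apply: is_derive_eq (derZ (- e^-1) (Dexp x)) _; field.
  - by rewrite -(mulr0 (- e^-1)); apply: cvgMr; exact: cvg_expRNM.
(* Antiderivative of the nonnegative combination; its second term is what two integrations by parts
   give for the damped cosine. *)
pose F y := - e^-1 * expR (- (e * y)) +
  expR (- (e * y)) * ((e ^+ 2 + u ^+ 2)^-1 * (- e * cos (u * y) + u * sin (u * y))).
have [L1c RIc] : L1 (on_pos (fun y => expR (- (e * y)) * (1 + cos (u * y)))) /\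
   RI (on_pos (fun y => expR (- (e * y)) * (1 + cos (u * y)))) = 0 - F 0.
  apply: L1_FTC.
  - by move=> x; rewrite mulr_ge0 ?expR_ge0 // -lerBlDl sub0r cos_geN1.
  - apply: der_continuous => x; eexists.
    exact: (derM (Dexp x) (derD (der_cst 1 x) (Dcos x))).
  - move=> x; apply: is_derive_eq (derD (derZ _ (Dexp x)) (derM (Dexp x)
      (derZ _ (derD (derZ _ (Dcos x)) (derZ _ (Dsin x)))))) _.
    field; rewrite ?en0 ?e2u2 /=. by [].
  - pose C := e^-1 + (e ^+ 2 + u ^+ 2)^-1 * (e + `|u|).
    have FC y : `|F y| <= C * expR (- (e * y)).
      rewrite /F /C mulrDl; apply: le_trans (ler_normD _ _) _; apply: lerD.
        by rewrite normrM normrN !ger0_norm ?expR_ge0 // invr_ge0 ltW.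
      rewrite normrM (mulrC `|expR _|) (ger0_norm (expR_ge0 _)) ler_wpM2r ?expR_ge0 //.
      have p0 : 0 <= (e ^+ 2 + u ^+ 2)^-1 by rewrite invr_ge0 addr_ge0 ?sqr_ge0.
      rewrite normrM ger0_norm // ler_wpM2l //.
      apply: le_trans (ler_normD _ _) _; rewrite !normrM normrN (gtr0_norm e0).
      by apply: lerD; apply: ler_piMr; rewrite ?normr_ge0 ?(ltW e0) // ler_norml
        ?cos_geN1 ?cos_le1 ?sin_geN1 ?sin_le1.
    have c0 : C * expR (- (e * x)) @[x --> +oo%R] --> (0 : R).
      by rewrite -(mulr0 C); apply: cvgMr; exact: cvg_expRNM.
    have cN0 : - (C * expR (- (e * x))) @[x --> +oo%R] --> (0 : R).
      by rewrite -oppr0; apply: cvgN.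
    apply: (squeeze_cvgr _ cN0 c0); apply: nearW => y.
    by rewrite -ler_norml.
have -> : on_pos (fun y => expR (- (e * y)) * cos (u * y)) =
   (fun y => on_pos (fun y => expR (- (e * y)) * (1 + cos (u * y))) y -
             on_pos (fun y => expR (- (e * y))) y).
  by apply/funext => y; rewrite !on_posE; case: ifP => _; [ring|rewrite subr0].
split => //; first exact: L1B.
rewrite RIB // RIe RIc /F !mulr0 oppr0 expR0 cos0 sin0.
field; rewrite ?en0 ?e2u2 /=. by [].
Qed.

(** The Poisson kernel of the half-plane without its normalising constant: its mass is [pi], which
    is the factor [pi] in the limits below. *)
Definition poisson (e u : R) : R := e / (e ^+ 2 + u ^+ 2).

Lemma poisson_ge0 e u : 0 < e -> 0 <= poisson e u.
Proof. by move=> e0; rewrite divr_ge0 ?(ltW e0) // addr_ge0 ?sqr_ge0. Qed.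

Lemma poisson_den e u : 0 < e -> 0 < e ^+ 2 + u ^+ 2 :> R.
Proof. by move=> e0; rewrite ltr_wpDr ?sqr_ge0 // exprn_gt0. Qed.

Lemma continuous_poisson e : 0 < e -> continuous (poisson e).
Proof.
move=> e0 u; rewrite /poisson; apply: cvgMr; apply: cvgV.
  by rewrite gt_eqF // poisson_den.
by apply: cvgD; [exact: cvg_cst|exact: exprn_continuous].
Qed.

Lemma RI_poisson e : 0 < e -> L1 (poisson e) /\ RI (poisson e) = pi.
Proof.
move=> e0; have en0 : e != 0 by rewrite gt_eqF.
have [L1p RIp] : L1 (on_pos (poisson e)) /\
    RI (on_pos (poisson e)) = pi / 2 - atan (e^-1 * 0).
  apply: (@L1_FTC _ (fun u => atan (e^-1 * u))).
  - by move=> u; exact: poisson_ge0.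
  - exact: continuous_poisson.
  - move=> u; apply: is_derive_eq (der_comp (f := atan) (der_lin _ _) (is_derive1_atan _)) _.
    rewrite /poisson; field; rewrite en0 /=.
    by rewrite gt_eqF // poisson_den.
  - apply: (@cvg_comp _ _ _ (fun x => e^-1 * x) atan _ +oo%R); last exact: cvgy_atan.
    by apply: gt0_cvgMry; [rewrite invr_gt0|exact: cvg_id].
have mp : measurable_fun setT (poisson e).
  by apply: continuous_measurable_fun; exact: continuous_poisson.
have H : (\int[mu]_u (poisson e u)%:E = pi%:E)%E.
  rewrite ge0_symfun_integralT.
  - rewrite -set_itvcy -integral_itv_obnd_cbnd; last exact/measurable_EFinP/measurable_funTS.
    rewrite integral_mkcond restrict_EFin -/(on_pos _) RIE // RIp mulr0 atan0 subr0 -EFinM.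
    by rewrite mulrC divfK.
  - by move=> u; exact: poisson_ge0.
  - exact: continuous_poisson.
  - by move=> u; rewrite /poisson /= sqrrN.
have L : L1 (poisson e).
  by apply/L1_ge0P => // [u|]; [exact: poisson_ge0|rewrite H ltry].
by split=> //; apply: EFin_inj; rewrite -RIE.
Qed.

Lemma RI_poisson_shift e y0 : 0 < e ->
  L1 (fun t => poisson e (t - y0)) /\ RI (fun t => poisson e (t - y0)) = pi.
Proof.
move=> e0; have [L P] := RI_poisson e0.
by split; [exact: L1_shift|rewrite RI_shift].
Qed.

(** Approximate identity argument. Near [y0] continuity bounds the difference by a small multiple of
    the kernel. Away from [y0] the kernel is of order [e], and two majorants are used:
    [e * del ^- 2], paired with the integrable [k], and a multiple of [e * poisson 1 (t - y0)],
    paired with the constant [k y0], which is not integrable by itself. *)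
Lemma poisson_limit k (y0 : R) : L1 k -> {for y0, continuous k} ->
  forall eta : R, 0 < eta -> exists2 d : R, 0 < d & forall e, 0 < e < d ->
    `|RI (fun t => k t * poisson e (t - y0)) - pi * k y0| <= eta.
Proof.
move=> k1 ck eta eta0.
have pi0 : 0 < pi :> R by exact: pi_gt0.
have c0 : 0 < eta / (2 * pi) by rewrite divr_gt0 // mulr_gt0.
have /(@cvgrPdist_le _ _ _ _ _ _ _)/(_ _ c0)/nbhs_ballP[del /= del0 near_k] := ck.
(* The far contribution divided by [e]; the bound imposed on [e] makes [e * A] at most [eta / 2]. *)
pose A := RI (fun t => `|k t|) / del ^+ 2 + `|k y0| * (1 + del ^- 2) * pi.
have i0 : 0 <= del ^- 2 by rewrite invr_ge0 sqr_ge0.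
have A0 : 0 <= A.
  apply: addr_ge0; first by rewrite mulr_ge0 // RI_ge0.
  by rewrite mulr_ge0 ?(ltW pi0) // mulr_ge0 // addr_ge0.
exists (eta / (2 * (A + 1))).
  by rewrite divr_gt0 // mulr_gt0 // ltr_wpDl.
move=> e /andP[e0 ed].
have [Lp Rp] := RI_poisson_shift y0 e0.
have [Lp1 Rp1] := @RI_poisson_shift 1 y0 ltr01.
have mp : measurable_fun setT (fun t : R => poisson e (t - y0)) by exact: L1_measurable.
have pe t : `|poisson e (t - y0)| <= e^-1.
  rewrite ger0_norm ?poisson_ge0 // /poisson ler_pdivrMr ?poisson_den //.
  rewrite mulrDr expr2 mulrA mulVf ?gt_eqF // mul1r lerDl.
  by rewrite mulr_ge0 ?sqr_ge0 // invr_ge0 ltW.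
have Lkp : L1 (fun t => k t * poisson e (t - y0)) by exact: L1_mul_bounded mp pe k1.
have -> : pi * k y0 = RI (fun t => k y0 * poisson e (t - y0)) by rewrite RIZ // Rp mulrC.
rewrite -RIB //; last exact: L1Z.
pose g t := eta / (2 * pi) * poisson e (t - y0) +
  e * (del ^- 2 * `|k t| + `|k y0| * (1 + del ^- 2) * poisson 1 (t - y0)).
have Lkn := L1_norm k1.
have Lg : L1 g by apply: L1D; apply: L1Z => //; apply: L1D; exact: L1Z.
apply: (le_trans (norm_RI_le (g := g) _ _ _)) => //.
- by apply: L1B => //; exact: L1Z.
- move=> t; rewrite -mulrBl normrM (ger0_norm (poisson_ge0 _ e0)) /g.
  have p1 := poisson_ge0 (t - y0) e0.
  have p2 := @poisson_ge0 1 (t - y0) ltr01.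
  have h2 : 0 <= e * (del ^- 2 * `|k t| + `|k y0| * (1 + del ^- 2) * poisson 1 (t - y0)).
    rewrite mulr_ge0 ?(ltW e0) // addr_ge0 // mulr_ge0 // mulr_ge0 //.
    by rewrite addr_ge0.
  have [tl|tg] := ltP `|t - y0| del.
    apply: ler_wpDr => //; rewrite ler_wpM2r // distrC.
    by apply: near_k; rewrite /ball /= distrC.
  apply: ler_wpDl; first by rewrite mulr_ge0 // ltW.
  have u2 : del ^+ 2 <= (t - y0) ^+ 2 by rewrite -[leRHS]real_normK ?num_real // lerXn2r // nnegrE ?(ltW del0).
  have d2 : 0 < del ^+ 2 by rewrite exprn_gt0.
  have u0 : 0 < (t - y0) ^+ 2 by exact: lt_le_trans u2.
  have q1 : poisson e (t - y0) <= e * del ^- 2.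
    rewrite /poisson ler_pM2l // lef_pV2 ?posrE ?poisson_den //.
    by apply: le_trans u2 _; rewrite lerDr sqr_ge0.
  have q2 : poisson e (t - y0) <= e * ((1 + del ^- 2) * poisson 1 (t - y0)).
    rewrite /poisson ler_pM2l // mul1r expr1n -[X in X <= _]mul1r.
    rewrite ler_pdivrMr ?poisson_den // mulrAC ler_pdivlMr; last first.
      by rewrite ltr_wpDr ?sqr_ge0.
    rewrite mul1r [leRHS]mulrDr.
    have : 1 <= del ^- 2 * (t - y0) ^+ 2 by rewrite mulrC ler_pdivlMr ?mul1r.
    have : 0 <= (1 + del ^- 2) * e ^+ 2 by rewrite mulr_ge0 ?sqr_ge0 // addr_ge0.
    by nra.
  apply: le_trans (ler_wpM2r p1 (ler_normB _ _)) _.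
  rewrite mulrDl mulrDr; apply: lerD.
    by rewrite mulrC mulrA ler_wpM2r.
  by rewrite -(mulrA `|k y0|) (mulrCA e) ler_wpM2l.
- rewrite /g RID; [|exact: L1Z|by apply: L1Z; apply: L1D; exact: L1Z].
  rewrite RIZ // Rp RIZ; last by apply: L1D; exact: L1Z.
  rewrite RID; [|exact: L1Z|exact: L1Z].
  rewrite RIZ // RIZ // Rp1 (mulrC (del ^- 2)) -/A.
  have -> : eta / (2 * pi) * pi = eta / 2.
    by rewrite invfM mulrA divfK // gt_eqF.
  have : e * A <= eta / 2.
    have: e * (A + 1) <= eta / 2.
      rewrite -ler_pdivlMr ?ltr_wpDl //; apply: le_trans (ltW ed) _.
      by rewrite invfM mulrA.
    by rewrite mulrDr mulr1; lra.
  by lra.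
Qed.

(** A product majorant makes every section integrable, not merely almost every one. *)
Lemma RI_fubini_le (f : R * R -> R) (g k : R -> R) :
  measurable_fun setT f -> L1 g -> L1 k ->
  (forall x y, `|f (x, y)| <= g x * k y) ->
  [/\ RI (fun x => RI (fun y => f (x, y))) = RI (fun y => RI (fun x => f (x, y))),
      L1 (fun x => RI (fun y => f (x, y))),
      L1 (fun y => RI (fun x => f (x, y))),
      forall x, L1 (fun y => f (x, y)) &
      forall y, L1 (fun x => f (x, y)) ].
Proof.
move=> mf g1 k1 fgk.
have sec1 x : L1 (fun y => f (x, y)).
  apply: L1_le (fgk x) _; last exact: L1Z.
  by apply: (measurableT_comp mf).
have sec2 y : L1 (fun x => f (x, y)).
  apply: L1_le (fun x => fgk x y) _; last first.
    by apply: eq_L1 (L1Z (k y) g1) => x; rewrite mulrC.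
  by apply: (measurableT_comp mf).
have B x : (\int[mu]_y `|f (x, y)|%:E <= (`|g x| * RI (fun y => `|k y|))%:E)%E.
  rewrite -RIZ; last exact: L1_norm.
  rewrite RIE; last exact: L1_norm.
  rewrite lee_fin; apply: le_RI; [exact: L1_norm| |].
    by apply: L1Z; exact: L1_norm.
  by move=> y; rewrite -normrM; apply: le_trans (fgk x y) _; exact: ler_norm.
have mfn : measurable_fun setT (fun z => `|f z|%:E).
  by apply/measurable_EFinP; exact: measurableT_comp.
have foo : (\int[mu]_x \int[mu]_y `|f (x, y)|%:E < +oo)%E.
  have L : L1 (fun x => RI (fun y => `|k y|) * `|g x|) by apply: L1Z; exact: L1_norm.
  apply: (@le_lt_trans _ _ (\int[mu]_x (RI (fun y => `|k y|) * `|g x|)%:E)%E).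
    apply: ge0_le_integral => //.
    - by move=> x _; exact: integral_ge0.
    - exact: (@measurable_fun_fubini_tonelli_F _ _ _ _ _ mu (fun z => `|f z|%:E)).
    - by have /measurable_EFinP := L1_measurable L.
    - by move=> x _; rewrite mulrC.
  by rewrite RIE // ltry.
by have [] := RI_fubini2 mf foo.
Qed.

Lemma measurable_of_fst f : measurable_fun setT f ->
  measurable_fun setT (fun z : R * R => f z.1).
Proof. by move=> mf; exact: measurableT_comp. Qed.

Lemma measurable_of_snd f : measurable_fun setT f ->
  measurable_fun setT (fun z : R * R => f z.2).
Proof. by move=> mf; exact: measurableT_comp. Qed.

Lemma measurable_cosM (f g : R * R -> R) : measurable_fun setT f ->
  measurable_fun setT g -> measurable_fun setT (fun z => cos (f z * g z)).
Proof.
move=> mf mg; apply: measurableT_comp; last exact: measurable_funM.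
exact: continuous_measurable_fun (@continuous_cos R).
Qed.

Lemma norm_cos_le1 x : `|cos x| <= 1.
Proof. by rewrite ler_norml cos_geN1 cos_le1. Qed.

Lemma norm_sin_le1 x : `|sin x| <= 1.
Proof. by rewrite ler_norml sin_geN1 sin_le1. Qed.

Lemma L1_cos f g : measurable_fun setT g -> L1 f -> L1 (fun t => f t * cos (g t)).
Proof.
move=> mg f1; apply: (@L1_mul_bounded _ f (fun t => cos (g t)) 1) => //; last first.
  by move=> t; exact: norm_cos_le1.
by apply: measurableT_comp => //; exact: continuous_measurable_fun (@continuous_cos R).
Qed.

Lemma L1_sin f g : measurable_fun setT g -> L1 f -> L1 (fun t => f t * sin (g t)).
Proof.
move=> mg f1; apply: (@L1_mul_bounded _ f (fun t => sin (g t)) 1) => //; last first.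
  by move=> t; exact: norm_sin_le1.
by apply: measurableT_comp => //; exact: continuous_measurable_fun (@continuous_sin R).
Qed.

Lemma RI0 : RI (fun=> 0) = 0 :> R.
Proof. by rewrite /RI /Rintegral integral0. Qed.

(** The damping makes the double integral absolutely convergent; after the exchange the inner
    integral is that of [RI_exp_cos], namely the Poisson kernel. *)
Lemma abel_fubini k y0 e : L1 k -> 0 < e ->
  RI (on_pos (fun y => expR (- (e * y)) * RI (fun t => k t * cos ((t - y0) * y)))) =
  RI (fun t => k t * poisson e (t - y0)).
Proof.
move=> k1 e0; have [Le _ _] := RI_exp_cos 0 e0.
have mk := L1_measurable k1; have me := L1_measurable Le.
pose f (z : R * R) := on_pos (fun y => expR (- (e * y))) z.1 * (k z.2 * cos ((z.2 - y0) * z.1)).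
have mf : measurable_fun setT f.
  apply: measurable_funM; first exact: measurable_of_fst.
  apply: measurable_funM; first exact: measurable_of_snd.
  apply: (@measurable_cosM (fun z => z.2 - y0) (fun z => z.1)); last exact: measurable_fst.
  by apply: measurable_funB => //; exact: measurable_snd.
have fb x y : `|f (x, y)| <= on_pos (fun y => expR (- (e * y))) x * `|k y|.
  rewrite /f /= !normrM ger0_norm; last by rewrite on_posE; case: ifP => // _; exact: expR_ge0.
  rewrite ler_wpM2l //; first by rewrite on_posE; case: ifP => // _; exact: expR_ge0.
  by rewrite ler_piMr // ler_norml cos_geN1 cos_le1.
have [E _ _ _ _] := RI_fubini_le mf Le (L1_norm k1) fb.
transitivity (RI (fun x => RI (fun y => f (x, y)))).
  apply: eq_RI => y; rewrite /f /= on_posE [in RHS]on_posE; case: ifP => y0'.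
    rewrite RIZ; first by [].
    apply: (L1_cos _ k1); apply: measurable_funM; last exact: measurable_cst.
    exact: measurable_funB.
  rewrite (@eq_RI _ _ (fun=> 0)); last by move=> x; rewrite mul0r.
  by rewrite RI0.
rewrite E; apply: eq_RI => t; rewrite /f /=.
have [_ L2 R2] := RI_exp_cos (t - y0) e0.
rewrite /poisson -R2 -RIZ //.
by apply: eq_RI => y; rewrite !on_posE; case: ifP => _; ring.
Qed.

(** Fourier inversion in the sense of Abel. The cosine transform of [k] need not be integrable, and
    continuity of [k] is asked at [y0] alone; the cosine centred at [y0] combines the cosine and
    sine transforms. *)
Lemma abel_limit k (y0 : R) : L1 k -> {for y0, continuous k} ->
  forall eta : R, 0 < eta -> exists2 d : R, 0 < d & forall e, 0 < e < d ->
    `|RI (on_pos (fun y => expR (- (e * y)) * RI (fun t => k t * cos ((t - y0) * y))))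
      - pi * k y0| <= eta.
Proof.
move=> k1 ck eta eta0; have [d d0 H] := poisson_limit k1 ck eta0.
by exists d => // e /[dup] /andP[e0 _] ed; rewrite abel_fubini //; exact: H.
Qed.

End AbelKernel.

(** * Translations in [L1], autocorrelation and Plancherel's identity *)

Section Plancherel.
Context {R : realType}.
Notation mu := (@lebesgue_measure R).
Implicit Types (f g h : R -> R) (x : R).

Lemma measurable_EFin f : measurable_fun setT f ->
  measurable_fun setT (fun x : R => (f x)%:E).
Proof. by move=> mf; apply/measurable_EFinP. Qed.

(** Sequences bounded by 1 suffice, which later gives one dominating function for all translates; an
    arbitrary null sequence is shifted past the index after which it is so bounded. *)
Lemma seq_continuous0 (F : R -> R) (l : R) :
  (forall u : nat -> R, u n @[n --> \oo] --> (0 : R) -> (forall n, `|u n| <= 1) ->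
     F (u n) @[n --> \oo] --> l) ->
  F x @[x --> (0 : R)] --> l.
Proof.
move=> H; apply/(@cvg_nbhsP _ R^o) => u u0.
have /(@cvgrPdist_le _ _ _ _ _ _ _)/(_ _ ltr01)[N _ HN] := u0.
rewrite -(cvg_shiftn N (fun n => F (u n))).
apply: (H (fun n => u (n + N)%N)).
  by rewrite (cvg_shiftn N u).
move=> n; have /= := HN (n + N)%N; rewrite sub0r normrN; apply.
by rewrite leq_addl.
Qed.

Definition cut (M : R) g : R -> R := g \_ `[- M, M].

Lemma cutE M g s : cut M g s = if `|s| <= M then g s else 0.
Proof. by rewrite /cut patchE mem_setE in_itv /= -ler_norml. Qed.

Lemma measurable_cut M g : measurable_fun setT g -> measurable_fun setT (cut M g).
Proof.
move=> mg; apply/(measurable_restrictT g (measurable_itv _)).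
exact: measurable_funTS.
Qed.

(** Dominated convergence along a sequence of translations: translates by at most 1 vanish outside
    [[- (M + 1), M + 1]], and pointwise convergence can fail only at the two jumps [M] and [- M]. *)
Lemma truncated_translation g (M : R) : continuous g -> 0 < M ->
  let p : R -> R := cut M g in
  L1 p /\ RI (fun s => `|p (s + t) - p s|) @[t --> (0 : R)] --> (0 : R).
Proof.
move=> cg M0 p.
have pE s : p s = if `|s| <= M then g s else 0.
  exact: cutE.
have NMM : - M <= M by rewrite (@le_trans _ _ 0) ?oppr_le0 ?ltW.
have [c _ Hc] : exists2 c, c \in `[- M, M]%R & forall t, t \in `[- M, M]%R -> `|g t| <= `|g c|.
  apply: (@EVT_max R (fun x => `|g x|)) => //.
  apply: continuous_subspaceT => x; apply: (@continuous_comp _ _ _ g Num.norm); first exact: cg.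
  exact: norm_continuous.
pose K : R := `|g c|.
have pK s : `|p s| <= K.
  rewrite pE; case: ifPn => [sM|_]; last by rewrite normr0 /K.
  by apply: Hc; rewrite in_itv /= -ler_norml.
have mg : measurable_fun setT g by exact: continuous_measurable_fun.
have mp : measurable_fun setT p by exact: measurable_cut.
have Lcst (B : R) : L1 (fun s : R => (2 * K) * \1_(`[- B, B]%classic) s).
  by apply: L1Z; exact: integrable_indic_itv.
have L1p : L1 p.
  apply: L1_le (Lcst M) => // s; rewrite pE indicE mem_setE in_itv /= -ler_norml.
  case: ifPn => [sM|_]; last by rewrite normr0 mulr0.
  rewrite mulr1; apply: (@le_trans _ _ K); first by apply: Hc; rewrite in_itv /= -ler_norml.
  by rewrite ler_peMl ?ler1n /K.
split => //; apply: seq_continuous0 => u u0 u1.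
have mpu n : measurable_fun setT (fun s : R => `|p (s + u n) - p s|).
  apply: measurableT_comp => //; apply: measurable_funB => //.
  by apply: (measurableT_comp mp); exact: measurable_shift.
have -> : (0 : R) = RI (fun _ : R => 0) by rewrite RI0.
apply: (proj2 (@RI_dct_ae _ (fun n s => `|p (s + u n) - p s|) (fun=> 0)
   (fun s : R => (2 * K) * \1_(`[- (M + 1), M + 1]%classic) s) mpu _ (Lcst _) _ _)).
- exact: measurable_cst.
- move=> n s; rewrite normr_id indicE mem_setE in_itv /= -ler_norml.
  have [sM|sM] := leP `|s| (M + 1); rewrite /= ?mulr1 ?mulr0.
    apply: le_trans (ler_normB _ _) _; rewrite mulr_natl mulr2n; exact: lerD.
  rewrite !pE !ifF ?subrr ?normr0 //; apply/negbTE; rewrite -ltNge.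
    by apply: lt_trans sM; rewrite ltrDl.
  have := ler_normB (s + u n) (u n); rewrite addrK => h.
  by have := u1 n; lra.
exists [set M; - M]; split.
- by apply: measurableU; exact: measurable_set1.
- by apply: countable_lebesgue_measure0; apply: finite_set_countable; exact: finite_set2.
- move=> s /= H; apply: contrapT => sM; apply: H.
  have cus : s + u n @[n --> \oo] --> s.
    by rewrite -[X in _ --> X]addr0; apply: cvgD => //; exact: cvg_cst.
  have cabs : `|s + u n| @[n --> \oo] --> `|s| by exact: cvg_norm.
  have [lt|gt|e] := ltgtP `|s| M.
  + suff H : p (s + u n) @[n --> \oo] --> p s.
      rewrite -(normr0 R) -(subrr (p s)); apply: cvg_norm; apply: cvgB => //; exact: cvg_cst.
    rewrite [p s]pE (ltW lt).
    have : g (s + u n) @[n --> \oo] --> g s by apply: continuous_cvg => //; exact: cg.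
    apply: cvg_trans; apply: near_eq_cvg; near=> n; rewrite pE ifT //.
    by near: n; apply: (cvgr_le `|s|).
  + suff H : p (s + u n) @[n --> \oo] --> p s.
      rewrite -(normr0 R) -(subrr (p s)); apply: cvg_norm; apply: cvgB => //; exact: cvg_cst.
    rewrite [p s]pE ifF; last by rewrite leNgt gt.
    have : (fun _ : nat => 0 : R) n @[n --> \oo] --> (0 : R) by exact: cvg_cst.
    apply: cvg_trans; apply: near_eq_cvg; near=> n; rewrite pE ifF //.
    apply/negbTE; rewrite -ltNge.
    by near: n; apply: (cvgr_gt `|s|).
  + exfalso; apply: sM; have [s0|s0] := leP 0 s.
      by left; rewrite -e ger0_norm.
    by right; rewrite -e ltr0_norm // opprK.
Unshelve. all: by end_near. Qed.

(** Two errors of [eta / 2]: discarding the part outside a large interval, then approximating by a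
    continuous function on that interval. *)
Lemma L1_approx h (eta : R) : L1 h -> 0 < eta ->
  exists g : R -> R, exists2 M : R, 0 < M & continuous g /\
     RI (fun s => `|h s - cut M g s|) <= eta.
Proof.
move=> h1 eta0; have mh := L1_measurable h1.
pose hn (n : nat) := cut n.+1%:R h.
have hnE n s : hn n s = if `|s| <= n.+1%:R then h s else 0.
  exact: cutE.
have mhn n : measurable_fun setT (hn n) by exact: measurable_cut.
have L1hn n : L1 (hn n).
  apply: L1_le (L1_norm h1) => // s; rewrite hnE; case: ifP => // _.
  by rewrite normr0.
have [_ ] : L1 (fun _ : R => 0 : R) /\ RI (fun s => `|h s - hn n s|) @[n --> \oo] --> RI (fun _ : R => 0 : R).
  apply: (@RI_dct _ _ _ (fun s => `|h s|)).
  - by move=> n; apply: measurableT_comp => //; exact: measurable_funB.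
  - exact: L1_norm.
  - move=> n s; rewrite normr_id hnE; case: ifP => _; last by rewrite subr0.
    by rewrite subrr normr0.
  - move=> s; have : (fun _ : nat => 0 : R) n @[n --> \oo] --> (0 : R) by exact: cvg_cst.
    apply: cvg_trans; apply: near_eq_cvg; near=> n; rewrite hnE ifT ?subrr ?normr0 //.
    near: n; exists (Num.bound `|s|) => // n /= sn.
    apply: (@le_trans _ _ (Num.bound `|s|)%:R); last by rewrite ler_nat (leq_trans sn).
    by apply/ltW; rewrite archi_boundP.
rewrite RI0 => /cvgrPdist_le /(_ (eta / 2)) [|N _ HN]; first by rewrite divr_gt0.
have {HN} := HN N (leqnn N) => /=; rewrite sub0r normrN ger0_norm; last by apply: RI_ge0.
move=> HN.
pose M : R := N.+1%:R; have M0 : 0 < M by rewrite ltr0n.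
have [|||g_ [cg ig cvg]] := @approximation_continuous_integrable R (`[- M, M]) h.
- exact: measurable_itv.
- have : (mu ([set` `[- M, M]%R] : set R) < +oo)%E by rewrite lebesgue_measure_itv /=; case: ifP => _; rewrite -?EFinB ltry.
  by [].
- by apply: integrableS h1.
have /fine_cvg /cvgrPdist_le /(_ (eta / 2)) [|k _ Hk] := cvg; first by rewrite divr_gt0.
exists (g_ k), M => //; split; first exact: cg.
have {Hk} := Hk k (leqnn k) => /=; rewrite sub0r normrN.
have L1g : L1 (cut M (g_ k)) by have [] := truncated_translation (cg k) M0.
have -> : (\int[mu]_(z in `[(- M)%R, M]) `|(h z - g_ k z)%:E| = (RI (fun z => `|hn N z - cut M (g_ k) z|))%:E)%E.
  rewrite -RIE; last by apply: L1_norm; exact: L1B.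
  rewrite integral_mkcond; apply: eq_integral => z _; rewrite /hn /cut !patchE -/M.
  by case: ifP => //; rewrite subrr normr0.
rewrite /= ger0_norm; last exact: RI_ge0.
move=> Hk; apply: (@le_trans _ _ (RI (fun s => `|h s - hn N s| + `|hn N s - cut M (g_ k) s|))).
  apply: le_RI.
  - by apply: L1_norm; exact: L1B.
  - by apply: L1D; apply: L1_norm; exact: L1B.
  - by move=> s; apply: ler_distD.
rewrite RID; [|by apply: L1_norm; exact: L1B..].
by rewrite [leRHS](splitr eta); exact: lerD.
Unshelve. all: by end_near. Qed.

(** Three terms of [eta / 3]: the approximation error twice, equal by translation invariance, and
    the translation error of the truncated continuous function. *)
Lemma L1_translation h : L1 h ->
  RI (fun s => `|h (s + t) - h s|) @[t --> (0 : R)] --> (0 : R).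
Proof.
move=> h1; apply/cvgrPdist_le => eta eta0.
have e3 : 0 < eta / 3 by rewrite divr_gt0.
have [g [M M0 [cg Hg]]] := L1_approx h1 e3.
have [L1p] := truncated_translation cg M0.
set p := cut M g in Hg L1p *.
move=> /cvgrPdist_le /(_ _ e3); apply: filterS => t.
rewrite !sub0r !normrN !ger0_norm; try exact: RI_ge0.
move=> Ht.
have L1hp : L1 (fun s => `|h s - p s|) by apply: L1_norm; exact: L1B.
have L1hpt : L1 (fun s => `|h (s + t) - p (s + t)|).
  exact: (L1_shift t L1hp).
have L1pt : L1 (fun s => `|p (s + t) - p s|).
  by apply: L1_norm; apply: L1B => //; exact: L1_shift.
apply: (@le_trans _ _ (RI (fun s => `|h (s + t) - p (s + t)| + (`|p (s + t) - p s| + `|h s - p s|)))).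
  apply: le_RI.
  - by apply: L1_norm; apply: L1B => //; exact: L1_shift.
  - by apply: L1D => //; exact: L1D.
  - move=> s; apply: le_trans (ler_distD (p (s + t)) _ _) _.
    rewrite lerD2l; apply: le_trans (ler_distD (p s) _ _) _.
    by rewrite lerD2l distrC.
rewrite RID //; last exact: L1D.
rewrite RID // (RI_shift t L1hp).
have : RI (fun s => `|p (s + t) - p s|) <= eta / 3 by [].
by move: Hg; lra.
Qed.

Definition fcos h (y : R) : R := RI (fun t => h t * cos (t * y)).
Definition fsin h (y : R) : R := RI (fun t => h t * sin (t * y)).

Lemma measurable_mulr_cst (y : R) : measurable_fun setT (fun t : R => t * y).
Proof. by apply: measurable_funM => //; exact: measurable_cst. Qed.

Lemma continuous_fcos h : L1 h -> continuous (fcos h).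
Proof.
move=> h1 y; apply/(@cvg_nbhsP _ R^o) => u uy.
apply: (proj2 (@RI_dct _ (fun n t => h t * cos (t * u n)) (fun t => h t * cos (t * y)) (fun t => `|h t|) _ (L1_norm h1) _ _)).
- by move=> n; apply: L1_measurable; apply: (L1_cos _ h1); exact: measurable_mulr_cst.
- by move=> n t; rewrite normrM ler_piMr // norm_cos_le1.
- move=> t; apply: cvgMr; apply: continuous_cvg; first exact: continuous_cos.
  exact: cvgMr.
Qed.

Lemma continuous_fsin h : L1 h -> continuous (fsin h).
Proof.
move=> h1 y; apply/(@cvg_nbhsP _ R^o) => u uy.
apply: (proj2 (@RI_dct _ (fun n t => h t * sin (t * u n)) (fun t => h t * sin (t * y)) (fun t => `|h t|) _ (L1_norm h1) _ _)).
- by move=> n; apply: L1_measurable; apply: (L1_sin _ h1); exact: measurable_mulr_cst.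
- by move=> n t; rewrite normrM ler_piMr // norm_sin_le1.
- move=> t; apply: cvgMr; apply: continuous_cvg; first exact: continuous_sin.
  exact: cvgMr.
Qed.

Section Autocorrelation.
Variable h : R -> R.
Hypotheses (h1 : L1 h) (h2 : L1 (fun s => h s ^+ 2)).

Let mh : measurable_fun setT h. Proof. exact: L1_measurable. Qed.

Definition autocorr (t : R) : R := RI (fun s => h s * h (s + t)).

Let L1hh t : L1 (fun s => h s * h (s + t)).
Proof.
apply: (@L1_le _ _ (fun s => h s ^+ 2 + h (s + t) ^+ 2)).
- apply: measurable_funM => //; apply: (measurableT_comp mh).
  exact: measurable_shift.
- move=> s; rewrite normrM -[h s ^+ 2]real_normK ?num_real //.
  rewrite -[h (s + t) ^+ 2]real_normK ?num_real //.
  by have := normr_ge0 (h s); have := normr_ge0 (h (s + t)); nra.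
- by apply: L1D => //; exact: (L1_shift t h2).
Qed.

(** The bounded factor [g] is carried along so that the constant 1 gives integrability of the
    autocorrelation and a cosine gives its transform. *)
Let prod_fubini (g : R -> R) : measurable_fun setT g -> (forall t, `|g t| <= 1) ->
  RI (fun s => RI (fun t => h s * h (s + t) * g t)) = RI (fun t => autocorr t * g t) /\
  L1 (fun t => autocorr t * g t).
Proof.
move=> mg g1.
pose f (z : R * R) := h z.1 * h (z.1 + z.2) * g z.2.
have mf : measurable_fun setT f.
  apply: measurable_funM; last exact: measurable_of_snd.
  apply: measurable_funM; first exact: measurable_of_fst.
  apply: (measurableT_comp mh).
  by apply: measurable_funD; [exact: measurable_fst|exact: measurable_snd].
have L1g s : L1 (fun t => h (s + t) * g t).
  apply: (@L1_mul_bounded _ (fun t => h (s + t)) g 1) => //.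
  by apply: eq_L1 (L1_shift s h1) => t; rewrite addrC.
have foo : (\int[mu]_x \int[mu]_y `|f (x, y)|%:E < +oo)%E.
  have L : L1 (fun s => RI (fun y => `|h y|) * `|h s|) by apply: L1Z; exact: L1_norm.
  apply: (@le_lt_trans _ _ (\int[mu]_x (RI (fun y => `|h y|) * `|h x|)%:E)%E).
    apply: ge0_le_integral => //.
    - by move=> x _; exact: integral_ge0.
    - apply: (@measurable_fun_fubini_tonelli_F _ _ _ _ _ mu (fun z => `|f z|%:E)) => //.
      by apply/measurable_EFinP; exact: measurableT_comp.
    - by have /measurable_EFinP := L1_measurable L.
    - move=> x _; rewrite RIE; last first.
        apply: L1_norm; apply: eq_L1 (L1Z (h x) (L1g x)) => t.
        by rewrite /f /= mulrA.
      rewrite lee_fin mulrC -RIZ; last exact: L1_norm.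
      rewrite -(RI_shift x (L1Z `|h x| (L1_norm h1))); apply: le_RI.
      + apply: L1_norm; apply: eq_L1 (L1Z (h x) (L1g x)) => t.
        by rewrite /f /= mulrA.
      + exact: (L1_shift x (L1Z `|h x| (L1_norm h1))).
      + move=> t; rewrite /f /= !normrM (addrC t) ler_piMr ?mulr_ge0 //.
  by rewrite RIE // ltry.
have [E _ I] := RI_fubini2 mf foo.
have e t : RI (fun s => f (s, t)) = autocorr t * g t.
  rewrite mulrC -RIZ //; apply: eq_RI => s; rewrite /f /=; ring.
split; last exact: eq_L1 I.
by rewrite [LHS]E; apply: eq_RI => t; exact: e.
Qed.

Lemma L1_autocorr : L1 autocorr.
Proof.
have [||_ L] := @prod_fubini (fun=> 1).
- exact: measurable_cst.
- by move=> t; rewrite normr1.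
- by apply: eq_L1 L => t; rewrite mulr1.
Qed.

Lemma autocorr0 : autocorr 0 = RI (fun s => h s ^+ 2).
Proof. by apply: eq_RI => s; rewrite addr0 expr2. Qed.

(** The transform of an autocorrelation is the squared modulus of the transform: after a translation
    of the inner variable the addition formula splits the cosine. The phase is written [t - 0] to
    fit [abel_limit] at 0. *)
Lemma cos_autocorr y :
  RI (fun t => autocorr t * cos ((t - 0) * y)) = fcos h y ^+ 2 + fsin h y ^+ 2.
Proof.
have [||E _] := @prod_fubini (fun t => cos ((t - 0) * y)).
- apply: measurableT_comp; first exact: continuous_measurable_fun (@continuous_cos R).
  apply: measurable_funM; last exact: measurable_cst.
  exact: measurable_funB.
- by move=> t; exact: norm_cos_le1.
have Lc : L1 (fun t => h t * cos (t * y)) by apply: (L1_cos _ h1); exact: measurable_mulr_cst.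
have Ls : L1 (fun t => h t * sin (t * y)) by apply: (L1_sin _ h1); exact: measurable_mulr_cst.
rewrite -E !expr2 /fcos /fsin -!RIZ -?RID; try exact: L1Z; try done.
apply: eq_RI => s.
transitivity (h s * (cos (s * y) * fcos h y + sin (s * y) * fsin h y)); last by rewrite /fcos /fsin; ring.
rewrite /fcos /fsin -!RIZ // -RID; try exact: L1Z.
have L3 : L1 (fun t => cos (s * y) * (h t * cos (t * y)) + sin (s * y) * (h t * sin (t * y))).
  by apply: L1D; exact: L1Z.
rewrite -(RI_shift s L3) -RIZ; last exact: (L1_shift s L3).
apply: eq_RI => t; rewrite subr0 -mulrA; congr (_ * _).
rewrite (_ : t * y = (t + s) * y - s * y) ?cosB; last by ring.
by rewrite (addrC s t); ring.
Qed.

(** Continuity of translations is at hand in [L1], while [h] may be unbounded. Where [|h s| <= N]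
    the [L1] modulus is multiplied by [N]; elsewhere a weighted arithmetic-geometric inequality
    leaves the tail of [h ^+ 2], small for large [N], and a small multiple of the full integral of
    [h ^+ 2]. *)
Lemma autocorr_continuous0 : {for 0, continuous autocorr}.
Proof.
apply/cvgrPdist_le => /= eta eta0.
pose N2 := RI (fun s => h s ^+ 2).
have N20 : 0 <= N2 by apply: RI_ge0 => s; exact: sqr_ge0.
(* Weight of the arithmetic-geometric inequality: [c * (N2 + N2)] has to stay below [eta / 2], and
   the 1 covers [N2 = 0]. *)
pose c := eta / (4 * (N2 + 1)).
have c0 : 0 < c by rewrite divr_gt0 // mulr_gt0 // ltr_wpDl.
pose big n s := if `|h s| <= n%:R then 0 else h s ^+ 2.
have mbig n : measurable_fun setT (big n).
  apply: measurable_fun_ifT => //; last exact: measurable_funX.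
  by apply: measurable_fun_ler => //; exact: measurableT_comp.
have bigle n s : `|big n s| <= h s ^+ 2.
  by rewrite /big; case: ifP => _; rewrite ?normr0 ?sqr_ge0 // ger0_norm ?sqr_ge0.
have L1big n : L1 (big n) by exact: L1_le (mbig n) (bigle n) h2.
have [_] : L1 (fun _ : R => 0 : R) /\ RI (big n) @[n --> \oo] --> RI (fun _ : R => 0 : R).
  apply: (RI_dct mbig h2 bigle) => s.
  have : (fun _ : nat => 0 : R) n @[n --> \oo] --> (0 : R) by exact: cvg_cst.
  apply: cvg_trans; apply: near_eq_cvg; near=> n; rewrite /big ifT //.
  near: n; exists (Num.bound `|h s|) => // n /= sn.
  apply: (@le_trans _ _ (Num.bound `|h s|)%:R); last by rewrite ler_nat.
  by apply/ltW; rewrite archi_boundP.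
have e1 : 0 < c * eta / 2 by rewrite divr_gt0 // mulr_gt0.
rewrite RI0 => /cvgrPdist_le /(_ _ e1) [N _ HN].
have {HN} := HN N (leqnn N) => /=; rewrite sub0r normrN ger0_norm; last first.
  by apply: RI_ge0 => s; rewrite /big; case: ifP => // _; exact: sqr_ge0.
move=> HN.
have e2 : 0 < eta / (4 * (N%:R + 1)) by rewrite divr_gt0 // mulr_gt0 // ltr_wpDl.
have := L1_translation h1 => /cvgrPdist_le /(_ _ e2); apply: filterS => t.
rewrite sub0r normrN ger0_norm; last by apply: RI_ge0.
move=> Ht.
have L1t := L1_shift t h1; have L2t := L1_shift t h2.
have Ld : L1 (fun s => `|h (s + t) - h s|) by apply: L1_norm; exact: L1B.
pose g s := N%:R * `|h (s + t) - h s| + ((2 * c)^-1 * big N s + c * (h s ^+ 2 + h (s + t) ^+ 2)).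
have Lg : L1 g.
  apply: L1D; first exact: L1Z.
  by apply: L1D; apply: L1Z => //; exact: L1D.
rewrite /autocorr -RIB //.
apply: (le_trans (norm_RI_le (g := g) _ Lg _)).
- exact: L1B.
- move=> s; rewrite addr0 -mulrBr normrM (distrC (h s)) /g /big.
  set d := h (s + t) - h s.
  have c2 : 0 <= (2 * c)^-1 by rewrite invr_ge0 mulr_ge0 // ltW.
  have q : 0 <= c * (h s ^+ 2 + h (s + t) ^+ 2) by rewrite mulr_ge0 ?(ltW c0) // addr_ge0 ?sqr_ge0.
  case: ifP => hs.
    rewrite mulr0 add0r; apply: ler_wpDr => //.
    by rewrite ler_wpM2r.
  apply: ler_wpDl; first by rewrite mulr_ge0.
  have dd : d ^+ 2 <= 2 * (h s ^+ 2 + h (s + t) ^+ 2).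
    by rewrite /d; have := sqr_ge0 (h s + h (s + t)); nra.
  have amgm : `|h s| * `|d| <= (2 * c)^-1 * h s ^+ 2 + c / 2 * d ^+ 2.
    rewrite -[h s ^+ 2]real_normK ?num_real // -[d ^+ 2]real_normK ?num_real //.
    have : 0 <= (2 * c)^-1 * (`|h s| - c * `|d|) ^+ 2 by rewrite mulr_ge0 ?sqr_ge0.
    rewrite -subr_ge0 => H; rewrite -subr_ge0; apply: le_trans H _.
    by rewrite le_eqVlt; apply/orP; left; apply/eqP; field; rewrite gt_eqF.
  apply: le_trans amgm _; rewrite lerD2l -mulrA ler_wpM2l ?(ltW c0) //.
  by rewrite mulrC ler_pdivrMr // mulrC.
rewrite /g RID; [|exact: L1Z|by apply: L1D; apply: L1Z => //; exact: L1D].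
rewrite RIZ // RID; [|exact: L1Z|by apply: L1Z; exact: L1D].
rewrite (RIZ ((2 * c)^-1) (L1big N)) (RIZ c (L1D h2 L2t)).
rewrite RID // (RI_shift t h2) -/N2.
have p1 : N%:R * RI (fun s => `|h (s + t) - h s|) <= eta / 4.
  apply: (@le_trans _ _ (N%:R * (eta / (4 * (N%:R + 1))))); first by rewrite ler_wpM2l.
  rewrite invfM mulrA (mulrC (N%:R)) -!mulrA ler_wpM2l ?(ltW eta0) //.
  rewrite mulrA ler_pdivrMr ?ltr_wpDl // mulrDr mulr1 mulrC lerDl //.
have p2 : (2 * c)^-1 * RI (big N) <= eta / 4.
  rewrite [leLHS]mulrC ler_pdivrMr; last by rewrite mulr_gt0.
  apply: (le_trans HN).
  by rewrite le_eqVlt; apply/orP; left; apply/eqP; field.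
have p3 : c * (N2 + N2) <= eta / 2.
  rewrite /c; apply: (@le_trans _ _ (eta / (4 * (N2 + 1)) * (2 * (N2 + 1)))).
    rewrite ler_wpM2l ?divr_ge0 ?mulr_ge0 ?(ltW eta0) ?addr_ge0 //.
    by lra.
  rewrite le_eqVlt; apply/orP; left; apply/eqP; field.
  by rewrite gt_eqF // ltr_wpDl.
by lra.
Unshelve. all: by end_near. Qed.

End Autocorrelation.

(** As the damping tends to 0, monotone convergence gives the left side and [abel_limit] for the
    autocorrelation at 0 gives the right side. The identity lives in the extended reals, so
    finiteness of the left side is a conclusion. The integrand is even in [y], hence [pi] for a
    half-line. *)
Lemma plancherel_real h : L1 h -> L1 (fun s => h s ^+ 2) ->
  (\int[mu]_y (on_pos (fun y => fcos h y ^+ 2 + fsin h y ^+ 2) y)%:E =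
   (pi * RI (fun s => (h s) ^+ 2))%:E)%E.
Proof.
move=> h1 h2.
pose k y := fcos h y ^+ 2 + fsin h y ^+ 2.
have k0 y : 0 <= k y by rewrite addr_ge0 ?sqr_ge0.
have mk : measurable_fun setT k.
  by apply: measurable_funD; apply: measurable_funX; apply: continuous_measurable_fun;
    [exact: continuous_fcos|exact: continuous_fsin].
have kE y : k y = RI (fun t => autocorr h t * cos ((t - 0) * y)) by rewrite cos_autocorr.
have La := L1_autocorr h1 h2.
have ka y : `|k y| <= RI (fun t => `|autocorr h t|).
  rewrite kE; apply: norm_RI_le.
  - apply: (L1_cos _ La); apply: measurable_funM; last exact: measurable_cst.
    exact: measurable_funB.
  - exact: L1_norm.
  - by move=> t; rewrite normrM ler_piMr // norm_cos_le1.
pose e n : R := n.+1%:R^-1.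
have e0 n : 0 < e n by rewrite invr_gt0 ltr0n.
pose gn n := on_pos (fun y => expR (- (e n * y)) * k y).
have mgn n : measurable_fun setT (gn n).
  apply: measurable_on_pos; apply: measurable_funTS; apply: measurable_funM => //.
  apply: measurableT_comp => //; apply: measurableT_comp => //.
have L1gn n : L1 (gn n).
  have [Le _ _] := RI_exp_cos 0 (e0 n).
  have L := L1Z (RI (fun t => `|autocorr h t|)) Le.
  apply: (L1_le _ _ L) => // y; rewrite /gn !on_posE; case: ifP => _.
    by rewrite normrM (mulrC `|expR _|) (ger0_norm (expR_ge0 _)) ler_wpM2r ?expR_ge0.
  by rewrite normr0 mulr0.
have gn0 n y : 0 <= gn n y by rewrite /gn on_posE; case: ifP => // _; rewrite mulr_ge0 // expR_ge0.
have gnk y : gn n y @[n --> \oo] --> on_pos k y.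
  have [y0|y0] := ltP 0 y; last first.
    have -> : (fun n => gn n y) = (fun=> 0).
      by apply/funext => n; rewrite /gn on_posE ltNge y0.
    by rewrite on_posE ltNge y0; exact: cvg_cst.
  have -> : (fun n => gn n y) = (fun n => expR (- (e n * y)) * k y).
    by apply/funext => n; rewrite /gn on_posE y0.
  rewrite on_posE y0 -[X in _ --> X]mul1r; apply: cvgMl; rewrite -expR0 -oppr0.
  apply: continuous_cvg; first exact: continuous_expR.
  by apply: cvgN; rewrite -(mul0r y); apply: cvgMl; exact: cvg_harmonic.
have c1 : (\int[mu]_y (gn n y)%:E @[n --> \oo] --> \int[mu]_y (on_pos k y)%:E)%E.
  have -> : (\int[mu]_y (on_pos k y)%:E = \int[mu]_y limn (fun n => (gn n y)%:E))%E.
    apply: eq_integral => y _; apply/esym/cvg_lim => //.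
    apply: cvg_EFin; [exact: nearW|exact: gnk].
  apply: cvg_monotone_convergence => //.
  - by move=> n; exact: measurable_EFin.
  - by move=> n y _; rewrite lee_fin.
  - move=> y _ m n mn; rewrite lee_fin /gn !on_posE; case: ifP => // y0.
    rewrite ler_wpM2r // ler_expR lerN2 ler_pM2r // /e lef_pV2 ?posrE ?ltr0n //.
    by rewrite ler_nat.
have c2 : (\int[mu]_y (gn n y)%:E @[n --> \oo] --> (pi * autocorr h 0)%:E)%E.
  rewrite (_ : (fun n => _) = (fun n => (RI (gn n))%:E)); last by apply/funext => n; rewrite RIE.
  apply: cvg_EFin; first exact: nearW.
  apply/cvgrPdist_le => eta eta0.
  have [d d0 Hd] := abel_limit La (autocorr_continuous0 h1 h2) eta0.
  have := @cvg_harmonic R => /cvgrPdist_lt /(_ _ d0); apply: filterS => n.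
  rewrite sub0r normrN gtr0_norm => // nd.
  rewrite distrC; have := Hd (e n); rewrite e0 nd => /(_ isT).
  rewrite (_ : on_pos _ = gn n) //.
  by apply/funext => y; rewrite /gn !on_posE; case: ifP => // _; rewrite kE.
by rewrite -autocorr0; apply: (cvg_unique _ c1 c2); exact: ereal_hausdorff.
Qed.

End Plancherel.

Local Open Scope complex_scope.

(** * Complex numbers in real coordinates, and complex differentiability with real moduli *)

Section ComplexBasics.
Context {R : realType}.
Notation nc := (@ComplexField.Normc.normc R).
Implicit Types (z w : R[i]).

Lemma ReD z w : complex.Re (z + w) = complex.Re z + complex.Re w.
Proof. by case: z w => a b [c d]. Qed.
Lemma ImD z w : complex.Im (z + w) = complex.Im z + complex.Im w.
Proof. by case: z w => a b [c d]. Qed.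
Lemma ReN z : complex.Re (- z) = - complex.Re z.
Proof. by case: z. Qed.
Lemma ImN z : complex.Im (- z) = - complex.Im z.
Proof. by case: z. Qed.
Lemma ReM z w : complex.Re (z * w) = complex.Re z * complex.Re w - complex.Im z * complex.Im w.
Proof. by case: z w => a b [c d]. Qed.
Lemma ImM z w : complex.Im (z * w) = complex.Re z * complex.Im w + complex.Im z * complex.Re w.
Proof. by case: z w => a b [c d]. Qed.
Definition ReImE := (ReD, ImD, ReN, ImN, ReM, ImM).

Lemma complex_ext z w : complex.Re z = complex.Re w -> complex.Im z = complex.Im w -> z = w.
Proof. by case: z w => a b [c d] /= -> ->. Qed.

Lemma normc_sqr z : nc z ^+ 2 = complex.Re z ^+ 2 + complex.Im z ^+ 2.
Proof. by case: z => a b /=; rewrite sqr_sqrtr // addr_ge0 ?sqr_ge0. Qed.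

Lemma normc_ge0 z : 0 <= nc z.
Proof. by case: z => a b; exact: sqrtr_ge0. Qed.

Lemma normRe_le z : `|complex.Re z| <= nc z.
Proof.
rewrite -(ler_pXn2r (n := 2)) ?nnegrE ?normc_ge0 // normc_sqr real_normK ?num_real //.
by rewrite lerDl sqr_ge0.
Qed.

Lemma normIm_le z : `|complex.Im z| <= nc z.
Proof.
rewrite -(ler_pXn2r (n := 2)) ?nnegrE ?normc_ge0 // normc_sqr real_normK ?num_real //.
by rewrite lerDr sqr_ge0.
Qed.

Lemma normc_le z : nc z <= `|complex.Re z| + `|complex.Im z|.
Proof.
rewrite -(ler_pXn2r (n := 2)) ?nnegrE ?normc_ge0 ?addr_ge0 // normc_sqr.
rewrite -[complex.Re z ^+ 2]real_normK ?num_real // -[complex.Im z ^+ 2]real_normK ?num_real //.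
by have := normr_ge0 (complex.Re z); have := normr_ge0 (complex.Im z); nra.
Qed.

Lemma normcM z w : nc (z * w) = nc z * nc w.
Proof. exact: ComplexField.Normc.normcM. Qed.

Lemma normc_opp z : nc (- z) = nc z.
Proof. by case: z => a b /=; rewrite !sqrrN. Qed.

(** The norm of [R[i]] takes its values in [R[i]]; positive values there are real, so all later
    estimates can be made with the real modulus and without dividing by [w]. *)
Lemma derivable_epsP (F : R[i] -> R[i]) z :
  derivable (F : R[i]^o -> R[i]^o) z 1 <->
  exists d, forall eta : R, 0 < eta -> exists2 delta : R, 0 < delta &
    forall w, nc w < delta -> nc (F (z + w) - F z - d * w) <= eta * nc w.
Proof.
have nE (u : R[i]) : `|u| = (nc u)%:C by [].
split.
- move=> /cvg_ex [d /cvgrPdist_le H]; exists d => eta eta0.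
  have e0 : 0 < eta%:C by rewrite ltcR.
  have /nbhs_ballP[del /= del0 Hd] := H _ e0.
  have [delr dd] : exists k : R, del = k%:C.
    by apply/complex_realP; exact: gtr0_real.
  exists delr; first by rewrite -ltcR -dd.
  move=> w wd; have [->|w0] := eqVneq w 0.
    rewrite addr0 subrr mulr0 subr0 ComplexField.Normc.normc0 mulr0 //.
  have bw : ball (0 : R[i]^o) del w.
    by rewrite -ball_normE /= sub0r normrN nE dd ltcR.
  have := Hd w bw w0; rewrite /= /GRing.scale /= mulr1 nE lecR => h.
  have -> : F (z + w) - F z - d * w = - (d - w^-1 * (F (w + z) - F z)) * w.
    by rewrite opprB mulrBl mulrAC mulVf // mul1r (addrC w).
  by rewrite normcM ler_wpM2r ?normc_ge0 // normc_opp.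
- move=> [d H]; apply/cvg_ex; exists d; apply/cvgrPdist_le => eta eta0.
  have [etar ee] : exists k : R, eta = k%:C.
    by apply/complex_realP; exact: gtr0_real.
  have etar0 : 0 < etar by rewrite -ltcR -ee.
  have [del del0 Hd] := H _ etar0.
  apply/nbhs_ballP; exists del%:C => /=; first by rewrite ltcR.
  move=> w; rewrite -ball_normE /= sub0r normrN nE ltcR => wd w0.
  rewrite /GRing.scale /= mulr1 nE ee lecR.
  have nw0 : 0 < nc w.
    rewrite lt_neqAle normc_ge0 andbT eq_sym; apply/eqP => /ComplexField.Normc.eq0_normc.
    by apply/eqP.
  have -> : d - w^-1 * (F (w + z) - F z) = - (w^-1 * (F (z + w) - F z - d * w)).
    by rewrite [in RHS]mulrBr (mulrC d) mulKf // opprB (addrC w).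
  rewrite normc_opp normcM ComplexField.Normc.normcV mulrC ler_pdivrMr //.
  exact: Hd.
Qed.

End ComplexBasics.

(** * Taylor remainders of the exponential *)

Section ExpBounds.
Context {R : realType}.
Implicit Types (x y : R).

Lemma MVT_bound (f df : R -> R) (K x : R) : (forall y, is_derive y 1 f (df y)) ->
  (forall y, `|y| <= `|x| -> `|df y| <= K) -> `|f x - f 0| <= K * `|x|.
Proof.
move=> Df dK; have cf : continuous f by apply: der_continuous => y; exists (df y).
have [x0|x0] := leP 0 x.
  have [c] := MVT_segment x0 (fun y _ => Df y) (continuous_subspaceT cf).
  rewrite in_itv /= => /andP[c0 cx] ->; rewrite subr0 normrM ler_wpM2r //.
  by apply: dK; rewrite !ger0_norm.
have [c] := MVT_segment (ltW x0) (fun y _ => Df y) (continuous_subspaceT cf).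
rewrite in_itv /= => /andP[cx c0] e; rewrite distrC e sub0r normrM normrN ler_wpM2r //.
by apply: dK; rewrite !ler0_norm ?lerN2 // ltW.
Qed.

Lemma norm_sin_le x : `|sin x| <= `|x|.
Proof.
rewrite -[leRHS]mul1r -[sin x]subr0 -[X in _ - X](@sin0 R).
by apply: (MVT_bound (df := cos)) => y _; exact: norm_cos_le1.
Qed.

Lemma norm_cosB1_le x : `|cos x - 1| <= `|x|.
Proof.
rewrite -[leRHS]mul1r -[X in _ - X](@cos0 R).
by apply: (MVT_bound (df := fun y => - sin y)) => y _; rewrite normrN norm_sin_le1.
Qed.

Lemma norm_cosB1_le2 x : `|cos x - 1| <= `|x| * `|x|.
Proof.
rewrite -[X in _ - X](@cos0 R).
apply: (MVT_bound (df := fun y => - sin y)) => y yx.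
by rewrite normrN (le_trans (norm_sin_le y)).
Qed.

Lemma norm_sinB_le2 x : `|sin x - x| <= `|x| * `|x|.
Proof.
have -> : sin x - x = (sin x - x) - (sin 0 - 0) by rewrite sin0 subrr subr0.
apply: (MVT_bound (f := fun x => sin x - x) (df := fun y => cos y - 1)) => y yx.
by rewrite (le_trans (norm_cosB1_le y)).
Qed.

Lemma norm_expRB1_le x : `|expR x - 1| <= expR `|x| * `|x|.
Proof.
rewrite -[X in _ - X](@expR0 R).
apply: (MVT_bound (df := expR)) => y yx.
by rewrite ger0_norm ?expR_ge0 // ler_expR (le_trans (ler_norm y)).
Qed.

Lemma norm_expRB1B_le2 x : `|expR x - 1 - x| <= expR `|x| * `|x| * `|x|.
Proof.
have -> : expR x - 1 - x = (expR x - 1 - x) - (expR 0 - 1 - 0).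
  by rewrite expR0 subrr subr0 subr0.
apply: (MVT_bound (f := fun x => expR x - 1 - x) (df := fun y => expR y - 1)) => [y|y yx].
  apply: is_derive_eq (derD (derD (is_derive_expR y) (der_cst (-1) y)) (derN (is_derive_id _ _))) _.
  by rewrite addr0.
apply: le_trans (norm_expRB1_le y) _; apply: ler_pM => //; rewrite ?expR_ge0 //.
by rewrite ler_expR.
Qed.

Lemma cexpD (z w : R[i]) : cexp (z + w) = cexp z * cexp w.
Proof.
apply: complex_ext; rewrite /cexp /= !ReImE /= expRD ?cosD ?sinD; ring.
Qed.

Lemma normc_cexp (z : R[i]) : ComplexField.Normc.normc (cexp z) = expR (complex.Re z).
Proof.
apply/eqP; rewrite -(eqrXn2 (n := 2)) ?expR_ge0 ?normc_ge0 // normc_sqr /cexp /=.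
by rewrite !exprMn -mulrDr cos2Dsin2 mulr1.
Qed.

(** Coordinate by coordinate, from [e^a cos b - 1 - a = (e^a - 1 - a) + e^a (cos b - 1)] and [e^a
    sin b - b = (e^a - 1) sin b + (sin b - b)]. *)
Lemma cexp_bound (z : R[i]) (m : R) : `|complex.Re z| <= m -> `|complex.Im z| <= m ->
  `|complex.Re (cexp z - 1 - z)| <= 2 * m ^+ 2 * expR m /\
  `|complex.Im (cexp z - 1 - z)| <= 2 * m ^+ 2 * expR m.
Proof.
case: z => a b /= am bm; have m0 : 0 <= m by exact: le_trans am.
have a0 := normr_ge0 a; have b0 := normr_ge0 b.
have e1 : 1 <= expR m by rewrite -expR0 ler_expR.
have ea : expR `|a| <= expR m by rewrite ler_expR.
have ea' : expR a <= expR m by rewrite ler_expR (le_trans (ler_norm a)).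
have ep := expR_ge0 a.
have h1 : `|expR a - 1 - a| <= m ^+ 2 * expR m.
  apply: le_trans (norm_expRB1B_le2 a) _; rewrite mulrC expr2 -mulrA.
  apply: ler_pM => //; rewrite ?mulr_ge0 ?expR_ge0 //.
  by rewrite mulrC; apply: ler_pM => //; rewrite ?expR_ge0.
have h2 : `|cos b - 1| <= m ^+ 2.
  by apply: le_trans (norm_cosB1_le2 b) _; rewrite expr2; exact: ler_pM.
have h3 : `|sin b - b| <= m ^+ 2.
  by apply: le_trans (norm_sinB_le2 b) _; rewrite expr2; exact: ler_pM.
have h4 : `|sin b| <= m by exact: le_trans (norm_sin_le b) _.
have h5 : `|expR a - 1| <= expR m * m.
  by apply: le_trans (norm_expRB1_le a) _; apply: ler_pM => //; rewrite ?expR_ge0.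
have m2 : 0 <= m ^+ 2 by exact: sqr_ge0.
rewrite /cexp /=; split.
  have -> : expR a * cos b - 1 - a = (expR a - 1 - a) + expR a * (cos b - 1) by ring.
  apply: le_trans (ler_normD _ _) _; rewrite normrM (ger0_norm ep).
  have : expR a * `|cos b - 1| <= expR m * m ^+ 2 by apply: ler_pM.
  by move: h1; lra.
have -> : expR a * sin b - 0 - b = (expR a - 1) * sin b + (sin b - b) by ring.
apply: le_trans (ler_normD _ _) _; rewrite normrM.
have : `|expR a - 1| * `|sin b| <= expR m * m * m by apply: ler_pM.
have : m ^+ 2 <= m ^+ 2 * expR m by rewrite ler_peMr.
by move: h3; rewrite -mulrA -expr2; lra.
Qed.

End ExpBounds.

(** * The Laplace transform *)

Section Laplace.
Context {R : realType}.
Notation mu := (@lebesgue_measure R).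
Notation nc := (@ComplexField.Normc.normc R).
Implicit Types (x t : R) (u v : R -> R) (f g : R -> R[i]) (z w : R[i]).

(** A class wide enough for both sides of the argument: it contains the coordinates of [L2w]
    functions and of the preimages produced by the Paley-Wiener theorem. *)
Definition damped_L2 u : Prop :=
  measurable_fun (`]0, +oo[%classic : set R) u /\
  forall x : R, 0 < x -> L1 (on_pos (fun t => expR (- (2 * x * t)) * u t ^+ 2)).

Definition damp (x : R) u : R -> R := on_pos (fun t => expR (- (x * t)) * u t).

Lemma measurable_expRM (c : R) (D : set R) : measurable_fun D (fun t : R => expR (- (c * t))).
Proof.
apply: measurable_funTS; apply: continuous_measurable_fun; apply: der_continuous => x.
eexists; exact: (der_comp (derN (der_lin c x)) (is_derive_expR _)).
Qed.

Lemma measurable_damp x u : measurable_fun (`]0, +oo[%classic : set R) u ->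
  measurable_fun setT (damp x u).
Proof.
move=> mu_; apply: measurable_on_pos; apply: measurable_funM => //.
exact: measurable_expRM.
Qed.

Lemma damp_sqr x u t : damp x u t ^+ 2 = on_pos (fun t => expR (- (2 * x * t)) * u t ^+ 2) t.
Proof.
rewrite /damp !on_posE; case: ifP => _; last by rewrite expr0n.
by rewrite exprMn -expRM_natl; congr (expR _ * _); ring.
Qed.

Lemma L1_damp_sqr x u : damped_L2 u -> 0 < x -> L1 (fun t => damp x u t ^+ 2).
Proof. by move=> [_ H] x0; apply: eq_L1 (H _ x0) => t; rewrite damp_sqr. Qed.

Lemma L1_pexp (c : R) : 0 < c -> L1 (on_pos (fun t => expR (- (c * t)))).
Proof. by move=> c0; have [] := RI_exp_cos 0 c0. Qed.

(** With [e] the damping at [x / 2], [e ^+ 2 * u t] is the product of [e] and [e * u t], both square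
    integrable: half of the exponent pays for the Cauchy-Schwarz step. *)
Lemma L1_damp x u : damped_L2 u -> 0 < x -> L1 (damp x u).
Proof.
move=> Hu x0; have x20 : 0 < x / 2 by rewrite divr_gt0.
apply: L1_le (L1D (L1_pexp x0) (L1_damp_sqr Hu x20)).
  by apply: measurable_damp; case: Hu.
move=> t; rewrite /damp !on_posE; case: ifP => _; last by rewrite normr0 expr0n addr0.
have -> : expR (- (x * t)) = expR (- (x / 2 * t)) ^+ 2.
  by rewrite -expRM_natl; congr expR; field.
set e := expR _.
have : 0 <= (e - e * `|u t|) ^+ 2 by exact: sqr_ge0.
rewrite sqrrB -[(e * u t) ^+ 2]real_normK ?num_real //.
rewrite (normrM e (u t)) (@ger0_norm _ e) ?expR_ge0 //.
have := sqr_ge0 (e * `|u t|).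
have e0 : 0 <= e by exact: expR_ge0.
have -> : e * (e * `|u t|) = `|e ^+ 2 * u t| by rewrite normrM ger0_norm ?sqr_ge0 // expr2 mulrA.
by have := sqr_ge0 e; lra.
Qed.

Lemma damped_L2_le u v : measurable_fun (`]0, +oo[%classic : set R) u ->
  (forall t : R, 0 < t -> `|u t| <= `|v t|) -> damped_L2 v -> damped_L2 u.
Proof.
move=> mu_ uv [mv Hv]; split=> // x x0; apply: L1_le (Hv _ x0).
  apply: measurable_on_pos; apply: measurable_funM; first exact: measurable_expRM.
  exact: measurable_funX.
move=> t; rewrite !on_posE; case: ifP => [t0|_]; last by rewrite normr0.
rewrite normrM ger0_norm ?expR_ge0 // ler_wpM2l ?expR_ge0 //.
rewrite normrX -[v t ^+ 2]real_normK ?num_real //.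
by rewrite lerXn2r ?nnegrE //; exact: uv.
Qed.

Lemma damped_L2D u v : damped_L2 u -> damped_L2 v -> damped_L2 (fun t => u t + v t).
Proof.
move=> [mu_ Hu] [mv Hv]; split; first exact: measurable_funD.
move=> x x0; apply: L1_le (L1Z 2 (L1D (Hu _ x0) (Hv _ x0))).
  apply: measurable_on_pos; apply: measurable_funM; first exact: measurable_expRM.
  by apply: measurable_funX; exact: measurable_funD.
move=> t; rewrite !on_posE; case: ifP => [t0|_]; last by rewrite normr0 addr0 mulr0.
rewrite -mulrDr [leRHS]mulrCA normrM (ger0_norm (expR_ge0 _)) ler_wpM2l ?expR_ge0 //.
rewrite ger0_norm ?sqr_ge0 //.
by have := sqr_ge0 (u t - v t); nra.
Qed.

Lemma damped_L2N u : damped_L2 u -> damped_L2 (fun t => - u t).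
Proof.
move=> Hu; apply: damped_L2_le (Hu); first by apply: measurableT_comp => //; case: Hu.
by move=> t _; rewrite normrN.
Qed.

Lemma sqr_le_expR (t x : R) : 0 <= t -> 0 < x -> t ^+ 2 <= 2 / x ^+ 2 * expR (x * t).
Proof.
move=> t0 x0; have xt0 : 0 <= x * t by rewrite mulr_ge0 // ltW.
have := expR_ge1Dxn 1 xt0; rewrite (_ : 2`! = 2)%N // => h.
have h2 : (x * t) ^+ 2 / 2 <= expR (x * t) by apply: le_trans h; rewrite lerDr.
rewrite mulrAC ler_pdivlMr ?exprn_gt0 //.
by move: h2; rewrite ler_pdivrMr // exprMn mulrC (mulrC _ 2).
Qed.

(** The derivative of a Laplace transform is the transform of [- (t * f t)]; half of the exponent
    absorbs [t ^+ 2]. *)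
Lemma damped_L2M u : damped_L2 u -> damped_L2 (fun t => t * u t).
Proof.
move=> [mu_ Hu]; have mtu : measurable_fun (`]0, +oo[%classic : set R) (fun t : R => t * u t).
  by apply: measurable_funM => //; exact: measurable_id.
split=> // x x0; have x20 : 0 < x / 2 by rewrite divr_gt0.
apply: L1_le (L1Z (2 / x ^+ 2) (Hu _ x20)).
  apply: measurable_on_pos; apply: measurable_funM; first exact: measurable_expRM.
  exact: measurable_funX.
move=> t; rewrite !on_posE; case: ifP => [t0|_]; last by rewrite normr0 mulr0.
rewrite ger0_norm; last by rewrite mulr_ge0 ?expR_ge0 ?sqr_ge0.
rewrite exprMn [leLHS]mulrA [leRHS]mulrA; apply: ler_wpM2r; first exact: sqr_ge0.
have -> : expR (- (2 * (x / 2) * t)) = expR (- (2 * x * t)) * expR (x * t).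
  by rewrite -expRD; congr expR; field.
rewrite [leRHS]mulrCA ler_wpM2l ?expR_ge0 //.
exact: (sqr_le_expR (ltW t0) x0).
Qed.

Definition laplace_class f : Prop :=
  damped_L2 (fun t => complex.Re (f t)) /\ damped_L2 (fun t => complex.Im (f t)).

Definition CI f : R[i] :=
  RI (on_pos (fun t => complex.Re (f t))) +i* RI (on_pos (fun t => complex.Im (f t))).

Definition L1c f : Prop :=
  L1 (on_pos (fun t => complex.Re (f t))) /\ L1 (on_pos (fun t => complex.Im (f t))).

Lemma eq_CI f g : (forall t, 0 < t -> f t = g t) -> CI f = CI g.
Proof.
move=> fg; rewrite /CI; congr (_ +i* _); apply: eq_RI => t; rewrite !on_posE;
  by case: ifP => // t0; rewrite fg.
Qed.

Lemma eq_L1c f g : (forall t, 0 < t -> f t = g t) -> L1c f -> L1c g.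
Proof.
move=> fg [H1 H2]; split; [apply: eq_L1 H1|apply: eq_L1 H2] => t; rewrite !on_posE;
  by case: ifP => // t0; rewrite fg.
Qed.

Lemma on_posD u v t : on_pos (fun t => u t + v t) t = on_pos u t + on_pos v t.
Proof. by rewrite !on_posE; case: ifP => _ //; rewrite addr0. Qed.

Lemma on_posZ (c : R) u t : on_pos (fun t => c * u t) t = c * on_pos u t.
Proof. by rewrite !on_posE; case: ifP => _ //; rewrite mulr0. Qed.

Lemma eq_on_pos u v t : (0 < t -> u t = v t) -> on_pos u t = on_pos v t.
Proof. by move=> uv; rewrite !on_posE; case: ifP => // /uv. Qed.

Lemma CID f g : L1c f -> L1c g ->
  L1c (fun t => f t + g t) /\ CI (fun t => f t + g t) = CI f + CI g.
Proof.
move=> [f1 f2] [g1 g2]; split.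
  split; [apply: eq_L1 (L1D f1 g1)|apply: eq_L1 (L1D f2 g2)] => t;
  by rewrite -on_posD; apply: eq_on_pos; rewrite !ReImE.
apply: complex_ext; rewrite !ReImE /= -RID //; apply: eq_RI => t;
by rewrite -on_posD; apply: eq_on_pos; rewrite !ReImE.
Qed.

Lemma CIZ (c : R[i]) f : L1c f ->
  L1c (fun t => c * f t) /\ CI (fun t => c * f t) = c * CI f.
Proof.
move=> [f1 f2]; case: c => a b.
have e1 t : on_pos (fun t => complex.Re ((a +i* b) * f t)) t =
    a * on_pos (fun t => complex.Re (f t)) t - b * on_pos (fun t => complex.Im (f t)) t.
  by rewrite !on_posE; case: ifP => _; rewrite ?ReImE // !mulr0 subr0.
have e2 t : on_pos (fun t => complex.Im ((a +i* b) * f t)) t =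
    a * on_pos (fun t => complex.Im (f t)) t + b * on_pos (fun t => complex.Re (f t)) t.
  by rewrite !on_posE; case: ifP => _; rewrite ?ReImE // !mulr0 addr0.
split.
  split; [rewrite (funext e1); apply: L1B|rewrite (funext e2); apply: L1D];
  exact: L1Z.
apply: complex_ext; rewrite !ReImE /= ?(funext e1) ?(funext e2).
  by rewrite RIB ?RIZ //; exact: L1Z.
by rewrite RID ?RIZ //; exact: L1Z.
Qed.

Lemma normc_CI_le f v : L1c f -> L1 (on_pos v) ->
  (forall t, 0 < t -> `|complex.Re (f t)| <= v t /\ `|complex.Im (f t)| <= v t) ->
  nc (CI f) <= 2 * RI (on_pos v).
Proof.
move=> [f1 f2] Lv H; apply: le_trans (normc_le _) _; rewrite mulr_natl mulr2n /CI /=.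
by apply: lerD; apply: norm_RI_le => // t; rewrite !on_posE; case: ifP => [/H[]//|_]; rewrite normr0.
Qed.

Lemma laplaceE f z : laplace f z = CI (fun t => cexp (- (t%:C * z)) * f t).
Proof. by rewrite /laplace /CI /RI /on_pos -!Rintegral_mkcond. Qed.

Lemma cexpE (t x y : R) :
  cexp (- (t%:C * (x +i* y))) =
  (expR (- (x * t)) * cos (t * y)) +i* (- (expR (- (x * t)) * sin (t * y))).
Proof.
rewrite /cexp !ReImE /= !mul0r subr0 addr0 cosN sinN mulrN.
by rewrite (mulrC t x).
Qed.

Lemma laplace_re_im f (x y t : R) :
  on_pos (fun t => complex.Re (cexp (- (t%:C * (x +i* y))) * f t)) t =
    damp x (fun t => complex.Re (f t)) t * cos (t * y) +
    damp x (fun t => complex.Im (f t)) t * sin (t * y) /\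
  on_pos (fun t => complex.Im (cexp (- (t%:C * (x +i* y))) * f t)) t =
    damp x (fun t => complex.Im (f t)) t * cos (t * y) -
    damp x (fun t => complex.Re (f t)) t * sin (t * y).
Proof.
rewrite /damp !on_posE; case: ifP => _; last by rewrite !mul0r addr0 subr0.
by rewrite cexpE !ReImE /=; split; ring.
Qed.

Lemma L1c_laplace f z : laplace_class f -> rhp z ->
  L1c (fun t => cexp (- (t%:C * z)) * f t).
Proof.
case: z => x y [fr fi]; rewrite /rhp /= => x0.
have H1 := L1_damp fr x0; have H2 := L1_damp fi x0.
have my := @measurable_mulr_cst R y.
split.
  apply: (eq_L1 (fun t => esym (laplace_re_im f x y t).1)).
  by apply: L1D; [exact: L1_cos|exact: L1_sin].
apply: (eq_L1 (fun t => esym (laplace_re_im f x y t).2)).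
by apply: L1B; [exact: L1_cos|exact: L1_sin].
Qed.

Lemma laplace_fourier f (x y : R) : laplace_class f -> 0 < x ->
  laplace f (x +i* y) =
  (fcos (damp x (fun t => complex.Re (f t))) y + fsin (damp x (fun t => complex.Im (f t))) y) +i*
  (fcos (damp x (fun t => complex.Im (f t))) y - fsin (damp x (fun t => complex.Re (f t))) y).
Proof.
move=> [fr fi] x0; have H1 := L1_damp fr x0; have H2 := L1_damp fi x0.
have my := @measurable_mulr_cst R y.
rewrite laplaceE /CI /fcos /fsin; congr (_ +i* _).
  rewrite -RID; [|exact: L1_cos|exact: L1_sin].
  by apply: eq_RI => t; exact: (laplace_re_im f x y t).1.
rewrite -RIB; [|exact: L1_cos|exact: L1_sin].
by apply: eq_RI => t; exact: (laplace_re_im f x y t).2.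
Qed.

Lemma eq_damped_L2 u v : (forall t, u t = v t) -> damped_L2 u -> damped_L2 v.
Proof. by move=> uv; rewrite (funext uv). Qed.

Lemma laplace_classD f g : laplace_class f -> laplace_class g ->
  laplace_class (fun t => f t + g t).
Proof.
move=> [f1 f2] [g1 g2]; split.
  by apply: eq_damped_L2 (damped_L2D f1 g1) => t; rewrite ReD.
by apply: eq_damped_L2 (damped_L2D f2 g2) => t; rewrite ImD.
Qed.

Lemma laplace_classN f : laplace_class f -> laplace_class (fun t => - f t).
Proof.
move=> [f1 f2]; split.
  by apply: eq_damped_L2 (damped_L2N f1) => t; rewrite ReN.
by apply: eq_damped_L2 (damped_L2N f2) => t; rewrite ImN.
Qed.

Lemma laplaceD f g z : laplace_class f -> laplace_class g -> rhp z ->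
  laplace (fun t => f t + g t) z = laplace f z + laplace g z.
Proof.
move=> Hf Hg zr; rewrite !laplaceE.
rewrite -(CID (L1c_laplace Hf zr) (L1c_laplace Hg zr)).2.
by apply: eq_CI => t _; rewrite mulrDr.
Qed.

Lemma laplaceN f z : laplace_class f -> rhp z ->
  laplace (fun t => - f t) z = - laplace f z.
Proof.
move=> Hf zr; rewrite !laplaceE -mulN1r -(CIZ (-1) (L1c_laplace Hf zr)).2.
by apply: eq_CI => t _; rewrite mulrN mulN1r.
Qed.

(** Differentiation under the integral: the error is the transform of [f] times the second-order
    remainder of [cexp] at [- t w], of size [|w|^2 t^2 e^{t |w|}]. For [|w| < x / 2] half of the
    exponent [x] controls the last factor, a quarter absorbs [t^2], and the last quarter keeps the
    integral finite. *)
Lemma laplace_holomorphic f : laplace_class f -> holomorphic_rhp (laplace f).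
Proof.
move=> Hf z zr; apply/derivable_epsP.
pose g t := - (t%:C * f t).
have Hg : laplace_class g.
  apply: laplace_classN; case: Hf => f1 f2; split.
    by apply: eq_damped_L2 (damped_L2M f1) => t; rewrite ReM /= mul0r subr0.
  by apply: eq_damped_L2 (damped_L2M f2) => t; rewrite ImM /= mul0r addr0.
exists (laplace g z) => eta eta0.
have x0 : 0 < complex.Re z by [].
set x := complex.Re z in x0.
have x40 : 0 < x / 4 by rewrite divr_gt0.
pose b := on_pos (fun t => expR (- (x / 4 * t)) * (`|complex.Re (f t)| + `|complex.Im (f t)|)).
have Lb : L1 b.
  have [f1 f2] := Hf.
  apply: eq_L1 (L1D (L1_norm (L1_damp f1 x40)) (L1_norm (L1_damp f2 x40))) => t.
  rewrite /b /damp !on_posE; case: ifP => _; last by rewrite normr0 addr0.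
  by rewrite !normrM ger0_norm ?expR_ge0 // mulrDr.
(* The constant of [cexp_bound], once for each coordinate, times that of [sqr_le_expR] at [x / 4];
   the further 2 in [K] comes from [normc_CI_le]. *)
pose C := 2 * (2 * (2 / (x / 4) ^+ 2)).
pose K := 2 * C * RI b.
have C0 : 0 <= C by rewrite !mulr_ge0 ?invr_ge0 ?sqr_ge0.
have K0 : 0 <= K.
  rewrite mulr_ge0 //; [exact: mulr_ge0|apply: RI_ge0 => t].
  by rewrite /b on_posE; case: ifP => // _; rewrite mulr_ge0 ?expR_ge0 ?addr_ge0.
exists (Num.min (x / 2) (eta / (K + 1))).
  by rewrite lt_min !divr_gt0 // ltr_wpDl.
move=> w; rewrite lt_min => /andP[wx weta].
have w0 := normc_ge0 w.
have zwr : rhp (z + w).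
  rewrite /rhp /= ReD -/x.
  have := normRe_le w; rewrite ler_norml => /andP[h _].
  by move: wx h; lra.
have zE t : 0 < t -> cexp (- (t%:C * (z + w))) * f t - cexp (- (t%:C * z)) * f t - w * (cexp (- (t%:C * z)) * g t)
    = cexp (- (t%:C * z)) * f t * (cexp (- (t%:C * w)) - 1 - (- (t%:C * w))).
  by move=> t0; rewrite mulrDr opprD cexpD /g; ring.
have Lzw := L1c_laplace Hf zwr; have Lz := L1c_laplace Hf zr.
have Lgz := L1c_laplace Hg zr.
have [L2 E2] := CIZ (-1) Lz; have [L3 E3] := CIZ (- w) Lgz.
have [L4 E4] := CID Lzw L2; have [L5 E5] := CID L4 L3.
have -> : laplace f (z + w) - laplace f z - laplace g z * w =
  CI (fun t => cexp (- (t%:C * z)) * f t * (cexp (- (t%:C * w)) - 1 - (- (t%:C * w)))).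
  rewrite !laplaceE; transitivity (CI (fun t => cexp (- (t%:C * (z + w))) * f t + -1 * (cexp (- (t%:C * z)) * f t)
    + - w * (cexp (- (t%:C * z)) * g t))).
    by rewrite E5 E4 E2 E3 mulN1r mulNr (mulrC w).
  by apply: eq_CI => t t0; rewrite -zE // mulN1r mulNr.
have L6 : L1c (fun t => cexp (- (t%:C * z)) * f t * (cexp (- (t%:C * w)) - 1 - (- (t%:C * w)))).
  by apply: eq_L1c L5 => t t0; rewrite -zE // mulN1r mulNr.
have Lv : L1 (on_pos (fun t => C * nc w ^+ 2 * (expR (- (x / 4 * t)) * (`|complex.Re (f t)| + `|complex.Im (f t)|)))).
  apply: eq_L1 (L1Z (C * nc w ^+ 2) Lb) => t.
  by rewrite /b on_posZ.
apply: le_trans (normc_CI_le L6 Lv _) _; last first.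
  rewrite (@eq_RI _ _ (fun t => C * nc w ^+ 2 * b t)); last first.
    by move=> t; rewrite /b on_posZ.
  rewrite RIZ // expr2 mulrA [leLHS](_ : _ = nc w * K * nc w); last by rewrite /K; ring.
  rewrite ler_wpM2r //; apply: (@le_trans _ _ (nc w * (K + 1))).
    by rewrite ler_wpM2l // lerDl.
  by rewrite -ler_pdivlMr ?ltr_wpDl // ltW.
move=> t t0.
set A := cexp _ * f t; set B := _ - _ - _.
have m0 : 0 <= t * nc w by rewrite mulr_ge0 // ltW.
have [B1 B2] : `|complex.Re B| <= 2 * (t * nc w) ^+ 2 * expR (t * nc w) /\
    `|complex.Im B| <= 2 * (t * nc w) ^+ 2 * expR (t * nc w).
  apply: cexp_bound; rewrite !ReImE /= mul0r ?subr0 ?addr0 normrN normrM (gtr0_norm t0);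
    rewrite ler_pM2l //; [exact: normRe_le|exact: normIm_le].
have nA : nc A <= expR (- (x * t)) * (`|complex.Re (f t)| + `|complex.Im (f t)|).
  rewrite /A normcM normc_cexp !ReImE /= mul0r subr0 (mulrC t) -/x.
  by rewrite ler_wpM2l ?expR_ge0 // normc_le.
have nB : nc B <= 4 * (t * nc w) ^+ 2 * expR (t * nc w).
  apply: le_trans (normc_le _) _; apply: le_trans (lerD B1 B2) _.
  by rewrite -mulrDl -mulrDl; lra.
have AB : nc (A * B) <= C * nc w ^+ 2 * (expR (- (x / 4 * t)) * (`|complex.Re (f t)| + `|complex.Im (f t)|)).
  rewrite normcM; apply: le_trans (ler_pM _ _ nA nB) _; rewrite ?normc_ge0 //.
  rewrite [leLHS]mulrAC [leRHS]mulrA; apply: ler_wpM2r; first by rewrite addr_ge0.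
  have e1 : expR (t * nc w) <= expR (x / 2 * t) by rewrite ler_expR mulrC ler_pM2r // ltW.
  have e2 := sqr_le_expR (ltW t0) x40.
  have -> : expR (- (x / 4 * t)) = expR (- (x * t)) * (expR (x / 2 * t) * expR (x / 4 * t)).
    by rewrite -!expRD; congr expR; field.
  rewrite [leRHS]mulrCA; apply: ler_wpM2l; first exact: expR_ge0.
  have h := ler_pM (sqr_ge0 t) (expR_ge0 (t * nc w)) e2 e1.
  have nw2 : 0 <= 4 * nc w ^+ 2 by rewrite mulr_ge0 ?sqr_ge0.
  have := ler_wpM2l nw2 h; rewrite /C => h'.
  rewrite [leLHS](_ : _ = 4 * nc w ^+ 2 * (t ^+ 2 * expR (t * nc w))); last by ring.
  by apply: le_trans h' _; rewrite le_eqVlt; apply/orP; left; apply/eqP; ring.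
by split; apply: le_trans AB; [exact: normRe_le|exact: normIm_le].
Qed.

End Laplace.

(** * Joint measurability on the half-plane, and Plancherel on vertical lines *)

Section HalfPlaneMeasurability.
Context {R : realType}.
Notation mu := (@lebesgue_measure R).
Notation nc := (@ComplexField.Normc.normc R).
Implicit Types (z w : R[i]).

Lemma ge0_integral_symmetrize (f : R -> R) : measurable_fun setT f ->
  (forall x, 0 <= f x) ->
  (\int[mu]_y (f y)%:E = \int[mu]_y (on_pos (fun y => f y + f (- y)) y)%:E)%E.
Proof.
move=> mf f0.
have mfN : measurable_fun setT (fun y : R => f (- y)).
  by apply: (measurableT_comp mf); exact: measurable_funN.
have H : (\int[mu]_(r in `[0%R, +oo[) (f (- r))%:E = \int[mu]_(r in `]-oo, 0%R]) (f r)%:E)%E.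
  rewrite (ge0_integration_by_substitution0 (f := fun r => (f (- r))%:E)) //.
  - by apply: eq_integral => r _; rewrite opprK.
  - exact: measurable_EFin.
  - by move=> r; rewrite lee_fin.
rewrite -{1}setC0 -(set_itvoc0 0%R) setCitv /= ge0_integral_setU //=; first last.
- rewrite disj_set2E; apply/eqP; rewrite -subset0 => x []/= /[!in_itv]/=.
  by rewrite leNgt andbT => /negP.
- by move=> x _; rewrite lee_fin.
- by apply/measurable_EFinP; apply: measurable_funTS.
rewrite -H -integral_itv_obnd_cbnd; last by apply/measurable_EFinP/measurable_funTS.
rewrite -ge0_integralD //=; first last.
- by apply/measurable_EFinP/measurable_funTS.
- by move=> x _; rewrite lee_fin.
- by apply/measurable_EFinP/measurable_funTS.
- by move=> x _; rewrite lee_fin.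
rewrite integral_mkcond; apply: eq_integral => y _.
rewrite patchE mem_setE in_itv /= andbT on_posE.
by case: ifP => _ //; rewrite -EFinD addrC.
Qed.

(** Caratheodory functions are jointly measurable: replacing the first variable by a point of a grid
    of width [1 / (n + 1)] gives a function measurable on each of countably many strips, and
    continuity in that variable gives the limit. *)
Lemma measurable_caratheodory (u : R -> R -> R) :
  (forall x : R, 0 < x -> measurable_fun setT (u x)) ->
  (forall x y : R, 0 < x -> u t y @[t --> x] --> u x y) ->
  measurable_fun setT (fun p : R * R => if 0 < p.1 then u p.1 p.2 else 0).
Proof.
move=> mu_ cu.
pose D := (fst : R * R -> R) @^-1` `]0, +oo[.
have mD : measurable D.
  by rewrite -[D]setTI; apply: measurable_fst => //; exact: measurable_itv.
have memD p : (p \in D) = (0 < p.1) by apply/idP/idP; rewrite inE /D /= in_itv /= andbT.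
have -> : (fun p : R * R => if 0 < p.1 then u p.1 p.2 else 0) = (fun p => u p.1 p.2) \_ D.
  by apply/funext => p; rewrite patchE memD.
apply/(measurable_restrictT _ mD).
(* The grid point lies strictly to the right of [x], hence in the open half-line. *)
pose a (n : nat) (x : R) : R := (Num.truncn (n.+1%:R * x)).+1%:R / n.+1%:R.
have n0 n : (0 : R) < n.+1%:R by rewrite ltr0n.
have aP n x : 0 < x -> x < a n x <= x + n.+1%:R^-1.
  move=> x0; have nx0 : 0 <= n.+1%:R * x by rewrite mulr_ge0 // ltW.
  have /andP[h1 h2] := truncn_itv nx0.
  rewrite /a ltr_pdivlMr // mulrC h2 /= ler_pdivrMr // mulrDl mulVf ?gt_eqF // mulrC.
  by rewrite -natr1 lerD2r mulrC.
apply: (@measurable_fun_cvg _ _ R D (fun n p => u (a n p.1) p.2)) => //.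
- move=> n.
  pose E (k : nat) := D `&` [set p : R * R | Num.truncn (n.+1%:R * p.1) = k].
  have DE : D = \bigcup_k E k.
    apply/seteqP; split => p; first by move=> Dp; exists (Num.truncn (n.+1%:R * p.1)).
    by case=> k _ [].
  have mE k : measurable (E k).
    have -> : E k = D `&` ((fst : R * R -> R) @^-1` `[k%:R / n.+1%:R, k.+1%:R / n.+1%:R[).
      apply/seteqP; split => p [Dp] /=.
        move=> tk; split => //=; rewrite in_itv /=.
        have p0 : 0 < p.1 by move: Dp; rewrite /D /= in_itv /= andbT.
        have nx0 : 0 <= n.+1%:R * p.1 by rewrite mulr_ge0 // ltW.
        have /andP[h1 h2] := truncn_itv nx0.
        by rewrite ler_pdivrMr // ltr_pdivlMr // !(mulrC p.1) -tk h1 h2.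
      rewrite in_itv /= ler_pdivrMr // ltr_pdivlMr // !(mulrC p.1) => h; split => //.
      exact: truncn_def.
    apply: measurableI => //; rewrite -[X in measurable X]setTI.
    by apply: measurable_fst => //; exact: measurable_itv.
  rewrite DE; apply/measurable_fun_bigcup => // k.
  apply: (eq_measurable_fun (fun p : R * R => u (k.+1%:R / n.+1%:R) p.2)).
    by move=> p; rewrite inE => -[_ /= <-].
  apply: measurable_funTS; apply: (measurableT_comp (mu_ _ _)) => //.
- move=> p; rewrite /D /= in_itv /= andbT => p0.
  have ca : a n p.1 @[n --> \oo] --> p.1.
    have c1 : (fun _ : nat => p.1) n @[n --> \oo] --> p.1 by exact: cvg_cst.
    have c2 : p.1 + n.+1%:R^-1 @[n --> \oo] --> p.1.
      rewrite -[X in _ --> X]addr0; apply: cvgD; first exact: cvg_cst.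
      exact: cvg_harmonic.
    apply: (squeeze_cvgr _ c1 c2).
    by apply: nearW => n; have /andP[/ltW -> ->] := aP n _ p0.
  by move: (cu p.1 p.2 p0) => /(@cvg_nbhsP _ R^o); apply.
Qed.

Definition continuous_rhp (F : R[i] -> R[i]) : Prop :=
  forall z, rhp z -> forall eta : R, 0 < eta ->
  exists2 delta : R, 0 < delta & forall w, nc w < delta -> nc (F (z + w) - F z) <= eta.

Lemma normcD z w : nc (z + w) <= nc z + nc w.
Proof. exact: le_normcD. Qed.

Lemma normc0 : nc 0 = 0.
Proof. exact: ComplexField.Normc.normc0. Qed.

Lemma normc_eq0 z : nc z = 0 -> z = 0.
Proof. exact: ComplexField.Normc.eq0_normc. Qed.

Lemma normc_dist z w : `|nc z - nc w| <= nc (z - w).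
Proof.
have h1 := normcD (z - w) w; have h2 := normcD (w - z) z.
rewrite subrK in h1; rewrite subrK -opprB normc_opp in h2.
by rewrite ler_norml; apply/andP; split; lra.
Qed.

Lemma holomorphic_continuous (F : R[i] -> R[i]) : holomorphic_rhp F -> continuous_rhp F.
Proof.
move=> hF z zr eta eta0; have /derivable_epsP[d H] := hF z zr.
have [del del0 Hd] := H 1 ltr01.
have d0 := normc_ge0 d.
exists (Num.min del (eta / (1 + nc d))).
  by rewrite lt_min del0 divr_gt0 // ltr_wpDr.
move=> w; rewrite lt_min => /andP[wd we].
have -> : F (z + w) - F z = (F (z + w) - F z - d * w) + d * w by rewrite subrK.
apply: le_trans (normcD _ _) _; rewrite normcM.
apply: (@le_trans _ _ ((1 + nc d) * nc w)).
  by rewrite mulrDl lerD2r; exact: Hd.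
by rewrite mulrC -ler_pdivlMr ?ltr_wpDr // ltW.
Qed.

Lemma continuous_rhp_line (F : R[i] -> R[i]) (p : R[i] -> R) (x : R) :
  continuous_rhp F -> (forall z w, `|p z - p w| <= nc (z - w)) -> 0 < x ->
  continuous (fun y => p (F (x +i* y))).
Proof.
move=> cF pl x0 y; apply/cvgrPdist_le => eta eta0.
have [del del0 H] := cF (x +i* y) x0 _ eta0.
apply/nbhs_ballP; exists del => //= t; rewrite /ball /= => yt.
apply: le_trans (pl _ _) _; rewrite -opprB normc_opp.
have -> : x +i* t = (x +i* y) + (0 +i* (t - y)).
  by apply: complex_ext; rewrite !ReImE /= ?addr0 // addrC subrK.
apply: H; apply: le_lt_trans (normc_le _) _ => /=.
by rewrite normr0 add0r distrC.
Qed.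

Lemma continuous_rhp_row (F : R[i] -> R[i]) (p : R[i] -> R) (x y : R) :
  continuous_rhp F -> (forall z w, `|p z - p w| <= nc (z - w)) -> 0 < x ->
  p (F (t +i* y)) @[t --> x] --> p (F (x +i* y)).
Proof.
move=> cF pl x0; apply/cvgrPdist_le => eta eta0.
have [del del0 H] := cF (x +i* y) x0 _ eta0.
apply/nbhs_ballP; exists del => //= t; rewrite /ball /= => yt.
apply: le_trans (pl _ _) _; rewrite -opprB normc_opp.
have -> : t +i* y = (x +i* y) + ((t - x) +i* 0).
  by apply: complex_ext; rewrite !ReImE /= ?addr0 // addrC subrK.
apply: H; apply: le_lt_trans (normc_le _) _ => /=.
by rewrite normr0 addr0 distrC.
Qed.

Lemma measurable_rhp (F : R[i] -> R[i]) (p : R[i] -> R) :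
  continuous_rhp F -> (forall z w, `|p z - p w| <= nc (z - w)) ->
  measurable_fun setT (fun q : R * R => if 0 < q.1 then p (F (q.1 +i* q.2)) else 0).
Proof.
move=> cF pl; apply: (@measurable_caratheodory (fun x y => p (F (x +i* y)))).
  move=> x x0; apply: continuous_measurable_fun.
  exact: (continuous_rhp_line cF pl x0).
by move=> x y x0; exact: (continuous_rhp_row cF pl x0).
Qed.

(** Extended by zero, which makes it measurable on the plane whatever values [F] takes outside the
    half-plane. *)
Definition rhp_sqr (F : R[i] -> R[i]) (q : R * R) : R :=
  if 0 < q.1 then nc (F (q.1 +i* q.2)) ^+ 2 else 0.

Lemma rhp_sqr_ge0 F q : 0 <= rhp_sqr F q.
Proof. by rewrite /rhp_sqr; case: ifP => // _; exact: sqr_ge0. Qed.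

Lemma measurable_rhp_sqr (F : R[i] -> R[i]) : continuous_rhp F ->
  measurable_fun setT (rhp_sqr F).
Proof.
move=> cF; have := measurable_rhp cF normc_dist => /(measurable_funX 2).
apply: eq_measurable_fun => q _; rewrite /rhp_sqr /=.
by case: ifP => // _; rewrite expr0n.
Qed.

Lemma fcosN (h : R -> R) y : fcos h (- y) = fcos h y.
Proof. by apply: eq_RI => t; rewrite mulrN cosN. Qed.

Lemma fsinN (h : R -> R) y : L1 h -> fsin h (- y) = - fsin h y.
Proof.
move=> h1; rewrite /fsin -RIN; last by apply: (L1_sin _ h1); exact: measurable_mulr_cst.
by apply: eq_RI => t; rewrite mulrN sinN mulrN.
Qed.

Lemma laplace_class_sqr (f : R -> R[i]) x : laplace_class f -> 0 < x ->
  L1 (on_pos (fun t => expR (- (2 * x * t)) * nc (f t) ^+ 2)).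
Proof.
move=> [[_ H1] [_ H2]] x0; apply: eq_L1 (L1D (H1 _ x0) (H2 _ x0)) => t.
by rewrite !on_posE; case: ifP => _; rewrite ?addr0 // normc_sqr mulrDr.
Qed.

(** Adding the values at [y] and [- y] cancels the mixed products, sine transforms being odd; what
    remains is twice the sum of [plancherel_real] for the two coordinates of the damped function. *)
Lemma plancherel_line (f : R -> R[i]) x : laplace_class f -> 0 < x ->
  (\int[mu]_y (nc (laplace f (x +i* y)) ^+ 2)%:E =
   (2 * pi * RI (on_pos (fun t => expR (- (2 * x * t)) * nc (f t) ^+ 2)))%:E)%E.
Proof.
move=> Hf x0; have [fr fi] := Hf.
have Lp := L1_damp fr x0; have Lq := L1_damp fi x0.
have Lp2 := L1_damp_sqr fr x0; have Lq2 := L1_damp_sqr fi x0.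
set p := damp x _ in Lp Lp2; set q := damp x _ in Lq Lq2.
have cF := holomorphic_continuous (laplace_holomorphic Hf).
rewrite (ge0_integral_symmetrize (f := fun y => nc (laplace f (x +i* y)) ^+ 2)); first last.
- by move=> y; exact: sqr_ge0.
- apply: measurable_funX; apply: continuous_measurable_fun.
  exact: (continuous_rhp_line cF normc_dist).
have k0 (u : R -> R) y : 0 <= on_pos (fun y => fcos u y ^+ 2 + fsin u y ^+ 2) y.
  by rewrite on_posE; case: ifP => // _; rewrite addr_ge0 ?sqr_ge0.
have mk (u : R -> R) : L1 u -> measurable_fun setT (on_pos (fun y => fcos u y ^+ 2 + fsin u y ^+ 2)).
  move=> Lu; apply: measurable_on_pos; apply: measurable_funTS.
  by apply: measurable_funD; apply: measurable_funX; apply: continuous_measurable_fun;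
    [exact: continuous_fcos|exact: continuous_fsin].
transitivity (\int[mu]_y (2%:E * ((on_pos (fun y => fcos p y ^+ 2 + fsin p y ^+ 2) y)%:E +
    (on_pos (fun y => fcos q y ^+ 2 + fsin q y ^+ 2) y)%:E)))%E.
  apply: eq_integral => y _; rewrite -EFinD -EFinM !on_posE; case: ifP => _; last by rewrite addr0 mulr0.
  rewrite !normc_sqr !laplace_fourier //= !fcosN !fsinN // -/p -/q.
  by congr EFin; ring.
rewrite ge0_integralZl //=; first last.
- by move=> y _; rewrite adde_ge0 // lee_fin.
- by apply: emeasurable_funD; apply: measurable_EFin; exact: mk.
rewrite ge0_integralD //=; first last.
- by apply: measurable_EFin; exact: mk.
- by move=> y _; rewrite lee_fin.
- by apply: measurable_EFin; exact: mk.
- by move=> y _; rewrite lee_fin.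
rewrite !plancherel_real // -EFinD -EFinM; congr EFin.
rewrite -mulrDr mulrA; congr (_ * _); rewrite -RID //; apply: eq_RI => t.
rewrite /p /q !damp_sqr !on_posE; case: ifP => _; rewrite ?addr0 // normc_sqr.
by rewrite mulrDr.
Qed.

End HalfPlaneMeasurability.

(** * Tonelli for squared moduli of Laplace transforms, and the constant of the Bergman norm *)

Section Isometry.
Context {R : realType}.
Notation mu := (@lebesgue_measure R).
Notation nc := (@ComplexField.Normc.normc R).
Implicit Types (f : R -> R[i]) (z w : R[i]).

Lemma measurable_sqr_normc f : laplace_class f ->
  measurable_fun (`]0, +oo[%classic : set R) (fun t => nc (f t) ^+ 2).
Proof.
move=> [[m1 _] [m2 _]].
apply: (eq_measurable_fun (fun t => complex.Re (f t) ^+ 2 + complex.Im (f t) ^+ 2)).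
  by move=> t _; rewrite normc_sqr.
by apply: measurable_funD; exact: measurable_funX.
Qed.

Lemma measurable_expR_prod (e : R) :
  measurable_fun setT (fun p : R * R => expR (- (2 * (p.1 + e) * p.2))).
Proof.
apply: measurableT_comp; first exact: measurable_expR.
apply: measurableT_comp => //; apply: measurable_funM => //.
by apply: measurable_funM => //; exact: measurable_funD.
Qed.

(** Common source of both isometries: the Zen norm takes [nu] for [m], the indicator of [[0, oo)]
    for [g] and [e > 0]; the Bergman norm takes Lebesgue measure, a power on (0, oo) and [e = 0].
    The condition linking [g] and [e] keeps the lines that count inside the half-plane. *)
Lemma tonelli_laplace (m : {sigma_finite_measure set (measurableTypeR R) -> \bar R})
    (g : R -> R) (e : R) f :
  measurable_fun setT g -> (forall r, 0 <= g r) -> (forall r, g r != 0 -> 0 < r + e) ->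
  laplace_class f ->
  (\int[m \x mu]_p (g p.1 * rhp_sqr (laplace f) (p.1 + e, p.2))%:E =
   \int[mu]_t ((on_pos (fun t => nc (f t) ^+ 2) t)%:E *
      \int[m]_r (2 * pi * g r * expR (- (2 * (r + e) * t)))%:E))%E.
Proof.
move=> mg g0 ge Hf.
have cF := holomorphic_continuous (laplace_holomorphic Hf).
have mE : measurable_fun setT (on_pos (fun t => nc (f t) ^+ 2)).
  by apply: measurable_on_pos; exact: measurable_sqr_normc.
have E0 t : 0 <= on_pos (fun t => nc (f t) ^+ 2) t.
  by rewrite on_posE; case: ifP => // _; exact: sqr_ge0.
have mh : measurable_fun setT (fun p : R * R => g p.1 * rhp_sqr (laplace f) (p.1 + e, p.2)).
  apply: measurable_funM; first exact: measurable_of_fst.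
  apply: (measurableT_comp (measurable_rhp_sqr cF)).
  apply/measurable_fun_pairP; split => /=; last exact: measurable_snd.
  by apply: measurable_funD.
rewrite fubini_tonelli1 /=; first last.
- by move=> p; rewrite lee_fin mulr_ge0 ?rhp_sqr_ge0.
- by apply/measurable_EFinP.
pose k (p : R * R) := 2 * pi * g p.1 * (expR (- (2 * (p.1 + e) * p.2)) * on_pos (fun t => nc (f t) ^+ 2) p.2).
have p0 : 0 <= 2 * pi :> R by rewrite mulr_ge0 ?pi_ge0.
have k0 p : 0 <= k p by rewrite /k !mulr_ge0 ?expR_ge0 ?pi_ge0.
have mk : measurable_fun setT k.
  apply: measurable_funM.
    by apply: measurable_funM => //; exact: measurable_of_fst.
  apply: measurable_funM; first exact: measurable_expR_prod.
  exact: measurable_of_snd.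
transitivity (\int[m]_r \int[mu]_t (k (r, t))%:E)%E.
  apply: eq_integral => r _; rewrite /fubini_F /=.
  have [gr|gr] := eqVneq (g r) 0.
    rewrite /k /= gr; under eq_integral do rewrite mul0r.
    by under [RHS]eq_integral do rewrite mulr0 mul0r.
  have re := ge r gr.
  under eq_integral do rewrite EFinM.
  rewrite ge0_integralZl //=; first last.
  - by rewrite lee_fin.
  - by move=> y _; rewrite lee_fin; exact: rhp_sqr_ge0.
  - apply/measurable_EFinP; apply: (measurableT_comp (measurable_rhp_sqr cF)).
    exact: pair1_measurable.
  under eq_integral do rewrite /rhp_sqr /= re.
  have Lk := L1Z (2 * pi * g r) (laplace_class_sqr Hf re).
  rewrite plancherel_line // -EFinM mulrA (mulrC (g r)) -RIZ; last exact: laplace_class_sqr.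
  rewrite -RIE //; apply: eq_integral => t _; congr EFin.
  by rewrite /k /= !on_posE; case: ifP => _; rewrite ?mulr0.
rewrite (fubini_tonelli (m1 := m) (m2 := mu) (fun p => (k p)%:E)); first last.
- by move=> p; rewrite lee_fin.
- exact/measurable_EFinP.
apply: eq_integral => t _.
rewrite -ge0_integralZl //=; first last.
- by rewrite lee_fin.
- by move=> r _; rewrite lee_fin mulr_ge0 ?expR_ge0 // mulr_ge0.
- apply/measurable_EFinP; apply: measurable_funM; first exact: measurable_funM.
  exact: (measurableT_comp (measurable_expR_prod e) (measurable_pair2 t)).
by apply: eq_integral => r _; rewrite -EFinM /k /=; congr EFin; ring.
Qed.

Lemma ge0_integral_scale (c : R) (f : R -> \bar R) : 0 < c -> measurable_fun setT f ->
  (forall x, 0 <= f x)%E ->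
  (\int[mu]_x f x = c%:E * \int[mu]_x f (c * x)%R)%E.
Proof.
move=> c0 mf f0.
have mc : measurable_fun setT ((fun x => c * x) : R -> measurableTypeR R).
  exact: measurable_funM.
have c0' : 0 <= c by exact: ltW.
pose cn : {nonneg R} := NngNum c0'.
have H (A : set R) : measurable A ->
   mscale cn (pushforward mu ((fun x => c * x) : R -> measurableTypeR R)) A = mu A.
  move=> mA; apply/esym/lebesgue_measure_unique => //= _ [[a b]] _ <-.
  suff : (mu [set` `]a, b]%R] = c%:E * mu ((fun x : R => (c * x)%R) @^-1` [set` `]a, b]%R]))%E by [].
  have -> : (fun x : R => c * x) @^-1` [set` `]a, b]] = [set` `](c^-1 * a), (c^-1 * b)]].
    by apply/seteqP; split => x /=; rewrite !in_itv /= ltr_pdivrMl // ler_pdivlMl.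
  rewrite !lebesgue_measure_itv /= !lte_fin ltr_pM2l ?invr_gt0 //.
  case: ifP => _; last by rewrite mule0.
  by rewrite -!EFinD -EFinM -mulrBr mulrA mulfV ?mul1r // gt_eqF.
transitivity (c%:E * \int[mu]_(x in ((fun x : R => c * x)%R : R -> measurableTypeR R) @^-1` setT)
   (f \o (fun x => c * x)%R) x)%E => //.
rewrite -ge0_integral_pushforward //= -[c%:E]/(cn%:num%:E) -ge0_integral_mscale //.
by apply: eq_measure_integral => A mA _; rewrite [RHS]H.
Qed.

(** The value is [Gamma (alpha + 1) / 2 ^ alpha]; the argument relies on its being finite and
    positive. *)
Definition bergman_const (alpha : R) : \bar R :=
  \int[mu]_x (on_pos (fun x => 2 * x `^ alpha * expR (- (2 * x))) x)%:E.

Lemma measurable_bergman_kernel (alpha t : R) :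
  measurable_fun setT (on_pos (fun x => 2 * x `^ alpha * expR (- (2 * (x * t))))).
Proof.
apply: measurable_on_pos; apply: measurable_funTS; apply: measurable_funM.
  by apply: measurable_funM => //; exact: measurable_powR.
apply: measurableT_comp; first exact: measurable_expR.
apply: measurableT_comp => //; apply: measurable_funM => //.
exact: measurable_funM.
Qed.

(** Rescaling the variable by [t]: this is the origin of the weight [t ^ (- (alpha + 1))]. *)
Lemma bergman_kernelE (alpha t : R) : 0 < t ->
  (\int[mu]_x (on_pos (fun x => 2 * x `^ alpha * expR (- (2 * (x * t)))) x)%:E =
   (t `^ (- (alpha + 1)))%:E * bergman_const alpha)%E.
Proof.
move=> t0; rewrite /bergman_const.
have m1 : measurable_fun setT (on_pos (fun x : R => 2 * x `^ alpha * expR (- (2 * x)))).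
  have := measurable_bergman_kernel alpha 1; apply: eq_measurable_fun => x _.
  by apply: eq_on_pos => _; rewrite mulr1.
have g0 x : (0 <= (on_pos (fun x : R => 2 * x `^ alpha * expR (- (2 * x))) x)%:E)%E.
  by rewrite lee_fin on_posE; case: ifP => // _; rewrite !mulr_ge0 ?expR_ge0 ?powR_ge0.
rewrite [in RHS](ge0_integral_scale t0 (measurable_EFin m1) g0).
rewrite muleA -EFinM.
have -> : t `^ (- (alpha + 1)) * t = t `^ (- alpha).
  rewrite -{2}(powRr1 (ltW t0)) -powRD; last by rewrite (gt_eqF t0) implybT.
  by congr (_ `^ _); ring.
rewrite -ge0_integralZl //=; first last.
- by rewrite lee_fin powR_ge0.
- apply: measurable_EFin; apply: (measurableT_comp m1); exact: measurable_funM.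
apply: eq_integral => x _; rewrite -EFinM !on_posE pmulr_rgt0 //.
case: ifP => x0; last by rewrite mulr0.
rewrite powRM ?(ltW x0) ?(ltW t0) // powRN (mulrC t x); congr EFin.
by field; rewrite gt_eqF // powR_gt0.
Qed.

(** One half of the exponential is kept as integrable majorant, the other half bounds the power: by
    1 on [(0, 1]], by a factorial beyond. Positivity comes from [[1, 2]], where the integrand is at
    least [2 * expR (- 4)]. *)
Lemma bergman_const_fin (alpha : R) : 0 <= alpha ->
  exists2 c : R, 0 < c & bergman_const alpha = c%:E.
Proof.
move=> a0.
have m1 : measurable_fun setT (on_pos (fun x : R => 2 * x `^ alpha * expR (- (2 * x)))).
  have := measurable_bergman_kernel alpha 1; apply: eq_measurable_fun => x _.
  by apply: eq_on_pos => _; rewrite mulr1.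
have ge0 x : 0 <= on_pos (fun x : R => 2 * x `^ alpha * expR (- (2 * x))) x.
  by rewrite on_posE; case: ifP => // _; rewrite !mulr_ge0 ?expR_ge0 ?powR_ge0.
have L : L1 (on_pos (fun x : R => 2 * x `^ alpha * expR (- (2 * x)))).
  pose n := Num.bound alpha.
  have an : alpha <= n.+1%:R.
    apply: (@le_trans _ _ n%:R); last by rewrite ler_nat.
    by apply/ltW; exact: archi_boundP.
  apply: (L1_le _ _ (L1Z (2 * (1 + n.+1`!%:R)) (L1_pexp (ltr01 : (0 : R) < 1)))) => // x.
  rewrite ger0_norm // !on_posE; case: ifP => x0; last by rewrite mulr0.
  rewrite -!mulrA ler_wpM2l // mul1r.
  have -> : expR (- (2 * x)) = expR (- x) * expR (- x) by rewrite -expRD; congr expR; ring.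
  rewrite mulrA ler_wpM2r ?expR_ge0 // expRN ler_pdivrMr ?expR_gt0 //.
  have e1 : 1 <= expR x by rewrite -expR0 ler_expR ltW.
  have [x1|x1] := leP x 1.
    apply: (@le_trans _ _ 1); first by rewrite -(powRr0 x); apply: ger_powR => //; rewrite x0.
    by rewrite -[leLHS]mulr1; apply: ler_pM => //; rewrite lerDl.
  apply: (@le_trans _ _ (x `^ n.+1%:R)); first by apply: ler_powR => //; exact: ltW.
  rewrite powR_mulrn ?(ltW x0) // mulrDl.
  have := expR_ge1Dxn n (ltW x0) => h.
  have h2 : x ^+ n.+1 / n.+1`!%:R <= expR x by apply: le_trans h; rewrite lerDr.
  rewrite ler_pdivrMr ?ltr0n ?fact_gt0 // in h2.
  by apply: le_trans h2 _; rewrite mulrC lerDr mul1r expR_ge0.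
exists (RI (on_pos (fun x : R => 2 * x `^ alpha * expR (- (2 * x))))); last by rewrite -RIE.
rewrite -lte_fin -RIE //.
apply: (@lt_le_trans _ _ (\int[mu]_(x in `[1%R, 2%R]) (2 * expR (- 4))%:E)%E).
  rewrite integral_cst //= lebesgue_measure_itv /= lte_fin ltr1n -EFinD -EFinM lte_fin.
  by rewrite !mulr_gt0 ?expR_gt0 // subr_gt0 ltr1n.
apply: (@le_trans _ _ (\int[mu]_(x in `[1%R, 2%R]) (on_pos (fun x : R => 2 * x `^ alpha * expR (- (2 * x))) x)%:E)%E).
  apply: ge0_le_integral => //.
  - by apply/measurable_EFinP/measurable_funTS.
  - move=> x /=; rewrite in_itv /= => /andP[x1 x2]; rewrite lee_fin on_posE.
    rewrite (lt_le_trans _ x1) // -mulrA ler_wpM2l //.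
    rewrite -[leLHS]mul1r; apply: ler_pM => //; rewrite ?expR_ge0 //.
      by rewrite -(powRr0 x); exact: ler_powR.
    by rewrite ler_expR lerN2; lra.
apply: ge0_subset_integral => //.
- by apply/measurable_EFinP.
- by move=> x _; rewrite lee_fin.
Qed.

End Isometry.

(** * The weight of a Zen space *)

Section ZenWeight.
Context {R : realType}.
Variable nu : {measure set (measurableTypeR R) -> \bar R}.
Hypothesis Hnu : zen_measure nu.

Let ball0 (r : R) : \bar R := nu `[0%R, r[%classic.

Let ball0_fin r : 0 < r -> exists2 a : R, 0 < a & ball0 r = a%:E.
Proof.
case: Hnu => _ _ H _ r0; have := H r r0; rewrite -/(ball0 r).
case: (ball0 r) => [a| |] //= /andP[] //; rewrite ?lte_fin => a0 _; by exists a.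
Qed.

Let measurable_ball0 (r : R) : measurable (`[0%R, r[%classic : set R).
Proof. exact: measurable_itv. Qed.

Lemma doubling_constant : exists2 D : R, 1 <= D &
  forall r, 0 < r -> (ball0 (2 * r) <= D%:E * ball0 r)%E.
Proof.
case: Hnu => _ _ _; set S := [set _ | _ in _] => H.
have HS r : 0 < r -> (ball0 (2 * r) / ball0 r <= ereal_sup S)%E.
  by move=> r0; apply: ereal_sup_ubound; exists r.
have [s Hs] : exists s : R, (ereal_sup S <= s%:E)%E.
  by move: H; case: (ereal_sup S) => [s| |] // _; [exists s|exists 0; rewrite leNye].
exists (Num.max 1 s); first by rewrite le_max lexx.
move=> r r0; have [a a0 ea] := ball0_fin r0.
have r20 : 0 < 2 * r by rewrite mulr_gt0.
have [b b0 eb] := ball0_fin r20.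
have := le_trans (HS r r0) Hs; rewrite ea eb inver (gt_eqF a0) -!EFinM !lee_fin.
by rewrite ler_pdivrMr // => /le_trans; apply; rewrite ler_wpM2r ?(ltW a0) // le_max lexx orbT.
Qed.

Definition zen_laplace (s : R) : \bar R :=
  \int[nu]_(r in `[0%R, +oo[) (expR (- (r * s)))%:E.

Lemma zen_weightE t : zen_weight nu t = ((2 * pi)%:E * zen_laplace (2 * t))%E.
Proof.
rewrite /zen_weight /zen_laplace; congr (_ * _)%E.
by apply: eq_integral => r _; congr (expR (- _))%:E; ring.
Qed.

Let measurable_exp (s : R) : measurable_fun (`[0%R, +oo[%classic : set R) (fun r => (expR (- (r * s)))%:E).
Proof.
apply/measurable_EFinP.
apply: (eq_measurable_fun (fun r => expR (- (s * r)))); last exact: measurable_expRM.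
by move=> r _; rewrite mulrC.
Qed.

Lemma ball0_le_laplace (x s : R) : 0 < x -> 0 < s ->
  ((expR (- (x * s)))%:E * ball0 x <= zen_laplace s)%E.
Proof.
move=> x0 s0; rewrite /zen_laplace.
apply: (@le_trans _ _ (\int[nu]_(r in `[0%R, x[) (expR (- (r * s)))%:E)%E); last first.
  apply: ge0_subset_integral => //.
  - exact: measurable_exp.
  - by move=> r /=; rewrite !in_itv /= andbT => /andP[].
rewrite -integral_cst //; apply: ge0_le_integral => //.
- by move=> r _; rewrite lee_fin expR_ge0.
- apply: measurable_funS (measurable_exp s) => //.
  by move=> r /=; rewrite !in_itv /= andbT => /andP[].
- move=> r /=; rewrite in_itv /= => /andP[r0 rx]; rewrite lee_fin ler_expR lerN2.
  by rewrite ler_wpM2r // ltW.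
Qed.

(** Take [n] least with [x < 2 ^+ n] and [m] with [2 * D <= 2 ^+ m]. For [n > 0], [(2 * D) ^+ n <=
    (2 ^+ n) ^+ m <= (2 * x) ^+ m], and the exponential beats this power. The 2 next to the doubling
    constant [D] will make a series geometric. *)
Lemma exp_dyadic (D : R) : 1 <= D -> exists2 M : R, 0 < M &
  forall x : R, 0 <= x -> exists2 n : nat, x < 2 ^+ n & expR (- x) <= M / (2 * D) ^+ n.
Proof.
move=> D1; have D0 : 0 < D by exact: lt_le_trans ltr01 D1.
have exn (y : R) : exists n : nat, y < 2 ^+ n.
  exists (Num.bound y); apply: (@lt_le_trans _ _ (Num.bound y)%:R).
    have [y0|y0] := leP 0 y; first exact: archi_boundP.
    by apply: lt_le_trans y0 _.
  by rewrite -natrX ler_nat ltnW // ltn_expl.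
have [m0 Hm0] := exn (2 * D).
pose m := m0.+1.
have Hm : 2 * D <= 2 ^+ m.
  by apply: (le_trans (ltW Hm0)); rewrite ler_weXn2l // ler1n.
exists (2 ^+ m * m`!%:R); first by rewrite mulr_gt0 ?exprn_gt0 // ltr0n fact_gt0.
move=> x x0.
have [n xn nmin] := ex_minnP (exn x).
exists n => //; have d0 : 0 < (2 * D) ^+ n by rewrite exprn_gt0 // mulr_gt0.
rewrite ler_pdivlMr // expRN mulrC ler_pdivrMr ?expR_gt0 //.
have [n0|n0] := posnP n.
  rewrite n0 expr0 -[leLHS]mulr1; apply: ler_pM => //.
    rewrite -[leLHS]mulr1; apply: ler_pM => //; first by rewrite exprn_ege1 // ler1n.
    by rewrite ler1n fact_gt0.
  by rewrite -expR0 ler_expR.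
have xn1 : 2 ^+ n.-1 <= x.
  rewrite leNgt; apply/negP => /nmin; by rewrite -ltnS prednK // ltnn.
have x2 : 2 ^+ n <= 2 * x.
  by rewrite -(prednK n0) exprS ler_pM2l.
apply: (@le_trans _ _ ((2 * x) ^+ m)).
  apply: (@le_trans _ _ ((2 ^+ m) ^+ n)).
    by rewrite lerXn2r // nnegrE ?mulr_ge0 ?exprn_ge0 // ltW.
  by rewrite exprAC lerXn2r // nnegrE ?mulr_ge0 ?exprn_ge0.
rewrite exprMn -mulrA ler_pM2l ?exprn_gt0 //.
have := expR_ge1Dxn m0 x0 => h.
have h2 : x ^+ m / m`!%:R <= expR x by apply: le_trans h; rewrite lerDr.
by rewrite ler_pdivrMr ?ltr0n ?fact_gt0 // mulrC in h2.
Qed.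

(** The exponential is dominated by a sum of indicators of the intervals [B n] with coefficients
    [M / (2 * D) ^+ n]. Doubling bounds the mass of [B n] by [D ^+ n] times that of [B 0], so the
    series is geometric of ratio [1 / 2] and sums to [2 * M] times this mass. *)
Lemma zen_laplace_doubling : exists2 K : R, 1 <= K &
  forall s, 0 < s -> (zen_laplace s <= K%:E * ball0 s^-1)%E.
Proof.
have [D D1 HD] := doubling_constant.
have D0 : 0 < D by exact: lt_le_trans ltr01 D1.
have [M M0 HM] := exp_dyadic D1.
exists (Num.max 1 (2 * M)); first by rewrite le_max lexx.
move=> s s0; have si0 : 0 < s^-1 by rewrite invr_gt0.
have [a a0 ea] := ball0_fin si0.
pose c n := M / (2 * D) ^+ n.
have c0 n : 0 <= c n by rewrite divr_ge0 ?(ltW M0) // exprn_ge0 // mulr_ge0 // ltW.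
pose B n : set R := `[0%R, 2 ^+ n * s^-1[%classic.
have HB n : (nu (B n) <= (D ^+ n * a)%:E)%E.
  elim: n => [|n IH]; first by rewrite /B !expr0 !mul1r -ea.
  rewrite /B exprS -mulrA -/(ball0 _).
  have p : 0 < 2 ^+ n * s^-1 by rewrite mulr_gt0 // exprn_gt0.
  apply: (le_trans (HD _ p)).
  by rewrite exprS -mulrA EFinM lee_wpmul2l // lee_fin ltW.
have mB n : measurable (B n) by exact: measurable_ball0.
pose f n (r : R) : \bar R := (c n * \1_(B n) r)%:E.
have f0 n r : (0 <= f n r)%E by rewrite lee_fin mulr_ge0.
have mf n (E : set R) : measurable_fun E (f n).
  by apply/measurable_EFinP; apply: measurable_funM => //; apply: measurable_funTS; exact: measurable_indic.
apply: (@le_trans _ _ (\int[nu]_(r in `[0%R, +oo[) (\sum_(n <oo) f n r)%E)%E).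
  apply: ge0_le_integral => //.
  - exact: measurable_exp.
  - apply: (@ge0_emeasurable_sum _ _ _ _ f xpredT) => [k x _ _|k _]; [exact: f0|exact: mf].
  - move=> r /=; rewrite in_itv /= andbT => r0.
    have rs0 : 0 <= r * s by rewrite mulr_ge0 // ltW.
    have [n rn en] := HM _ rs0.
    apply: (@le_trans _ _ (f n r)).
      have Br : B n r by rewrite /B /= in_itv /= r0 /= ltr_pdivlMr.
      by rewrite /f lee_fin indicE mem_set // mulr1.
    apply: le_trans (nneseries_lim_ge n.+1 (fun k _ _ => f0 k r)).
    by rewrite big_nat_recr //= leeDr // sume_ge0.
rewrite integral_nneseries //; last by move=> n; exact: mf.
(* The terms are written over [2 ^ n.+1] to fit [epsilon_trick0], whence the factor 2. *)
apply: (@le_trans _ _ (\sum_(n <oo) (2 * M * a / (2 ^ n.+1)%:R)%:E)%E).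
  apply: lee_nneseries => [n _ _|n _]; first by apply: integral_ge0.
  rewrite /f; under eq_integral do rewrite EFinM.
  rewrite ge0_integralZl //=; first last.
  - by rewrite lee_fin.
  - by apply/measurable_EFinP; apply: measurable_funTS; apply: measurable_indic; exact: mB.
  rewrite integral_indic //=; last exact: mB.
  apply: (@le_trans _ _ ((c n)%:E * (D ^+ n * a)%:E)%E).
    rewrite lee_wpmul2l ?lee_fin //; apply: le_trans (HB n).
    apply: le_measure; rewrite ?inE //; last exact: mB.
    by apply: measurableI; [exact: mB|exact: measurable_itv].
  rewrite -EFinM lee_fin /c exprMn natrX exprS le_eqVlt; apply/orP; left; apply/eqP.
  by field; rewrite !expf_neq0 // gt_eqF.
apply: (le_trans (epsilon_trick0 xpredT _)); first by rewrite !mulr_ge0 // ltW.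
by rewrite ea -EFinM lee_fin ler_wpM2r ?(ltW a0) // le_max lexx orbT.
Qed.

(** The interval of length [2 / s] governs both values: its mass bounds the transform at [s / 2]
    from above by [zen_laplace_doubling], and the one at [s] from below with the loss
    [expR (- 2)]. *)
Lemma zen_laplace_half : exists2 K : R, 1 <= K & forall s, 0 < s ->
  exists2 l : R, 0 < l & zen_laplace s = l%:E /\ (zen_laplace (s / 2) <= (K * l)%:E)%E.
Proof.
have [K K1 HK] := zen_laplace_doubling.
have K0 : 0 < K by exact: lt_le_trans ltr01 K1.
exists (K * expR 2); first by rewrite -[leLHS]mulr1; apply: ler_pM => //; rewrite -expR0 ler_expR.
move=> s s0; have s20 : 0 < s / 2 by rewrite divr_gt0.
have si0 : 0 < s^-1 by rewrite invr_gt0.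
have si20 : 0 < (s / 2)^-1 by rewrite invr_gt0.
have [a a0 ea] := ball0_fin si0; have [b b0 eb] := ball0_fin si20.
have h1 := ball0_le_laplace si0 s0; rewrite ea mulVf ?gt_eqF // -EFinM in h1.
have h1' := ball0_le_laplace si20 s0.
rewrite eb -EFinM (_ : (s / 2)^-1 * s = 2) in h1'; last by field; rewrite gt_eqF.
have h2 := HK s s0; rewrite ea -EFinM in h2.
have h3 := HK _ s20; rewrite eb -EFinM in h3.
have [l el] : exists l : R, zen_laplace s = l%:E.
  case: (zen_laplace s) h1 h2 => [l| |] //; by exists l.
exists l; first by rewrite el lee_fin in h1; apply: lt_le_trans h1; rewrite mulr_gt0 // expR_gt0.
split => //; apply: (le_trans h3); rewrite lee_fin.
rewrite el lee_fin expRN mulrC ler_pdivrMr ?expR_gt0 // in h1'.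
by rewrite -mulrA ler_pM2l // mulrC.
Qed.

(* Doubling bounds the Laplace transform of nu at s / 2 by K times its value at s,
   hence w s - w t <= K (t - s) / s * w s; this yields the power C. *)
Lemma zen_weight_properties : exists w : R -> R,
  [/\ forall t, 0 < t -> 0 < w t,
      forall t, 0 < t -> zen_weight nu t = (w t)%:E,
      forall s t, 0 < s <= t -> w t <= w s,
      forall x, 0 < x -> exists2 c : R, 0 < c & forall t, 0 < t -> c * expR (- (2 * x * t)) <= w t &
      exists C : nat, forall s t, 0 < s <= t -> s ^+ C * w s <= t ^+ C * w t].
Proof.
have [P [p0 PE]] : exists P : R, 0 < P /\ 2 * pi = P.
  by exists (2 * pi); rewrite mulr_gt0 ?pi_gt0.
have [K K1 HK] := zen_laplace_half.
have K0 : 0 < K by exact: lt_le_trans ltr01 K1.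
pose w t := P * fine (zen_laplace (2 * t)).
have lE s : 0 < s -> zen_laplace s = (fine (zen_laplace s))%:E.
  by move=> s0; have [l _ [-> _]] := HK s s0.
have l0 s : 0 < s -> 0 < fine (zen_laplace s).
  by move=> s0; have [l l0 [-> _]] := HK s s0.
have wE t : 0 < t -> zen_weight nu t = (w t)%:E.
  by move=> t0; rewrite zen_weightE PE lE ?mulr_gt0 // -EFinM.
have w0 t : 0 < t -> 0 < w t by move=> t0; rewrite /w mulr_gt0 // l0 // mulr_gt0.
exists w; split => //.
- move=> s t /andP[s0 st]; have t0 := lt_le_trans s0 st.
  rewrite /w ler_pM2l // -lee_fin -!lE ?mulr_gt0 //.
  apply: ge0_le_integral => //.
  + exact: measurable_exp.
  + exact: measurable_exp.
  + move=> r /=; rewrite in_itv /= andbT => r0; rewrite lee_fin ler_expR lerN2.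
    by rewrite ler_wpM2l // ler_pM2l.
- move=> x x0; have [a a0 ea] := ball0_fin x0.
  exists (P * a); first by rewrite mulr_gt0.
  move=> t t0; have t20 : 0 < 2 * t by rewrite mulr_gt0.
  have := ball0_le_laplace x0 t20; rewrite ea lE // -EFinM lee_fin => h.
  rewrite /w -mulrA ler_pM2l // mulrC; apply: le_trans h.
  by rewrite le_eqVlt; apply/orP; left; apply/eqP; congr (expR (- _) * _); ring.
(* Along a short step [t = s * (1 + x)] the relative decrease of [w] is at most [K * x]; an integer
   [C >= 2 * K] lets [(1 + x) ^+ C] make up for it while [K * x <= 1 / 2]. *)
pose C := (Num.bound (2 * K)).+1.
have CK : 2 * K <= C%:R.
  apply: (@le_trans _ _ (Num.bound (2 * K))%:R); last by rewrite ler_nat.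
  by apply/ltW; apply: archi_boundP; rewrite mulr_ge0 // ltW.
exists C; clearbody C.
(* Integrated form of [e^{-2rt} >= e^{-2rs} (1 - 2r(t - s))]: the bound [2rs e^{-rs} <= 1] trades
   the factor [r] for half of the exponent, which leaves the transform at [s], and
   [zen_laplace_half] brings it back to [2 * s]. *)
have incr s t : 0 < s <= t -> w s <= w t + (t - s) / s * (K * w s).
  move=> /andP[s0 st]; have t0 := lt_le_trans s0 st.
  have s20 : 0 < 2 * s by rewrite mulr_gt0.
  have t20 : 0 < 2 * t by rewrite mulr_gt0.
  have q0 : 0 <= (t - s) / s by rewrite divr_ge0 ?subr_ge0 // ltW.
  have [l ll [el eh]] := HK _ s20.
  have s2 : 2 * s / 2 = s by field.
  have H : (zen_laplace (2 * s) <= zen_laplace (2 * t) + ((t - s) / s)%:E * zen_laplace s)%E.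
    rewrite /zen_laplace -ge0_integralZl //=; first last.
    - exact: measurable_exp.
    rewrite -ge0_integralD //=; first last.
    - by apply: measurable_funeM; exact: measurable_exp.
    - by move=> r _; rewrite mule_ge0 // lee_fin expR_ge0.
    - exact: measurable_exp.
    apply: ge0_le_integral => //.
    - exact: measurable_exp.
    - by apply: emeasurable_funD; [exact: measurable_exp|apply: measurable_funeM; exact: measurable_exp].
    - move=> r /=; rewrite in_itv /= andbT => r0; rewrite -EFinM -EFinD lee_fin.
      have rs0 : 0 <= r * s by rewrite mulr_ge0 // ltW.
      set e := expR (- (r * s)).
      have e1 : expR (- (r * (2 * s))) = e * e by rewrite /e -expRD; congr expR; ring.
      have ep : 0 <= e by exact: expR_ge0.
      have e2 : expR (- (r * (2 * t))) = e * e * expR (- (2 * r * (t - s))).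
        by rewrite /e -!expRD; congr expR; ring.
      rewrite e1 e2.
      have h1 : 1 - 2 * r * (t - s) <= expR (- (2 * r * (t - s))) by exact: expR_ge1Dx.
      have h2 : 2 * (r * s) * e <= 1.
        rewrite /e expRN ler_pdivrMr ?expR_gt0 // mul1r.
        have h := expR_ge1Dx (r * s / 2).
        have -> : expR (r * s) = expR (r * s / 2) * expR (r * s / 2).
          by rewrite -expRD; congr expR; field.
        apply: (@le_trans _ _ ((1 + r * s / 2) * (1 + r * s / 2))).
          by have := sqr_ge0 (r * s / 2 - 1); rewrite expr2; lra.
        by apply: ler_pM => //; rewrite addr_ge0 // divr_ge0.
      have h3 : e * e * (1 - 2 * r * (t - s)) <= e * e * expR (- (2 * r * (t - s))).
        by rewrite ler_wpM2l ?mulr_ge0.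
      have h4 : (t - s) / s * e * (2 * (r * s) * e) <= (t - s) / s * e * 1.
        exact: ler_wpM2l (mulr_ge0 q0 ep) _ _ h2.
      have h5 : (t - s) / s * e * (2 * (r * s) * e) = e * e * (2 * r * (t - s)) by field; rewrite gt_eqF.
      by move: h3 h4; rewrite h5 mulr1; lra.
  rewrite s2 in eh.
  have H' : (zen_laplace (2 * s) <= zen_laplace (2 * t) + ((t - s) / s)%:E * (K * l)%:E)%E.
    by apply: (le_trans H); rewrite leeD2l // lee_wpmul2l.
  rewrite (lE (2 * t)) // el -EFinM -EFinD lee_fin in H'.
  rewrite /w el /=.
  have := ler_wpM2l (ltW p0) H'; rewrite mulrDr => h.
  by apply: (le_trans h); rewrite lerD2l le_eqVlt; apply/orP; left; apply/eqP; ring.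
clearbody w.
have step s t : 0 < s <= t -> t <= s * (1 + (2 * K)^-1) -> s ^+ C * w s <= t ^+ C * w t.
  move=> /[dup] st /andP[s0 lest] tle; have ws := w0 s s0.
  pose x := (t - s) / s.
  have x0 : 0 <= x by rewrite divr_ge0 ?subr_ge0 // ltW.
  have tE : t = s * (1 + x) by rewrite /x; field; rewrite gt_eqF.
  have xle : x <= (2 * K)^-1.
    by move: tle; rewrite tE ler_pM2l // lerD2l.
  have h1 : w s * (1 - K * x) <= w t.
    by have := incr s t st; rewrite -/x; lra.
  clearbody x.
  have h2 : 1 + C%:R * x <= (1 + x) ^+ C.
    elim: (C) => [|n IH]; first by rewrite mul0r addr0 expr0.
    rewrite exprS -natr1; have := ler_wpM2l (_ : 0 <= 1 + x) IH.
    rewrite addr_ge0 // => /(_ isT); apply: le_trans.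
    have : 0 <= n%:R * x * x by rewrite !mulr_ge0.
    by lra.
  have Kx : K * x <= 2^-1.
    by move: xle; rewrite -(ler_pM2l K0) invfM mulrCA mulfV ?mulr1 ?gt_eqF.
  have h3 : 1 <= (1 + C%:R * x) * (1 - K * x).
    have c1 : 0 <= (C%:R - 2 * K) * x by rewrite mulr_ge0 // subr_ge0.
    have c2 : 0 <= C%:R * x * (2^-1 - K * x) by rewrite mulr_ge0 ?mulr_ge0 // subr_ge0.
    by lra.
  have t0 : 0 < t by exact: lt_le_trans lest.
  have -> : t ^+ C = s ^+ C * (1 + x) ^+ C by rewrite tE exprMn.
  rewrite -[leRHS]mulrA ler_pM2l ?exprn_gt0 //.
  apply: (@le_trans _ _ ((1 + x) ^+ C * (w s * (1 - K * x)))); last first.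
    by rewrite ler_wpM2l // exprn_ge0 // addr_ge0.
  rewrite mulrCA -[leLHS]mulr1 ler_pM2l //; apply: (le_trans h3).
  by apply: ler_wpM2r => //; lra.
pose q := 1 + (2 * K)^-1.
have iK0 : 0 < (2 * K)^-1 by rewrite invr_gt0 mulr_gt0.
have q1 : 1 <= q by rewrite lerDl ltW.
have q0 : 0 < q by exact: lt_le_trans ltr01 q1.
(* Steps of ratio at most [q] are chained; the powers of [q] exceed every ratio by Bernoulli's
   inequality. *)
have iter n s t : 0 < s <= t -> t <= s * q ^+ n -> s ^+ C * w s <= t ^+ C * w t.
  elim: n s => [|n IH] s /andP[s0 st].
    rewrite expr0 mulr1 => ts; have -> : t = s by apply/eqP; rewrite eq_le ts st.
    by [].
  rewrite exprS mulrA => tq.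
  have [tsq|tsq] := leP t (s * q); first by apply: step => //; rewrite s0.
  apply: (@le_trans _ _ ((s * q) ^+ C * w (s * q))).
    by apply: step => //; rewrite s0 /= ler_peMr // ltW.
  by apply: IH => //; rewrite mulr_gt0 //= ltW.
move=> s t /[dup] st /andP[s0 _].
have [n Hn] : exists n : nat, t / s <= q ^+ n.
  exists (Num.bound (t / s * (2 * K))).
  have ts0 : 0 <= t / s * (2 * K).
    by rewrite mulr_ge0 ?mulr_ge0 ?invr_ge0 ?(ltW K0) ?(ltW s0) // (le_trans (ltW s0)) //; case/andP: st.
  have := archi_boundP ts0; set N := Num.bound _ => hN.
  apply: (@le_trans _ _ (1 + N%:R * (2 * K)^-1)).
    apply: (@le_trans _ _ (N%:R * (2 * K)^-1)); last by rewrite lerDr.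
    by rewrite ler_pdivlMr ?mulr_gt0 // ltW.
  elim: (N) => [|n IH]; first by rewrite mul0r addr0 expr0.
  rewrite exprS -natr1; have := ler_wpM2l (ltW q0) IH; apply: le_trans.
  have : 0 <= n%:R * (2 * K)^-1 * (2 * K)^-1 by rewrite !mulr_ge0 // ltW.
  by rewrite /q; lra.
by apply: (iter n) => //; rewrite mulrC -ler_pdivrMr.
Qed.

End ZenWeight.

(** * Zen and Bergman norms of Laplace transforms *)

Section Norms.
Context {R : realType}.
Notation mu := (@lebesgue_measure R).
Notation nc := (@ComplexField.Normc.normc R).
Implicit Types (f g : R -> R[i]) (v : R -> R).

(** Tonelli asks for a sigma-finite measure, while [nu] carries only the structure of a measure. The
    exhaustion by []-oo, n + 1[] uses that the negative half-line is null; the equality of measures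
    then allows rewriting inside the norm. *)
Lemma zen_sigma_finite (nu : {measure set (measurableTypeR R) -> \bar R}) : zen_measure nu ->
  exists m : {sigma_finite_measure set (measurableTypeR R) -> \bar R},
    nu = m :> {measure set (measurableTypeR R) -> \bar R}.
Proof.
case=> H0 _ Hfin _.
have sf : sigma_finite setT nu.
  exists (fun n : nat => `]-oo, n.+1%:R[%classic).
    apply/esym; rewrite -subTset => x _; exists (Num.bound `|x|) => //=; rewrite in_itv /=.
    apply: (le_lt_trans (ler_norm x)); apply: (lt_le_trans (archi_boundP _)) => //.
    by rewrite ler_nat.
  move=> n; split; first exact: measurable_itv.
  have /andP[_ fn] := Hfin n.+1%:R (ltr0Sn _ _).
  have -> : `]-oo, n.+1%:R[%classic = `]-oo, 0%R[%classic `|` `[0%R, n.+1%:R[%classic :> set R.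
    apply/seteqP; split => x /=; rewrite !in_itv /=.
      by move=> ->; rewrite andbT; case: (ltP x 0) => ?; [left|right].
    by case=> [x0|/andP[_ ->]//]; apply: lt_trans x0 _.
  apply: (le_lt_trans (measureU2 _ _ _)); [exact: measurable_itv|exact: measurable_itv|].
  apply: le_lt_trans fn; rewrite -[leRHS]add0e leeD // le_eqVlt; apply/orP; left.
  by apply/eqP; exact: H0.
pose H1 := isSigmaFinite.Build _ _ _ _ sf.
pose H2 := isSFinite.Build _ _ _ _ (sfinite_measure_sigma_finite sf).
pose m := HB.pack_for (SigmaFiniteMeasure.type (measurableTypeR R) R) (Measure.sort nu) H1 H2.
by exists m; exact: eq_measure.
Qed.

Definition weighted_sqr v f : \bar R :=
  \int[mu]_t (on_pos (fun t => nc (f t) ^+ 2 * v t) t)%:E.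

(** Preimages under the Laplace transform are known on the half-plane only; the shift by [e > 0]
    keeps the argument inside it even at [p.1 = 0]. *)
Lemma eq_rhp_zen_norm (nu : {measure set (measurableTypeR R) -> \bar R}) (F G : R[i] -> R[i]) :
  (forall z, rhp z -> F z = G z) -> zen_norm nu F = zen_norm nu G.
Proof.
move=> FG; rewrite /zen_norm; congr (sqrte (ereal_sup _)).
apply: eq_imagel => e /= e0; apply: eq_integral => p; rewrite inE => -[/= p0 _].
rewrite FG // /rhp /=; move: p0; rewrite in_itv /= andbT => p0.
exact: ltr_wpDl.
Qed.

Lemma eq_rhp_bergman_norm alpha (F G : R[i] -> R[i]) :
  (forall z, rhp z -> F z = G z) -> bergman_norm alpha F = bergman_norm alpha G.
Proof.
move=> FG; rewrite /bergman_norm; congr (sqrte (_ * _)%E).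
apply: eq_integral => p; rewrite inE => -[/= p0 _].
rewrite FG // /rhp /=; by move: p0; rewrite in_itv /= andbT.
Qed.

Lemma bergman_normE alpha (F : R[i] -> R[i]) :
  bergman_norm alpha F = sqrte ((pi^-1)%:E *
    \int[mu \x mu]_p (p.1 `^ alpha * rhp_sqr F p)%:E)%E.
Proof.
rewrite /bergman_norm integral_mkcond; congr (sqrte (_ * _)%E).
apply: eq_integral => p _; rewrite patchE /rhp_sqr.
have -> : (p \in `]0%R, +oo[%classic `*` setT) = (0 < p.1).
  by apply/idP/idP; rewrite inE /= in_itv /= andbT => // -[].
by case: ifP => // _; rewrite mulr0.
Qed.

Lemma weighted_sqr_ge0 v f : (forall t, 0 < t -> 0 <= v t) -> (0 <= weighted_sqr v f)%E.
Proof.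
move=> v0; apply: integral_ge0 => t _; rewrite lee_fin on_posE; case: ifP => // t0.
by rewrite mulr_ge0 ?sqr_ge0 ?v0.
Qed.

Lemma measurable_weighted v f : measurable_fun (`]0, +oo[%classic : set R) v ->
  measurable_fun (`]0, +oo[%classic : set R) (fun t => complex.Re (f t)) ->
  measurable_fun (`]0, +oo[%classic : set R) (fun t => complex.Im (f t)) ->
  measurable_fun setT (on_pos (fun t => nc (f t) ^+ 2 * v t)).
Proof.
move=> mv m1 m2; apply: measurable_on_pos; apply: measurable_funM => //.
apply: (eq_measurable_fun (fun t => complex.Re (f t) ^+ 2 + complex.Im (f t) ^+ 2)).
  by move=> t _; rewrite normc_sqr.
by apply: measurable_funD; exact: measurable_funX.
Qed.

(** [c] is the real value of [bergman_const alpha]; the [pi] of Plancherel cancels the [pi^-1] of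
    the norm. *)
Lemma bergman_norm_laplace alpha : 0 <= alpha ->
  exists2 c : R, 0 < c & forall f, laplace_class f ->
  bergman_norm alpha (laplace f) = sqrte (weighted_sqr (fun t => c * t `^ (- (alpha + 1))) f).
Proof.
move=> a0; have [c c0 cE] := bergman_const_fin a0.
exists c => // f Hf; rewrite bergman_normE; congr sqrte.
have p0 : 0 < pi :> R by exact: pi_gt0.
pose g (r : R) := if 0 < r then r `^ alpha else 0.
have mg : measurable_fun setT g.
  apply: (eq_measurable_fun (on_pos (fun r => r `^ alpha))); first by move=> x _; rewrite on_posE.
  by apply: measurable_on_pos; apply: measurable_funTS; exact: measurable_powR.
have g0 r : 0 <= g r by rewrite /g; case: ifP => // _; exact: powR_ge0.
have gr r : g r != 0 -> 0 < r + 0 by rewrite /g addr0; case: ifP; rewrite ?eqxx.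
have H := @tonelli_laplace R mu g 0 f mg g0 gr Hf.
have -> : (\int[mu \x mu]_p (p.1 `^ alpha * rhp_sqr (laplace f) p)%:E =
    \int[mu \x mu]_p (g p.1 * rhp_sqr (laplace f) (p.1 + 0, p.2))%:E)%E.
  apply: eq_integral => -[x y] _; congr EFin; rewrite /g /rhp_sqr /= addr0.
  by case: ifP => _; rewrite ?mulr0.
rewrite {}H.
have -> : (\int[mu]_t ((on_pos (fun t => nc (f t) ^+ 2) t)%:E *
      \int[mu]_r (2 * pi * g r * expR (- (2 * (r + 0) * t)))%:E) =
    pi%:E * weighted_sqr (fun t => (c * t `^ (- (alpha + 1)))%R) f)%E.
  rewrite -ge0_integralZl //=; first last.
  - by rewrite lee_fin ltW.
  - move=> t _; rewrite lee_fin on_posE; case: ifP => // _.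
    by rewrite mulr_ge0 ?sqr_ge0 // mulr_ge0 ?powR_ge0 // ltW.
  - apply: measurable_EFin; case: Hf => -[m1 _] [m2 _].
    apply: measurable_weighted => //; apply: measurable_funM => //.
    by apply: measurable_funTS; exact: measurable_powR.
  apply: eq_integral => t _; rewrite !on_posE; case: ifP => t0; last by rewrite mul0e mule0.
  have -> : (\int[mu]_r (2 * pi * g r * expR (- (2 * (r + 0) * t)))%:E =
     pi%:E * \int[mu]_x (on_pos (fun x => 2 * x `^ alpha * expR (- (2 * (x * t)))) x)%:E)%E.
    rewrite -ge0_integralZl //=; first last.
    - by rewrite lee_fin ltW.
    - by move=> r _; rewrite lee_fin on_posE; case: ifP => // _; rewrite !mulr_ge0 ?expR_ge0 ?powR_ge0.
    - by apply: measurable_EFin; exact: measurable_bergman_kernel.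
    apply: eq_integral => r _; rewrite -EFinM /g on_posE; case: ifP => _; last by rewrite !(mulr0, mul0r).
    congr EFin; rewrite (_ : 2 * (r + 0) * t = 2 * (r * t)); first ring.
    by rewrite addr0 mulrA.
  rewrite bergman_kernelE // cE -!EFinM; congr EFin.
  by rewrite [LHS]mulrCA; congr (_ * _); congr (_ * _); rewrite mulrC.
by rewrite muleA -EFinM mulVf ?gt_eqF // mul1e.
Qed.

Lemma cvg_integral_damp (k : R -> R) : measurable_fun setT (on_pos k) ->
  (forall t, 0 < t -> 0 <= k t) ->
  (\int[mu]_t (on_pos (fun t => expR (- (n.+1%:R^-1 * t)) * k t) t)%:E @[n --> \oo] -->
   \int[mu]_t (on_pos k t)%:E)%E.
Proof.
move=> mk k0; pose gn n : R -> R := on_pos (fun t => expR (- (n.+1%:R^-1 * t)) * k t).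
have gnk t : gn n t @[n --> \oo] --> on_pos k t.
  rewrite on_posE; case: ifP => t0; last first.
    by apply: cvg_near_cst; apply: nearW => n; rewrite /gn on_posE t0.
  rewrite (_ : (fun n => gn n t) = (fun n => expR (- (n.+1%:R^-1 * t)) * k t)); last first.
    by apply/funext => n; rewrite /gn on_posE t0.
  rewrite -[X in _ --> X]mul1r; apply: cvgMl.
  have ht : (fun n : nat => - (n.+1%:R^-1 * t) : R) @ \oo --> (- 0 : R).
    by apply: cvgN; rewrite -(mul0r t); apply: cvgMl; exact: cvg_harmonic.
  rewrite -[X in _ --> X]expR0 -[X in _ --> expR X]oppr0.
  exact: (continuous_cvg _ (@continuous_expR R _) ht).
have -> : (\int[mu]_t (on_pos k t)%:E = \int[mu]_t limn (fun n => (gn n t)%:E))%E.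
  apply: eq_integral => t _; apply/esym/cvg_lim => //.
  by apply: cvg_EFin; [exact: nearW|exact: gnk].
apply: cvg_monotone_convergence => //.
- move=> n; apply: measurable_EFin.
  rewrite (_ : on_pos _ = (fun t => expR (- (n.+1%:R^-1 * t)) * on_pos k t)); last first.
    by apply/funext => t; rewrite !on_posE; case: ifP; rewrite ?mulr0.
  by apply: measurable_funM => //; exact: measurable_expRM.
- move=> n t _; rewrite lee_fin on_posE; case: ifP => // t0.
  by rewrite mulr_ge0 ?expR_ge0 // k0.
- move=> t _ m n mn; rewrite lee_fin !on_posE; case: ifP => // t0.
  rewrite ler_wpM2r ?k0 // ler_expR lerN2 ler_pM2r // lef_pV2 ?posrE ?ltr0n //.
  by rewrite ler_nat.
Qed.

(** Monotonicity is known on (0, oo) only; replacing [t] by its maximum with [1 / (n + 1)] gives a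
    function monotone on the line, equal to [v] at a given [t > 0] once [n] is large. *)
Lemma measurable_nonincreasing_pos v :
  (forall s t, 0 < s <= t -> v t <= v s) -> measurable_fun (`]0, +oo[%classic : set R) v.
Proof.
move=> vanti.
refine (@measurable_fun_cvg _ _ R _ (fun (n : nat) (t : R) => v (Num.max t n.+1%:R^-1)) v _ _) => [n|t /=].
  apply: nonincreasing_measurable; first exact: measurable_itv.
  move=> s t st; apply: vanti; rewrite lt_max invr_gt0 ltr0Sn orbT /=.
  by rewrite ge_max !le_max st lexx /= orbT.
rewrite in_itv /= andbT => t0; apply: cvg_near_cst.
have := @cvg_harmonic R => /cvgrPdist_lt /(_ _ t0); apply: filterS => n.
rewrite sub0r normrN gtr0_norm ?invr_gt0 // => nt; congr v.
by apply/max_idPl; exact: ltW.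
Qed.

Section Zen.
Variables (nu : {measure set (measurableTypeR R) -> \bar R}) (w : R -> R).
Hypothesis Hnu : zen_measure nu.
Hypothesis w0 : forall t, 0 < t -> 0 < w t.
Hypothesis wE : forall t, 0 < t -> zen_weight nu t = (w t)%:E.
Hypothesis wanti : forall s t, 0 < s <= t -> w t <= w s.
Hypothesis wexp : forall x, 0 < x -> exists2 c : R, 0 < c &
  forall t, 0 < t -> c * expR (- (2 * x * t)) <= w t.

Let measurable_w : measurable_fun (`]0, +oo[%classic : set R) w := measurable_nonincreasing_pos wanti.

Lemma L2w_normE f : L2w_norm nu f = sqrte (weighted_sqr w f).
Proof.
rewrite /L2w_norm integral_mkcond; congr sqrte; apply: eq_integral => t _.
rewrite patchE on_posE mem_setE in_itv /= andbT; case: ifP => // t0.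
by rewrite wE.
Qed.

Lemma L2w_laplace_class f : L2w nu f -> laplace_class f.
Proof.
case=> m1 m2; rewrite L2w_normE => Hf.
have W0 : (0 <= weighted_sqr w f)%E by apply: weighted_sqr_ge0 => t /w0/ltW.
have L : L1 (on_pos (fun t => nc (f t) ^+ 2 * w t)).
  apply/L1_ge0P; first exact: (measurable_weighted measurable_w).
  - move=> t; rewrite on_posE; case: ifP => // t0; rewrite mulr_ge0 ?sqr_ge0 //.
    exact/ltW/w0.
  - rewrite ltNge leye_eq; apply/negP => /eqP E; move: Hf.
    by rewrite /weighted_sqr E.
have H (p : R[i] -> R) : (forall z, `|p z| <= nc z) ->
    measurable_fun (`]0, +oo[%classic : set R) (fun t => p (f t)) ->
    damped_L2 (fun t => p (f t)).
  move=> pn mp; split => // x x0; have [c c0 Hc] := wexp x0.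
  apply: L1_le (L1Z c^-1 L).
    apply: measurable_on_pos; apply: measurable_funM; first exact: measurable_expRM.
    exact: measurable_funX.
  move=> t; rewrite !on_posE; case: ifP => [t0|_]; last by rewrite normr0 mulr0.
  rewrite ger0_norm; last by apply: mulr_ge0; [exact: expR_ge0|exact: sqr_ge0].
  rewrite mulrC [leRHS]mulrCA; apply: ler_pM; rewrite ?sqr_ge0 ?expR_ge0 //.
    by rewrite -real_normK ?num_real // lerXn2r ?nnegrE ?normc_ge0.
  by rewrite [leRHS]mulrC ler_pdivlMr // [leLHS]mulrC; exact: Hc.
by split; apply: H => // z; [exact: normRe_le|exact: normIm_le].
Qed.

(** For each shift [e] Tonelli turns the integral into the one with weight
    [expR (- (2 * e * t)) * w t]; the supremum over [e] is then a monotone limit. *)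
Lemma zen_norm_laplace f : laplace_class f ->
  zen_norm nu (laplace f) = sqrte (weighted_sqr w f).
Proof.
move=> Hf; have [m mE] := zen_sigma_finite Hnu.
have [[m1 _] [m2 _]] := Hf.
rewrite /zen_norm; congr sqrte.
have E e : 0 < e -> (\int[nu \x mu]_(p in `[0%R, +oo[%classic `*` setT)
    (nc (laplace f ((p.1 + e)%R +i* p.2)) ^+ 2)%:E =
    weighted_sqr (fun t => (expR (- (2 * e * t)) * w t)%R) f)%E.
  move=> e0; pose g : R -> R := \1_(`[0, +oo[%classic).
  have gE r : g r = if 0 <= r then 1 else 0.
    by rewrite /g indicE mem_setE in_itv /= andbT; case: ifP.
  have mg : measurable_fun setT g by apply: measurable_indic; exact: measurable_itv.
  have g0 r : 0 <= g r by rewrite gE; case: ifP.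
  have gr r : g r != 0 -> 0 < r + e.
    by rewrite gE; case: ifP => [r0 _|_ /eqP//]; exact: ltr_wpDl.
  have H := @tonelli_laplace R m g e f mg g0 gr Hf.
  rewrite mE integral_mkcond.
  transitivity (\int[m \x mu]_p (g p.1 * rhp_sqr (laplace f) (p.1 + e, p.2))%:E)%E.
    apply: eq_integral => p _; rewrite patchE.
    have -> : (p \in `[0%R, +oo[%classic `*` setT) = (0 <= p.1).
      by apply/idP/idP; rewrite inE /= in_itv /= andbT => // -[].
    rewrite gE; case: ifP => p0; last by rewrite mul0r.
    by rewrite mul1r /rhp_sqr /= ltr_wpDl.
  rewrite H.
  apply: eq_integral => t _; rewrite !on_posE; case: ifP => t0; last by rewrite mul0e.
  rewrite [RHS]EFinM; congr (_ * _)%E; rewrite [RHS]EFinM -wE // /zen_weight mE muleA -EFinM.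
  rewrite -ge0_integralZl //=; first last.
  - by rewrite lee_fin mulr_ge0 ?expR_ge0 // mulr_ge0 ?pi_ge0.
  - apply/measurable_EFinP.
    apply: (eq_measurable_fun (fun r => expR (- (2 * t * r)))); last exact: measurable_expRM.
    by move=> r _; congr expR; ring.
  rewrite [RHS]integral_mkcond; apply: eq_integral => r _.
  rewrite patchE mem_setE in_itv /= andbT gE.
  case: ifP => _; last by rewrite mulr0 mul0r.
  rewrite -EFinM; congr EFin; rewrite (mulrDr 2 r e) mulrDl opprD expRD mulr1.
  by rewrite [RHS]mulrAC [RHS]mulrC (mulrC (expR (- (2 * e * t)))).
have le1 (x : R) : 0 <= x -> expR (- x) <= 1.
  by move=> x0; rewrite -expR0 ler_expR lerNl oppr0.
have mW (e : R) : measurable_fun setT (on_pos (fun t => nc (f t) ^+ 2 * (expR (- (2 * e * t)) * w t))).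
  by apply: measurable_weighted => //; apply: measurable_funM => //; exact: measurable_expRM.
have W0 t : 0 < t -> 0 <= nc (f t) ^+ 2 * w t.
  by move=> t0; rewrite mulr_ge0 ?sqr_ge0 // ltW // w0.
apply/eqP; rewrite eq_le; apply/andP; split.
  apply: ge_ereal_sup => _ [e /= e0 <-]; rewrite E //.
  apply: ge0_le_integral => //.
  - move=> t _; rewrite lee_fin on_posE; case: ifP => // t0.
    by rewrite mulr_ge0 ?sqr_ge0 // mulr_ge0 ?expR_ge0 // ltW // w0.
  - by apply: measurable_EFin; exact: mW.
  - by apply: measurable_EFin; exact: measurable_weighted.
  - move=> t _; rewrite lee_fin !on_posE; case: ifP => // t0.
    rewrite ler_wpM2l ?sqr_ge0 // ler_piMl ?(ltW (w0 t0)) // le1 //.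
    by rewrite mulr_ge0 ?mulr_ge0 // ltW.
have H := cvg_integral_damp (measurable_weighted measurable_w m1 m2) W0.
rewrite /weighted_sqr -(cvg_lim _ H) //; apply: lime_le; first by apply/cvg_ex; eexists; exact: H.
(* Half of [1 / (n + 1)], because the damping contains [2 * e]. *)
apply: nearW => n; have e0 : 0 < n.+1%:R^-1 / 2 :> R by rewrite divr_gt0 // invr_gt0.
apply: ereal_sup_ubound; exists (n.+1%:R^-1 / 2) => //; rewrite E //.
apply: eq_integral => t _; congr EFin; apply: eq_on_pos => t0.
by rewrite mulrCA; congr (expR (- _) * _); field.
Qed.

End Zen.

(** Injectivity, read off Plancherel's identity on the single line of abscissa 1. *)
Lemma laplace_eq0 f : laplace_class f -> (forall z, rhp z -> laplace f z = 0) ->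
  {ae mu, forall t, 0 < t -> f t = 0}.
Proof.
move=> Hf F0; have L := laplace_class_sqr Hf (@ltr01 R).
set K := on_pos _ in L.
have K0 t : 0 <= K t.
  by rewrite /K on_posE; case: ifP => // _; rewrite mulr_ge0 ?expR_ge0 ?sqr_ge0.
have := plancherel_line Hf (@ltr01 R); rewrite integral0_eq; last first.
  by move=> y _; rewrite F0 ?normc0 ?expr0n // /rhp /=.
move=> /esym /eqP; rewrite eqe mulf_eq0 mulf_eq0 gt_eqF //= gt_eqF ?pi_gt0 //= => /eqP RK.
have : (\int[mu]_t `|(K t)%:E| = 0)%E.
  rewrite -[RHS]/(0%:E) -RK -RIE //; apply: eq_integral => t _.
  by rewrite gee0_abs ?lee_fin.
move=> /(ae_eq_integral_abs mu measurableT (measurable_EFin (L1_measurable L))).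
apply: ae_mono => t /(_ I) [] Kt t0; apply/normc_eq0.
move: Kt; rewrite /K on_posE t0 => /eqP; rewrite mulf_eq0 gt_eqF ?expR_gt0 //= sqrf_eq0.
by move=> /eqP.
Qed.

End Norms.

(** * Goursat's theorem on rectangles *)

Section Goursat.
Context {R : realType}.
Notation mu := (@lebesgue_measure R).
Notation nc := (@ComplexField.Normc.normc R).
Implicit Types (f g : R -> R) (a b c m x y w h : R).

(** Half-open, so that adjacent segments add up without overlap. *)
Definition seg a b f : R -> R := f \_ `[a, b[.

Lemma segE a b f t : seg a b f t = if a <= t < b then f t else 0.
Proof. by rewrite /seg patchE mem_setE in_itv. Qed.

Lemma L1_seg a b f : (forall t, a <= t <= b -> {for t, continuous f}) -> L1 (seg a b f).
Proof.
move=> cf; rewrite /L1 /seg -restrict_EFin.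
apply: (proj1 (integrable_mkcond _ _)); first exact: measurable_itv.
have L : mu.-integrable `[a, b] (EFin \o f).
  apply: continuous_compact_integrable; first exact: segment_compact.
  by apply: continuous_in_subspaceT => t; rewrite inE /= in_itv /=; exact: cf.
apply: integrableS L; [exact: measurable_itv|exact: measurable_itv|].
by move=> t /=; rewrite !in_itv /= => /andP[-> /ltW].
Qed.

Lemma seg_split a m b f : a <= m <= b -> L1 (seg a m f) -> L1 (seg m b f) ->
  RI (seg a b f) = RI (seg a m f) + RI (seg m b f).
Proof.
move=> /andP[am mb] l1 l2; rewrite -RID //; apply: eq_RI => t; rewrite !segE.
case: (ltP t m) => tm; rewrite ?andbF ?andbT.
  by rewrite (lt_le_trans tm mb) andbT addr0.
by rewrite (le_trans am tm) add0r.
Qed.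

Lemma L1_seg_cst a b c : L1 (seg a b (cst c)).
Proof. by apply: L1_seg => t _; exact: cst_continuous. Qed.

Lemma RI_seg_cst a b c : a <= b -> RI (seg a b (cst c)) = c * (b - a).
Proof.
move=> ab; have L : L1 (seg a b (cst 1)) by exact: L1_seg_cst.
rewrite (@eq_RI _ _ (fun t => c * seg a b (cst 1) t)); last first.
  by move=> t; rewrite !segE; case: ifP; rewrite /= ?mulr1 ?mulr0.
rewrite RIZ //; congr (_ * _); apply: EFin_inj; rewrite -RIE //.
rewrite -[RHS](_ : mu `[a, b[ = _); last first.
  by rewrite lebesgue_measure_itv /= lte_fin; case: ltgtP ab => // -> _; rewrite subrr.
rewrite -[RHS]mul1e -integral_cst; last exact: measurable_itv.
rewrite [RHS]integral_mkcond; apply: eq_integral => t _.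
by rewrite patchE segE mem_setE in_itv /=; case: ifP.
Qed.

Lemma seg_near a b c m f : a <= b -> L1 (seg a b f) -> 0 <= m ->
  (forall t, a <= t < b -> `|f t - c| <= m) ->
  `|RI (seg a b f) - c * (b - a)| <= m * (b - a).
Proof.
move=> ab Lf m0 H; rewrite -!RI_seg_cst // -RIB //; last exact: L1_seg_cst.
apply: norm_RI_le; [by apply: L1B => //; exact: L1_seg_cst|exact: L1_seg_cst|].
move=> t; rewrite !segE; case: ifP => [/H//|_]; by rewrite subrr normr0.
Qed.

Lemma seg_norm_le a b f g : L1 (seg a b f) -> L1 (seg a b g) ->
  (forall t, a <= t < b -> `|f t| <= g t) -> `|RI (seg a b f)| <= RI (seg a b g).
Proof.
move=> Lf Lg H; apply: norm_RI_le => // t; rewrite !segE; case: ifP => [/H//|_].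
by rewrite normr0.
Qed.

Variable K : R[i] -> R[i].
Hypothesis hK : holomorphic_rhp K.

Let U x y := complex.Re (K (x +i* y)).
Let V x y := complex.Im (K (x +i* y)).

Let cK : continuous_rhp K := holomorphic_continuous hK.

Lemma normRe_dist (z w : R[i]) : `|complex.Re z - complex.Re w| <= nc (z - w).
Proof. by rewrite -ReN -ReD; exact: normRe_le. Qed.

Lemma normIm_dist (z w : R[i]) : `|complex.Im z - complex.Im w| <= nc (z - w).
Proof. by rewrite -ImN -ImD; exact: normIm_le. Qed.

Let Lx (x1 x2 y1 y2 : R) : 0 < x1 -> L1 (seg x1 x2 (fun x => U x y1 - U x y2)).
Proof.
move=> x10; apply: L1_seg => t /andP[t1 _]; have t0 := lt_le_trans x10 t1.
by apply: cvgB; exact: (continuous_rhp_row cK normRe_dist t0).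
Qed.

Let Ly (x1 x2 y1 y2 : R) : 0 < x1 -> 0 < x2 -> L1 (seg y1 y2 (fun y => V x2 y - V x1 y)).
Proof.
move=> x10 x20; apply: L1_seg => t _.
by apply: cvgB; [exact: (continuous_rhp_line cK normIm_dist x20)|
  exact: (continuous_rhp_line cK normIm_dist x10)].
Qed.

(** Real part of the counterclockwise integral of [K z dz] around the rectangle with lower left
    corner [(x, y)] and sides [w], [h]. The imaginary part is recovered later by multiplying the
    integrand by the imaginary unit. *)
Let D x y w h := RI (seg x (x + w) (fun t => U t y - U t (y + h))) -
  RI (seg y (y + h) (fun t => V (x + w) t - V x t)).

Let rect_split x y w h : 0 < x -> 0 <= w -> 0 <= h ->
  D x y w h = D x y (w / 2) (h / 2) + D (x + w / 2) y (w / 2) (h / 2) +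
    (D x (y + h / 2) (w / 2) (h / 2) + D (x + w / 2) (y + h / 2) (w / 2) (h / 2)).
Proof.
move=> x0 w0 h0; rewrite /D.
have ew : x + w / 2 + w / 2 = x + w by field.
have eh : y + h / 2 + h / 2 = y + h by field.
rewrite ew eh.
have w2 : 0 <= w / 2 by rewrite divr_ge0.
have h2 : 0 <= h / 2 by rewrite divr_ge0.
have xw : 0 < x + w / 2 by rewrite ltr_wpDr.
have xw2 : 0 < x + w by rewrite ltr_wpDr.
have sx g : L1 (seg x (x + w / 2) g) -> L1 (seg (x + w / 2) (x + w) g) ->
    RI (seg x (x + w) g) = RI (seg x (x + w / 2) g) + RI (seg (x + w / 2) (x + w) g).
  by apply: seg_split; rewrite lerDl w2 -ew lerDl.
have sy g : L1 (seg y (y + h / 2) g) -> L1 (seg (y + h / 2) (y + h) g) ->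
    RI (seg y (y + h) g) = RI (seg y (y + h / 2) g) + RI (seg (y + h / 2) (y + h) g).
  by apply: seg_split; rewrite lerDl h2 -eh lerDl.
rewrite sx ?sy; [|exact: Ly|exact: Ly|exact: Lx|exact: Lx].
have ax a b : 0 < a -> RI (seg a b (fun t => U t y - U t (y + h))) =
    RI (seg a b (fun t => U t y - U t (y + h / 2))) +
    RI (seg a b (fun t => U t (y + h / 2) - U t (y + h))).
  move=> a0; rewrite -RID; [|exact: Lx|exact: Lx].
  by apply: eq_RI => t; rewrite !segE; case: ifP => _; [ring|rewrite addr0].
have ay a b : RI (seg a b (fun t => V (x + w) t - V x t)) =
    RI (seg a b (fun t => V (x + w / 2) t - V x t)) +
    RI (seg a b (fun t => V (x + w) t - V (x + w / 2) t)).
  rewrite -RID; [|exact: Ly|exact: Ly].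
  by apply: eq_RI => t; rewrite !segE; case: ifP => _; [ring|rewrite addr0].
rewrite !ax // !ay; ring.
Qed.

Let rect_quarter x y w h : 0 < x -> 0 <= w -> 0 <= h ->
  exists2 p : R * R, x <= p.1 <= x + w / 2 /\ y <= p.2 <= y + h / 2 &
    `|D x y w h| / 4 <= `|D p.1 p.2 (w / 2) (h / 2)|.
Proof.
move=> x0 w0 h0; have w2 : 0 <= w / 2 by rewrite divr_ge0.
have h2 : 0 <= h / 2 by rewrite divr_ge0.
apply: contrapT => H.
have {}H p : x <= p.1 <= x + w / 2 -> y <= p.2 <= y + h / 2 ->
    `|D p.1 p.2 (w / 2) (h / 2)| < `|D x y w h| / 4.
  by move=> p1 p2; rewrite ltNge; apply/negP => Hp; apply: H; exists p.
have := rect_split y x0 w0 h0.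
have h1 := H (x, y); have h3 := H (x + w / 2, y); have h4 := H (x, y + h / 2).
have h5 := H (x + w / 2, y + h / 2).
rewrite /= !lexx ?lerDl ?w2 ?h2 /= in h1 h3 h4 h5.
have {}h1 := h1 isT isT; have {}h3 := h3 isT isT; have {}h4 := h4 isT isT; have {}h5 := h5 isT isT.
move=> E; have : `|D x y w h| < `|D x y w h|.
  rewrite [ltLHS](_ : _ = `|D x y (w / 2) (h / 2) + D (x + w / 2) y (w / 2) (h / 2) +
    (D x (y + h / 2) (w / 2) (h / 2) + D (x + w / 2) (y + h / 2) (w / 2) (h / 2))|); last by rewrite -E.
  apply: le_lt_trans (ler_normD _ _) _.
  apply: le_lt_trans (lerD (ler_normD _ _) (ler_normD _ _)) _.
  by lra.
by rewrite ltxx.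
Qed.

(* The affine part of the integrand contributes nothing to the boundary integral. *)
Let rect_local (X Y : R) : 0 < X -> forall eta : R, 0 < eta -> exists2 del : R, 0 < del &
  forall x y w h, 0 < x -> 0 <= w -> 0 <= h -> x <= X <= x + w -> y <= Y <= y + h ->
  w + h < del -> `|D x y w h| <= 2 * eta * (w + h) ^+ 2.
Proof.
move=> X0 eta eta0; have /derivable_epsP[d Hd] := hK (X0 : rhp (X +i* Y)).
have [del del0 H] := Hd _ eta0; exists del => // x y w h x0 w0 h0 xX yY whd.
pose e s t := K (s +i* t) - K (X +i* Y) - d * ((s - X) +i* (t - Y)).
have eb s t : x <= s <= x + w -> y <= t <= y + h -> nc (e s t) <= eta * (w + h).
  move=> sx ty.
  have nb : nc ((s - X) +i* (t - Y)) <= w + h.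
    apply: le_trans (normc_le _) _ => /=; apply: lerD; rewrite ler_norml; lra.
  have -> : e s t = K ((X +i* Y) + ((s - X) +i* (t - Y))) - K (X +i* Y) - d * ((s - X) +i* (t - Y)).
    rewrite /e; congr (K _ - _ - _); apply: complex_ext; rewrite !ReImE /=; ring.
  apply: le_trans (H _ (le_lt_trans nb whd)) _.
  by rewrite ler_wpM2l // ltW.
have xw0 : 0 < x + w by rewrite ltr_wpDr.
have M0 : 0 <= 2 * eta * (w + h) by rewrite !mulr_ge0 ?addr_ge0 // ltW.
have hx := @seg_near x (x + w) (complex.Im d * h) (2 * eta * (w + h)) (fun t => U t y - U t (y + h)).
have hy := @seg_near y (y + h) (complex.Im d * w) (2 * eta * (w + h)) (fun t => V (x + w) t - V x t).
have {}hx : `|RI (seg x (x + w) (fun t => U t y - U t (y + h))) - complex.Im d * h * (x + w - x)|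
    <= 2 * eta * (w + h) * (x + w - x).
  apply: hx => //; [by rewrite lerDl|exact: Lx|].
  move=> t /andP[t1 t2].
  have e1 := eb t y; have e2 := eb t (y + h).
  rewrite t1 (ltW t2) !lexx ?lerDl h0 /= in e1 e2.
  have {}e1 := e1 isT isT; have {}e2 := e2 isT isT.
  rewrite (_ : U t y - U t (y + h) - complex.Im d * h = complex.Re (e t y) - complex.Re (e t (y + h))).
    apply: le_trans (ler_normB _ _) _.
    by have := normRe_le (e t y); have := normRe_le (e t (y + h)); lra.
  rewrite /e /U !ReImE /=; ring.
have {}hy : `|RI (seg y (y + h) (fun t => V (x + w) t - V x t)) - complex.Im d * w * (y + h - y)|
    <= 2 * eta * (w + h) * (y + h - y).
  apply: hy => //; [by rewrite lerDl|exact: Ly|].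
  move=> t /andP[t1 t2].
  have e1 := eb x t; have e2 := eb (x + w) t.
  rewrite t1 (ltW t2) !lexx ?lerDl w0 /= in e1 e2.
  have {}e1 := e1 isT isT; have {}e2 := e2 isT isT.
  rewrite (_ : V (x + w) t - V x t - complex.Im d * w = complex.Im (e (x + w) t) - complex.Im (e x t)).
    apply: le_trans (ler_normB _ _) _.
    by have := normIm_le (e (x + w) t); have := normIm_le (e x t); lra.
  rewrite /e /V !ReImE /=; ring.
rewrite /D; move: hx hy; set I := RI _; set J := RI _ => hx hy.
rewrite (_ : I - J = (I - complex.Im d * h * (x + w - x)) - (J - complex.Im d * w * (y + h - y))); last by ring.
apply: le_trans (ler_normB _ _) _; apply: le_trans (lerD hx hy) _.
by rewrite le_eqVlt; apply/orP; left; apply/eqP; ring.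
Qed.

Lemma nested_point (a l : nat -> R) : (forall n, a n <= a n.+1) ->
  (forall n, a n.+1 + l n.+1 <= a n + l n) -> (forall n, 0 <= l n) ->
  exists X, forall n, a n <= X <= a n + l n.
Proof.
move=> ha hb l0.
have ma : {homo a : m n / (m <= n)%N >-> m <= n} by apply/nondecreasing_seqP.
have mb : {homo (fun n => a n + l n) : m n / (m <= n)%N >-> n <= m} by apply/nonincreasing_seqP.
have ub (m n : nat) : a m <= a n + l n.
  case: (leqP m n) => [/ma h|/ltnW /mb h]; first by apply: le_trans h _; rewrite lerDl.
  by apply: le_trans h; rewrite lerDl.
have hs : has_sup (range a).
  by split; [exists (a 0%N), 0%N|exists (a 0%N + l 0%N) => _ [n _ <-]].
exists (sup (range a)) => n; apply/andP; split; first by apply: ub_le_sup; [case: hs|exists n].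
by apply: ge_sup; [case: hs|move=> _ [m _ <-]].
Qed.

(** Successive quartering keeps at least a fourth of the defect at each stage; the local estimate at
    the common point is quadratic in the sides, hence also loses a fourth per stage, but with a
    constant that can be made too small for the defect. *)
Lemma goursat x y w h : 0 < x -> 0 <= w -> 0 <= h ->
  RI (seg x (x + w) (fun t => U t y - U t (y + h))) =
  RI (seg y (y + h) (fun t => V (x + w) t - V x t)).
Proof.
move=> x0 w0 h0; apply/eqP; rewrite -subr_eq0 -/(D x y w h) -normr_eq0; apply: contrapT => /negP Dn0.
pose d := `|D x y w h|; have d0 : 0 < d by rewrite lt_neqAle eq_sym Dn0 normr_ge0.
pose W n := w / 2 ^+ n; pose H n := h / 2 ^+ n.
have W0 n : 0 <= W n by rewrite divr_ge0 ?exprn_ge0.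
have H0 n : 0 <= H n by rewrite divr_ge0 ?exprn_ge0.
have WS n : W n.+1 = W n / 2 by rewrite /W exprS; field; rewrite expf_neq0.
have HS n : H n.+1 = H n / 2 by rewrite /H exprS; field; rewrite expf_neq0.
(* The bound [x <= p.1] keeps every rectangle inside the half-plane. *)
pose bad n (p : R * R) := x <= p.1 /\ d / 4 ^+ n <= `|D p.1 p.2 (W n) (H n)|.
(* The choice runs over pairs of a stage and a corner, with [(0, 0)] returned at corners that are
   not bad, so that a plain recursion defines the nested sequence. *)
have /choice[s Hs] : forall q : nat * (R * R), exists p : R * R, bad q.1 q.2 ->
    [/\ bad q.1.+1 p, q.2.1 <= p.1 <= q.2.1 + W q.1.+1 & q.2.2 <= p.2 <= q.2.2 + H q.1.+1].
  move=> [n [u v]]; case: (pselect (bad n (u, v))) => [[xu Hb]|nb]; last by exists (0, 0).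
  have u0 : 0 < u by exact: lt_le_trans xu.
  have [p [p1 p2] Hp] := rect_quarter v u0 (W0 n) (H0 n).
  exists p => _ /=; rewrite !WS !HS; split => //; split; first by case/andP: p1 => h1 _; exact: le_trans h1.
  rewrite WS HS; apply: le_trans Hp; rewrite exprS /=.
  have -> : d / (4 * 4 ^+ n) = d / 4 ^+ n / 4 by field; rewrite expf_neq0.
  by rewrite ler_pM2r ?invr_gt0.
pose q := fix q n := if n is m.+1 then s (m, q m) else (x, y).
have bq n : bad n (q n).
  elim: n => [|n IH]; last by have [] := Hs (n, q n) IH.
  by split; rewrite /W /H /= ?expr0 ?divr1.
have sx n : (q n).1 <= (q n.+1).1 <= (q n).1 + W n.+1 by have [] := Hs (n, q n) (bq n).
have sy n : (q n).2 <= (q n.+1).2 <= (q n).2 + H n.+1 by have [] := Hs (n, q n) (bq n).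
have [X HX] : exists X, forall n, (q n).1 <= X <= (q n).1 + W n.
  apply: nested_point => // n; first by case/andP: (sx n).
  by have /andP[_] := sx n; rewrite WS; lra.
have [Y HY] : exists Y, forall n, (q n).2 <= Y <= (q n).2 + H n.
  apply: nested_point => // n; first by case/andP: (sy n).
  by have /andP[_] := sy n; rewrite HS; lra.
have X0 : 0 < X by apply: lt_le_trans x0 _; case/andP: (HX 0%N).
(* Chosen so that [2 * eta * (w + h) ^+ 2 < d]; the 1 covers a degenerate rectangle. *)
pose eta := d / (4 * ((w + h) ^+ 2 + 1)).
have P1 : 0 < (w + h) ^+ 2 + 1 by rewrite ltr_wpDl ?sqr_ge0.
have eta0 : 0 < eta by rewrite divr_gt0 // mulr_gt0.
have [del del0 Hl] := rect_local Y X0 eta0.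
have [n Hn] : exists n : nat, (w + h) / 2 ^+ n < del.
  exists (Num.bound ((w + h) / del)); set N := Num.bound _.
  have wd0 : 0 <= (w + h) / del by rewrite divr_ge0 ?addr_ge0 // ltW.
  rewrite ltr_pdivrMr ?exprn_gt0 // mulrC -ltr_pdivrMr //.
  apply: lt_le_trans (archi_boundP wd0) _.
  by rewrite -natrX ler_nat ltnW // ltn_expl.
have [xq Hb] := bq n.
have qx0 : 0 < (q n).1 by exact: lt_le_trans xq.
have whn : W n + H n = (w + h) / 2 ^+ n by rewrite /W /H mulrDl.
have := Hl _ _ _ _ qx0 (W0 n) (H0 n) (HX n) (HY n); rewrite whn => /(_ Hn).
move=> /(le_trans Hb); apply/negP; rewrite -ltNge.
rewrite exprMn exprVn -exprM mulnC exprM (_ : 2 ^+ 2 = 4); last by rewrite -natrX.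
rewrite mulrA ltr_pM2r ?invr_gt0 ?exprn_gt0 //.
have S0 : 0 <= (w + h) ^+ 2 by exact: sqr_ge0.
rewrite /eta; move: P1 S0; set S := (w + h) ^+ 2 => P1 S0.
rewrite (_ : _ * S = d * S / (2 * (S + 1))); last by field; rewrite gt_eqF.
by rewrite ltr_pdivrMr ?mulr_gt0 // ltr_pM2l //; lra.
Qed.

End Goursat.

(** * Holomorphic functions on the half-plane: products and exponentials *)

Section Holomorphy.
Context {R : realType}.
Notation nc := (@ComplexField.Normc.normc R).

Lemma holomorphicM (F G : R[i] -> R[i]) : holomorphic_rhp F -> holomorphic_rhp G ->
  holomorphic_rhp (fun z => F z * G z).
Proof. by move=> hF hG z zr; exact: (derivableM (hF z zr) (hG z zr)). Qed.

Lemma holomorphic_cst (c : R[i]) : holomorphic_rhp (fun=> c).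
Proof. by move=> z zr; exact: derivable_cst. Qed.

Lemma holomorphic_cexp (t : R) : holomorphic_rhp (fun z : R[i] => cexp (t%:C * z)).
Proof.
move=> z _; apply/derivable_epsP; exists (t%:C * cexp (t%:C * z)) => eta eta0.
pose E := nc (cexp (t%:C * z)); pose T := `|t|.
pose K1 := E * (4 * T ^+ 2 * expR T).
have E0 : 0 <= E by exact: normc_ge0.
have K10 : 0 <= K1.
  apply: mulr_ge0 => //; apply: mulr_ge0; last exact: expR_ge0.
  by apply: mulr_ge0 => //; exact: sqr_ge0.
exists (Num.min 1 (eta / (K1 + 1))); first by rewrite lt_min ltr01 divr_gt0 // ltr_wpDl.
move=> w; rewrite lt_min => /andP[w1 wd]; have w0 := normc_ge0 w.
pose u := t%:C * w.
have -> : cexp (t%:C * (z + w)) - cexp (t%:C * z) - t%:C * cexp (t%:C * z) * w =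
    cexp (t%:C * z) * (cexp u - 1 - u).
  by rewrite mulrDr cexpD -/u /u !mulrBr mulr1; congr (_ - _); rewrite mulrCA mulrA.
rewrite normcM -/E.
have nu : nc u = T * nc w.
  rewrite normcM; congr (_ * _).
  by rewrite /ComplexField.Normc.normc /= expr0n addr0 sqrtr_sqr.
have uT : nc u <= T by rewrite nu; apply: ler_piMr; [exact: normr_ge0|exact: ltW].
have [b1 b2] := cexp_bound (normRe_le u) (normIm_le u).
have b : nc (cexp u - 1 - u) <= 4 * nc u ^+ 2 * expR T.
  apply: le_trans (normc_le _) _; apply: le_trans (lerD b1 b2) _.
  rewrite -mulrDl -mulrDl -natrD; apply: ler_wpM2l; last by rewrite ler_expR.
  by apply: mulr_ge0 => //; exact: sqr_ge0.
apply: le_trans (ler_wpM2l E0 b) _.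
have -> : E * (4 * nc u ^+ 2 * expR T) = K1 * nc w * nc w by rewrite /K1 nu; ring.
apply: ler_wpM2r => //.
have : nc w <= eta / (K1 + 1) by exact: ltW.
rewrite ler_pdivlMr ?ltr_wpDl // => h.
by apply: le_trans h; rewrite mulrC ler_wpM2l // lerDl.
Qed.

End Holomorphy.

(** * Moving an integral from one vertical line to another *)

Section VerticalShift.
Context {R : realType}.
Notation mu := (@lebesgue_measure R).
Notation nc := (@ComplexField.Normc.normc R).

Lemma measurable_seg (a b : R) f : measurable_fun setT f -> measurable_fun setT (seg a b f).
Proof.
move=> mf; apply/(measurable_restrictT f (measurable_itv _)).
exact: measurable_funTS.
Qed.

Lemma norm_seg (a b : R) f t : `|seg a b f t| <= `|f t|.
Proof. by rewrite segE; case: ifP => //; rewrite normr0. Qed.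

Lemma seg_normc_L1 (K : R[i] -> R[i]) (x1 x2 y : R) : holomorphic_rhp K -> 0 < x1 ->
  L1 (seg x1 x2 (fun x => nc (K (x +i* y)))).
Proof.
move=> hK x10; apply: L1_seg => t /andP[t1 _]; have t0 := lt_le_trans x10 t1.
exact: (continuous_rhp_row (holomorphic_continuous hK) normc_dist t0).
Qed.

(** Only some arbitrarily large height is required, the same above and below the axis: this is what
    square integrability over a strip can provide, as opposed to decay along all heights. *)
Definition strip_decay (K : R[i] -> R[i]) (x1 x2 : R) : Prop :=
  forall eta Y0 : R, 0 < eta -> exists Y : R, [/\ Y0 <= Y,
    RI (seg x1 x2 (fun x => nc (K (x +i* Y)))) <= eta &
    RI (seg x1 x2 (fun x => nc (K (x +i* (- Y))))) <= eta].

(** Goursat on rectangles of growing height: the horizontal sides vanish along the heights of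
    [strip_decay], and dominated convergence recovers the full lines. *)
Lemma vertical_shift (K : R[i] -> R[i]) (x1 x2 : R) : holomorphic_rhp K -> 0 < x1 <= x2 ->
  L1 (fun y => complex.Im (K (x1 +i* y))) -> L1 (fun y => complex.Im (K (x2 +i* y))) ->
  strip_decay K x1 x2 ->
  RI (fun y => complex.Im (K (x1 +i* y))) = RI (fun y => complex.Im (K (x2 +i* y))).
Proof.
move=> hK /andP[x10 x12] L1x L2x dK; have x20 := lt_le_trans x10 x12.
pose h y := complex.Im (K (x2 +i* y)) - complex.Im (K (x1 +i* y)).
have Lh : L1 h by exact: L1B.
apply/esym/eqP; rewrite -subr_eq0 -RIB // -/h.
have /choice[Y HY] : forall n : nat, exists Y : R, [/\ n%:R <= Y,
    RI (seg x1 x2 (fun x => nc (K (x +i* Y)))) <= n.+1%:R^-1 &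
    RI (seg x1 x2 (fun x => nc (K (x +i* (- Y))))) <= n.+1%:R^-1].
  by move=> n; apply: dK; rewrite invr_gt0.
have small n : `|RI (seg (- Y n) (Y n) h)| <= 2 * n.+1%:R^-1.
  have [Yn H1 H2] := HY n.
  have Y0 : 0 <= Y n by apply: le_trans Yn.
  have := goursat hK (- Y n) x10 (_ : 0 <= x2 - x1) (_ : 0 <= 2 * Y n).
  rewrite subr_ge0 x12 mulr_ge0 // => /(_ isT isT).
  rewrite (_ : x1 + (x2 - x1) = x2); last by ring.
  rewrite (_ : - Y n + 2 * Y n = Y n); last by ring.
  rewrite -/h => <-.
  have Ln y : L1 (seg x1 x2 (fun x => nc (K (x +i* y)))) by exact: seg_normc_L1.
  have LD : L1 (seg x1 x2 (fun x => nc (K (x +i* (- Y n))) + nc (K (x +i* Y n)))).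
    apply: eq_L1 (L1D (Ln (- Y n)) (Ln (Y n))) => t; rewrite !segE.
    by case: ifP => //; rewrite addr0.
  apply: le_trans (@seg_norm_le _ _ _ _ _ _ LD _) _.
  - apply: L1_seg => t /andP[t1 _]; have t0 := lt_le_trans x10 t1.
    by apply: cvgB; exact: (continuous_rhp_row (holomorphic_continuous hK) (@normRe_dist R) t0).
  - move=> t _; apply: le_trans (ler_normB _ _) _.
    by apply: lerD; exact: normRe_le.
  rewrite (@eq_RI _ _ (fun t => seg x1 x2 (fun x => nc (K (x +i* (- Y n)))) t +
      seg x1 x2 (fun x => nc (K (x +i* Y n))) t)).
    by rewrite RID // mulr_natl mulr2n; exact: lerD.
  by move=> t; rewrite !segE; case: ifP => //; rewrite addr0.
have c : RI (seg (- Y n) (Y n) h) @[n --> \oo] --> RI h.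
  apply: (proj2 (@RI_dct _ (fun n => seg (- Y n) (Y n) h) h (fun t => `|h t|) _ (L1_norm Lh) _ _)).
  - by move=> n; apply: measurable_seg; exact: L1_measurable.
  - by move=> n t; exact: norm_seg.
  - move=> t; apply: cvg_near_cst; exists (Num.bound `|t|) => //= n /= nt.
    have [Yn _ _] := HY n.
    have tY : `|t| < Y n.
      apply: lt_le_trans (archi_boundP (normr_ge0 t)) _; apply: le_trans Yn.
      by rewrite ler_nat.
    by move: tY; rewrite segE ltr_norml => /andP[h1 ->]; rewrite (ltW h1).
suff c0 : RI (seg (- Y n) (Y n) h) @[n --> \oo] --> (0 : R).
  by apply/eqP; apply: (cvg_unique _ c c0); exact: Rhausdorff.
apply/cvgrPdist_le => eta eta0; have e2 : 0 < eta / 2 by rewrite divr_gt0.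
have := @cvg_harmonic R => /cvgrPdist_lt /(_ _ e2); apply: filterS => n.
rewrite sub0r normrN gtr0_norm ?invr_gt0 // => nt.
by rewrite sub0r normrN; apply: le_trans (small n) _; rewrite mulrC -ler_pdivlMr // ltW.
Qed.

End VerticalShift.

(** * Paley-Wiener *)

Section PaleyWiener.
Context {R : realType}.
Notation mu := (@lebesgue_measure R).
Notation nc := (@ComplexField.Normc.normc R).
Implicit Types (x y t : R).
Variable G : R[i] -> R[i].

(** Integrability makes the inversion integral converge, square integrability gives Plancherel. A
    damped Bergman function is known to have both for almost every abscissa, whence a density
    assumption instead of one on all lines. *)
Definition good_line x : Prop :=
  [/\ 0 < x, L1 (fun y => nc (G (x +i* y))) & L1 (fun y => nc (G (x +i* y)) ^+ 2)].

Hypothesis hG : holomorphic_rhp G.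
Hypothesis dense_good : forall a b : R, 0 <= a < b -> exists2 x, a < x < b & good_line x.
Hypothesis bounded_good : exists C : R, forall X : R, exists x : R,
  [/\ X <= x, good_line x & RI (fun y => nc (G (x +i* y))) <= C].
Hypothesis decay_good : forall x1 x2 : R, 0 < x1 <= x2 -> strip_decay G x1 x2.

Let gr x y := complex.Re (G (x +i* y)).
Let gi x y := complex.Im (G (x +i* y)).

Let cgr x : 0 < x -> continuous (gr x).
Proof. by move=> x0; exact: (continuous_rhp_line (holomorphic_continuous hG) (@normRe_dist R) x0). Qed.

Let cgi x : 0 < x -> continuous (gi x).
Proof. by move=> x0; exact: (continuous_rhp_line (holomorphic_continuous hG) (@normIm_dist R) x0). Qed.

Let L1gr x : good_line x -> L1 (gr x).
Proof.
case=> x0 L _; apply: L1_le L; first by apply: continuous_measurable_fun; exact: cgr.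
by move=> y; exact: normRe_le.
Qed.

Let L1gi x : good_line x -> L1 (gi x).
Proof.
case=> x0 L _; apply: L1_le L; first by apply: continuous_measurable_fun; exact: cgi.
by move=> y; exact: normIm_le.
Qed.

Let L1gr2 x : good_line x -> L1 (fun y => gr x y ^+ 2).
Proof.
case=> x0 _ L; apply: L1_le L.
  by apply: measurable_funX; apply: continuous_measurable_fun; exact: cgr.
by move=> y; rewrite ger0_norm ?sqr_ge0 // normc_sqr lerDl sqr_ge0.
Qed.

Let L1gi2 x : good_line x -> L1 (fun y => gi x y ^+ 2).
Proof.
case=> x0 _ L; apply: L1_le L.
  by apply: measurable_funX; apply: continuous_measurable_fun; exact: cgi.
by move=> y; rewrite ger0_norm ?sqr_ge0 // normc_sqr lerDr sqr_ge0.
Qed.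

(** [A] and [B] are the real and imaginary parts of the integral over [y] of
    [G (x + i y) e^{i t y}], that is, of the inversion integral without its factor [e^{t x}]. *)
Let A x t := fcos (gr x) t - fsin (gi x) t.
Let B x t := fcos (gi x) t + fsin (gr x) t.

Let K (t : R) (z : R[i]) : R[i] := G z * cexp (t%:C * z).

Let K_E t x y :
  complex.Re (K t (x +i* y)) = expR (t * x) * (gr x y * cos (y * t) - gi x y * sin (y * t)) /\
  complex.Im (K t (x +i* y)) = expR (t * x) * (gi x y * cos (y * t) + gr x y * sin (y * t)).
Proof.
rewrite /K /cexp !ReImE /= !mul0r subr0 addr0 -/(gr x y) -/(gi x y) (mulrC t y).
by split; ring.
Qed.

Let K_RI t x : good_line x ->
  [/\ L1 (fun y => complex.Re (K t (x +i* y))), L1 (fun y => complex.Im (K t (x +i* y))),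
      RI (fun y => complex.Re (K t (x +i* y))) = expR (t * x) * A x t &
      RI (fun y => complex.Im (K t (x +i* y))) = expR (t * x) * B x t].
Proof.
move=> gx; have mt := @measurable_mulr_cst R t.
have c1 := L1_cos mt (L1gr gx); have c2 := L1_cos mt (L1gi gx).
have s1 := L1_sin mt (L1gr gx); have s2 := L1_sin mt (L1gi gx).
split.
- by apply: eq_L1 (L1Z (expR (t * x)) (L1B c1 s2)) => y; rewrite (K_E t x y).1.
- by apply: eq_L1 (L1Z (expR (t * x)) (L1D c2 s1)) => y; rewrite (K_E t x y).2.
- rewrite (@eq_RI _ _ (fun y => expR (t * x) * (gr x y * cos (y * t) - gi x y * sin (y * t)))).
    by rewrite RIZ ?RIB //; exact: L1B.
  by move=> y; rewrite (K_E t x y).1.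
- rewrite (@eq_RI _ _ (fun y => expR (t * x) * (gi x y * cos (y * t) + gr x y * sin (y * t)))).
    by rewrite RIZ ?RID //; exact: L1D.
  by move=> y; rewrite (K_E t x y).2.
Qed.

Let hK t : holomorphic_rhp (K t).
Proof. exact: (holomorphicM hG (@holomorphic_cexp R t)). Qed.

Let normcK t x y : nc (K t (x +i* y)) = expR (t * x) * nc (G (x +i* y)).
Proof. by rewrite normcM normc_cexp !ReImE /= mul0r subr0 mulrC. Qed.

Let strip_decayK t (x1 x2 : R) : 0 < x1 <= x2 -> strip_decay (K t) x1 x2.
Proof.
move=> /[dup] x12 /andP[x10 _] eta Y0 eta0; pose E := expR (`|t| * x2).
have E0 : 0 < E by exact: expR_gt0.
have [Y [YY h1 h2]] := decay_good x12 Y0 (divr_gt0 eta0 E0).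
have H y : RI (seg x1 x2 (fun x => nc (K t (x +i* y)))) <=
    E * RI (seg x1 x2 (fun x => nc (G (x +i* y)))).
  have LG := seg_normc_L1 x2 y hG x10; have LK := seg_normc_L1 x2 y (@hK t) x10.
  rewrite -(RIZ E LG); apply: (le_RI LK (L1Z E LG)).
  move=> x; rewrite !segE; case: ifP => [/andP[xx1 xx2]|_]; last by rewrite mulr0.
  rewrite normcK ler_wpM2r ?normc_ge0 // ler_expR.
  apply: le_trans (ler_norm _) _; rewrite normrM ler_wpM2l // ger0_norm ?ltW //.
  exact: lt_le_trans x10 xx1.
by exists Y; split => //; apply: le_trans (H _) _; rewrite mulrC -ler_pdivlMr.
Qed.

(** Both sides are integrals of [K t] along vertical lines. [vertical_shift] handles the imaginary
    part, and the real part is the imaginary part of [i] times [K t]. *)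
Let shift t (x1 x2 : R) : good_line x1 -> good_line x2 ->
  expR (t * x1) * A x1 t = expR (t * x2) * A x2 t /\
  expR (t * x1) * B x1 t = expR (t * x2) * B x2 t.
Proof.
wlog x12 : x1 x2 / x1 <= x2.
  move=> W g1 g2; case: (leP x1 x2) => [h|/ltW h]; first exact: W.
  by have [-> ->] := W _ _ h g2 g1.
move=> g1 g2; have [x10 _ _] := g1; have x1_2 : 0 < x1 <= x2 by rewrite x10.
have [r1 i1 <- <-] := K_RI t g1; have [r2 i2 <- <-] := K_RI t g2.
split; last exact: (vertical_shift (@hK t) x1_2 i1 i2 (strip_decayK t x1_2)).
have hi : holomorphic_rhp (fun z => (0 +i* 1) * K t z).
  exact: (holomorphicM (@holomorphic_cst R _) (@hK t)).
have iE x y : complex.Im ((0 +i* 1) * K t (x +i* y)) = complex.Re (K t (x +i* y)).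
  by rewrite !ReImE /= mul0r add0r mul1r.
have niE z : nc ((0 +i* 1) * K t z) = nc (K t z).
  by rewrite normcM [X in X * _](_ : _ = 1) ?mul1r //= expr0n expr1n add0r sqrtr1.
have := vertical_shift hi x1_2.
rewrite !(funext (iE _)) => H; apply: (H r1 r2) => eta Y0 eta0.
have [Y [YY h1 h2]] := strip_decayK t x1_2 Y0 eta0.
have nF y : (fun x => nc ((0 +i* 1) * K t (x +i* y))) = (fun x => nc (K t (x +i* y))).
  by apply/funext => x; rewrite niE.
by exists Y; split; rewrite ?nF.
Qed.

(** The line is moved to the right: [e^{t x}] tends to 0 for [t < 0], while the integrals of the
    modulus of [G] stay below [C] along some abscissas tending to infinity. *)
Let A_neg t x : good_line x -> t < 0 -> A x t = 0 /\ B x t = 0.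
Proof.
move=> gx t0; have [C HC] := bounded_good.
suff H (b : R) : (forall X : R, exists2 x : R, X <= x & `|b| <= expR (t * x) * C) -> b = 0.
  have e0 : expR (t * x) != 0 by rewrite gt_eqF ?expR_gt0.
  have bd (X : R) : exists2 x' : R, X <= x' &
      `|expR (t * x) * A x t| <= expR (t * x') * C /\ `|expR (t * x) * B x t| <= expR (t * x') * C.
    have [x' [Xx gx' Cx']] := HC X; exists x' => //.
    have [-> ->] := shift t gx gx'.
    have [r i <- <-] := K_RI t gx'.
    have [_ Ln _] := gx'.
    have bnd u : L1 u -> (forall y, `|u y| <= nc (K t (x' +i* y))) -> `|RI u| <= expR (t * x') * C.
      move=> Lu hu; apply: (@le_trans _ _ (expR (t * x') * RI (fun y => nc (G (x' +i* y))))).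
        rewrite -RIZ //; apply: norm_RI_le => //; first exact: L1Z.
        by move=> y; rewrite -normcK.
      by rewrite ler_wpM2l ?expR_ge0.
    by split; apply: bnd => // y; [exact: normRe_le|exact: normIm_le].
  split; apply/eqP; [rewrite -(mulrI_eq0 _ (mulfI e0))|rewrite -(mulrI_eq0 _ (mulfI e0))];
    by apply/eqP; apply: H => X; have [x' h [h1 h2]] := bd X; exists x'.
move=> Hb; apply/eqP; rewrite -normr_eq0; apply: contrapT => /negP b0.
have {}b0 : 0 < `|b| by rewrite lt_neqAle eq_sym b0 normr_ge0.
have nt0 : 0 < - t by rewrite oppr_gt0.
have [x' Xx' hb] := Hb (Num.max 1 (`|C| / (- t * `|b|) + 1)).
have x'1 : 1 <= x' by apply: le_trans Xx'; rewrite le_max lexx.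
have x'2 : `|C| / (- t * `|b|) + 1 <= x' by apply: le_trans Xx'; rewrite le_max lexx orbT.
have x'0 : 0 < x' by exact: lt_le_trans x'1.
have u0 : 0 < - t * x' by rewrite mulr_gt0.
have ex : expR (t * x') <= (- t * x')^-1.
  rewrite -[t * x']opprK expRN -mulNr lef_pV2 ?posrE ?expR_gt0 //.
  by apply: le_trans (expR_ge1Dx _); rewrite lerDr.
have : `|b| <= `|C| / (- t * x').
  apply: (le_trans hb); apply: le_trans (ler_wpM2l (expR_ge0 _) (ler_norm C)) _.
  by rewrite mulrC ler_wpM2l.
rewrite ler_pdivlMr // => h1.
have : `|C| < x' * (- t * `|b|).
  by rewrite -ltr_pdivrMr ?mulr_gt0 //; apply: lt_le_trans x'2; rewrite ltrDl.
by rewrite (_ : x' * _ = `|b| * (- t * x')) ?ltNge ?h1 //; ring.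
Qed.

(* Since the inverse transform vanishes at -t, adding it to the value at t turns
   the exponentials into cosines, to which Abel summation applies. *)
Let AB_pos t x : good_line x -> 0 < t ->
  [/\ A x t = 2 * fcos (gr x) t, B x t = 2 * fcos (gi x) t,
      fsin (gr x) t = fcos (gi x) t & fsin (gi x) t = - fcos (gr x) t].
Proof.
move=> gx t0; have nt0 : - t < 0 by rewrite oppr_lt0.
have [] := A_neg gx nt0; rewrite /A /B !fcosN !fsinN; [|exact: L1gr|exact: L1gi].
rewrite opprK => h1 h2.
have e1 : fsin (gr x) t = fcos (gi x) t by apply/esym/eqP; rewrite -subr_eq0 h2.
have e2 : fsin (gi x) t = - fcos (gr x) t by apply/eqP; rewrite -addr_eq0 addrC h1.
by split => //; rewrite ?e1 ?e2; ring.
Qed.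

Let L1_fourier_sqr h : L1 h -> L1 (fun y => h y ^+ 2) ->
  L1 (on_pos (fun t => fcos h t ^+ 2 + fsin h t ^+ 2)).
Proof.
move=> h1 h2; apply/L1_ge0P.
- apply: measurable_on_pos; apply: measurable_funTS.
  by apply: measurable_funD; apply: measurable_funX; apply: continuous_measurable_fun;
    [exact: continuous_fcos|exact: continuous_fsin].
- by move=> t; rewrite on_posE; case: ifP => // _; rewrite addr_ge0 ?sqr_ge0.
- by rewrite plancherel_real // ltry.
Qed.

(** Damping at [x] is compared with a good line at some [x' < x]: it absorbs [expR (2 * (t * x'))],
    and Plancherel on that line gives integrability. [p] and [q] stand for the two coordinates of
    [G], in either order. *)
Let damped_fourier (u : R -> R) (p q : R -> R -> R) (c : R) : measurable_fun setT u ->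
  (forall x, good_line x -> [/\ L1 (p x), L1 (fun y => p x y ^+ 2), L1 (q x) & L1 (fun y => q x y ^+ 2)]) ->
  0 <= c -> (forall x t, good_line x ->
    u t ^+ 2 <= c * expR (2 * (t * x)) * (fcos (p x) t ^+ 2 + fsin (q x) t ^+ 2)) ->
  damped_L2 u.
Proof.
move=> mu_ Hpq c0 Hu; split; first exact: measurable_funTS.
move=> x x0; have ax : (0 : R) <= 0 < x by rewrite lexx.
have [x' /andP[x'0 x'x] gx] := dense_good ax.
have [p1 p2 q1 q2] := Hpq x' gx.
apply: L1_le (L1Z c (L1D (L1_fourier_sqr p1 p2) (L1_fourier_sqr q1 q2))).
  apply: measurable_on_pos; apply: measurable_funM; first exact: measurable_expRM.
  by apply: measurable_funX; exact: measurable_funTS.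
move=> t; rewrite !on_posE; case: ifP => [t0|_]; last by rewrite normr0 addr0 mulr0.
rewrite ger0_norm; last by apply: mulr_ge0; [exact: expR_ge0|exact: sqr_ge0].
apply: le_trans (ler_wpM2l (expR_ge0 _) (Hu x' t gx)) _.
set S := fcos (p x') t ^+ 2 + _.
have S0 : 0 <= S by rewrite addr_ge0 ?sqr_ge0.
apply: (@le_trans _ _ (c * S)).
  rewrite (_ : _ * (_ * _ * S) = (expR (- (2 * x * t)) * expR (2 * (t * x'))) * (c * S)); last by ring.
  rewrite -expRD ler_piMl ?mulr_ge0 // -[leRHS]expR0 ler_expR.
  by have : 0 <= t * (x - x') by [rewrite mulr_ge0 ?subr_ge0 // ltW]; lra.
rewrite ler_wpM2l // /S.
by have := sqr_ge0 (fsin (p x') t); have := sqr_ge0 (fcos (q x') t); lra.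
Qed.

Let fcos_shift h (y0 t : R) : L1 h ->
  RI (fun y => h y * cos ((y - y0) * t)) = cos (t * y0) * fcos h t + sin (t * y0) * fsin h t.
Proof.
move=> h1; have mt := @measurable_mulr_cst R t.
have Lc := L1_cos mt h1; have Ls := L1_sin mt h1.
rewrite /fcos /fsin -!RIZ // -RID; [|exact: L1Z|exact: L1Z].
apply: eq_RI => y; rewrite mulrBl cosB (mulrC y0); ring.
Qed.

Theorem paley_wiener : exists2 f : R -> R[i], laplace_class f &
  forall z, rhp z -> laplace f z = G z.
Proof.
have [x0 _ gx0] : exists2 x : R, 0 < x < 1 & good_line x by apply: dense_good; rewrite lexx /= ltr01.
have [P [P0 PE]] : exists P : R, 0 < P /\ pi = P by exists pi; rewrite pi_gt0.
(* The inversion formula on one reference line; [fE] frees it from that line. *)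
pose f t : R[i] := (expR (t * x0) * A x0 t / (2 * P)) +i* (expR (t * x0) * B x0 t / (2 * P)).
have fE x t : good_line x ->
    f t = (expR (t * x) * A x t / (2 * P)) +i* (expR (t * x) * B x t / (2 * P)).
  by move=> gx; rewrite /f; have [-> ->] := shift t gx0 gx.
have mAB : measurable_fun setT (A x0) /\ measurable_fun setT (B x0).
  have mf (h : R -> R) : L1 h -> measurable_fun setT (fcos h) /\ measurable_fun setT (fsin h).
    by move=> Lh; split; apply: continuous_measurable_fun; [exact: continuous_fcos|exact: continuous_fsin].
  have [c1 s1] := mf _ (L1gr gx0); have [c2 s2] := mf _ (L1gi gx0).
  by split; [exact: (measurable_funB c1 s2)|exact: (measurable_funD c2 s1)].
have mexp : measurable_fun setT (fun t : R => expR (t * x0)).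
  apply: (eq_measurable_fun (fun t => expR (- (- x0 * t)))); last exact: measurable_expRM.
  by move=> t _; rewrite mulNr opprK mulrC.
have P20 : 0 < 2 * P by rewrite mulr_gt0.
pose c := 2 / (2 * P) ^+ 2.
have c0 : 0 <= c by rewrite divr_ge0 // sqr_ge0.
have Hf : laplace_class f.
  have sq2 (a b e : R) : (e * (a - b) / (2 * P)) ^+ 2 <= c * (e * e) * (a ^+ 2 + b ^+ 2).
    rewrite (_ : _ ^+ 2 = (e ^+ 2 / (2 * P) ^+ 2) * (a - b) ^+ 2); last by field; rewrite gt_eqF.
    rewrite (_ : c * _ * _ = (e ^+ 2 / (2 * P) ^+ 2) * (2 * (a ^+ 2 + b ^+ 2))); last first.
      by rewrite /c; field; rewrite gt_eqF.
    rewrite ler_wpM2l ?divr_ge0 ?sqr_ge0 //.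
    by have := sqr_ge0 (a + b); lra.
  have e2 x t : expR (2 * (t * x)) = expR (t * x) * expR (t * x).
    by rewrite -expRD; congr expR; ring.
  have [mA mB] := mAB; split.
  - apply: (@damped_fourier _ gr gi c) => //=.
    + by apply: measurable_funM => //; exact: measurable_funM.
    + by move=> x gx; split; [exact: L1gr|exact: L1gr2|exact: L1gi|exact: L1gi2].
    + by move=> x t gx; have [-> _] := shift t gx0 gx; rewrite e2; exact: sq2.
  - apply: (@damped_fourier _ gi gr c) => //=.
    + by apply: measurable_funM => //; exact: measurable_funM.
    + by move=> x gx; split; [exact: L1gi|exact: L1gi2|exact: L1gr|exact: L1gr2].
    + move=> x t gx; have [_ ->] := shift t gx0 gx; rewrite e2 /B -[fsin (gr x) t]opprK.
      by apply: le_trans (sq2 _ _ _) _; rewrite !opprK sqrrN.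
exists f => //.
have cL := holomorphic_continuous (laplace_holomorphic Hf).
have cG := holomorphic_continuous hG.
pose I (h : R -> R) (e y0 : R) := RI (on_pos (fun t => expR (- (e * t)) *
  RI (fun y => h y * cos ((y - y0) * t)))).
(* Seen from a good line [x], the transform at abscissa [x + e] is an Abel mean with parameter [e];
   letting [e] tend to 0 yields the value of [G] on that line. *)
have lapE x e y0 : good_line x -> 0 < e ->
    complex.Re (laplace f ((x + e) +i* y0)) = P^-1 * I (gr x) e y0 /\
    complex.Im (laplace f ((x + e) +i* y0)) = P^-1 * I (gi x) e y0.
  move=> gx e0; have [x0' _ _] := gx.
  have xe : rhp ((x + e) +i* y0) by rewrite /rhp /= addr_gt0.
  have [L1 L2] := L1c_laplace Hf xe.
  have E t : on_pos (fun t => complex.Re (cexp (- (t%:C * ((x + e) +i* y0))) * f t)) t =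
      P^-1 * on_pos (fun t => expR (- (e * t)) * RI (fun y => gr x y * cos ((y - y0) * t))) t /\
    on_pos (fun t => complex.Im (cexp (- (t%:C * ((x + e) +i* y0))) * f t)) t =
      P^-1 * on_pos (fun t => expR (- (e * t)) * RI (fun y => gi x y * cos ((y - y0) * t))) t.
    rewrite !on_posE; case: ifP => [t0|_]; last by rewrite mulr0.
    rewrite (fE x t gx) cexpE !ReImE /= !fcos_shift; [|exact: L1gi|exact: L1gr].
    have [-> -> -> ->] := AB_pos gx t0.
    have -> : expR (- ((x + e) * t)) = expR (- (e * t)) * (expR (t * x))^-1.
      by rewrite -expRN -expRD; congr expR; ring.
    have n0 : expR (t * x) != 0 by rewrite gt_eqF ?expR_gt0.
    by split; field; rewrite n0 gt_eqF.
  rewrite laplaceE /CI /=; split.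
    rewrite (eq_RI (fun t => (E t).1)) RIZ //.
    apply: eq_L1 (L1Z P L1) => t; rewrite (E t).1 mulrA mulfV ?mul1r // gt_eqF //.
  rewrite (eq_RI (fun t => (E t).2)) RIZ //.
  apply: eq_L1 (L1Z P L2) => t; rewrite (E t).2 mulrA mulfV ?mul1r // gt_eqF //.
have lim_eq (a b : R) : (forall eta : R, 0 < eta -> `|a - b| <= eta) -> a = b.
  move=> H; apply/eqP; rewrite -subr_eq0 -normr_le0; apply/ler_addgt0Pl => eta eta0.
  by rewrite addr0; exact: H.
have good_eq x y0 : good_line x -> laplace f (x +i* y0) = G (x +i* y0).
  move=> gx; have [x'0 _ _] := gx.
  have H (p : R[i] -> R) (k : R -> R) : (forall z w, `|p z - p w| <= nc (z - w)) ->
      L1 k -> continuous k -> (forall e, 0 < e -> p (laplace f ((x + e) +i* y0)) = P^-1 * I k e y0) ->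
      p (laplace f (x +i* y0)) = k y0.
    move=> pl Lk ck pE; apply: lim_eq => eta eta0.
    have e2 : 0 < eta / 2 by rewrite divr_gt0.
    have [d1 d10 H1] := cL (x +i* y0) x'0 _ e2.
    have [d2 d20 H2] := abel_limit Lk (ck y0) (mulr_gt0 P0 e2).
    pose e := Num.min d1 d2 / 2.
    have e0 : 0 < e by rewrite divr_gt0 // lt_min d10.
    have ed : e < d1 /\ e < d2.
      have [m1 m2] : Num.min d1 d2 <= d1 /\ Num.min d1 d2 <= d2.
        by rewrite !ge_min !lexx orbT.
      by rewrite /e; split; lra.
    have {}H1 := H1 (e +i* 0).
    have ne : nc (e +i* 0) = e.
      by rewrite /ComplexField.Normc.normc /= expr0n addr0 sqrtr_sqr gtr0_norm.
    rewrite ne in H1; have {}H1 := H1 ed.1.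
    rewrite (_ : (x +i* y0) + (e +i* 0) = (x + e) +i* y0) in H1; last first.
      by apply: complex_ext; rewrite !ReImE /= ?addr0.
    have {}H1 := le_trans (pl _ _) H1.
    have {}H2 := H2 e; rewrite e0 ed.2 PE -/(I k e y0) in H2.
    have {}H2 := H2 isT.
    rewrite pE // in H1.
    have H3 : `|P^-1 * I k e y0 - k y0| <= eta / 2.
      rewrite -(ler_pM2l P0) -[X in X * _](gtr0_norm P0) -normrM mulrBr mulrA mulfV ?gt_eqF //.
      by rewrite mul1r.
    rewrite (_ : _ - k y0 = (P^-1 * I k e y0 - k y0) - (P^-1 * I k e y0 - p (laplace f (x +i* y0)))); last by ring.
    by apply: le_trans (ler_normB _ _) _; lra.
  apply: complex_ext.
    apply: (H _ (gr x) (@normRe_dist R)); [exact: L1gr|exact: cgr|].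
    by move=> e e0; have [] := lapE x e y0 gx e0.
  apply: (H _ (gi x) (@normIm_dist R)); [exact: L1gi|exact: cgi|].
  by move=> e e0; have [] := lapE x e y0 gx e0.
(* Good lines accumulate from the right at every abscissa, and both sides are continuous. *)
move=> z zr; apply/eqP; rewrite -subr_eq0; apply/eqP; apply: normc_eq0.
apply: lim_eq => eta eta0; rewrite subr0 ger0_norm ?normc_ge0 //.
have e2 : 0 < eta / 2 by rewrite divr_gt0.
have [d1 d10 H1] := cL z zr _ e2; have [d2 d20 H2] := cG z zr _ e2.
have zr' : 0 < complex.Re z by [].
have az : 0 <= complex.Re z < complex.Re z + Num.min d1 d2.
  by rewrite (ltW zr') ltrDl lt_min d10.
have [x /andP[x1 x2] gx] := dense_good az.
pose w : R[i] := (x - complex.Re z) +i* 0.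
have nw : nc w = x - complex.Re z.
  by rewrite /ComplexField.Normc.normc /= expr0n addr0 sqrtr_sqr gtr0_norm // subr_gt0.
have : nc w < Num.min d1 d2 by rewrite nw ltrBlDl.
rewrite lt_min => /andP[/H1 h1 /H2 h2].
have zw : z + w = x +i* complex.Im z.
  by apply: complex_ext; rewrite !ReImE /= ?addr0 // addrC subrK.
rewrite zw good_eq // in h1; rewrite zw in h2.
rewrite (_ : laplace f z - G z = (G (x +i* complex.Im z) - G z) + - (G (x +i* complex.Im z) - laplace f z)).
  by apply: le_trans (normcD _ _) _; rewrite normc_opp; lra.
by rewrite opprB [RHS]addrC subrKA.
Qed.

End PaleyWiener.

(** * The Paley-Wiener hypotheses for a damped Bergman function *)

Section BergmanLaplace.
Context {R : realType}.
Notation mu := (@lebesgue_measure R).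
Notation nc := (@ComplexField.Normc.normc R).
Implicit Types (x y : R).

(** Otherwise [g] would be at least [e] on a half-line, which has infinite measure. *)
Lemma exists_small (g : R -> R) : measurable_fun setT g -> (forall y, 0 <= g y) ->
  (\int[mu]_y (g y)%:E < +oo)%E ->
  forall e Y0 : R, 0 < e -> exists2 Y, Y0 <= Y & g Y <= e.
Proof.
move=> mg g0 gfin e Y0 e0; apply: contrapT => H.
have big y : Y0 <= y -> e <= g y.
  by move=> yY; rewrite leNgt; apply/negP => /ltW gy; apply: H; exists y.
have C : (\int[mu]_(y in `[Y0, +oo[) (cst e%:E y) = e%:E * mu `[Y0, +oo[%classic)%E.
  by apply: integral_cst; exact: measurable_itv.
have : (e%:E * mu `[Y0, +oo[%classic <= \int[mu]_y (g y)%:E)%E.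
  rewrite -C.
  apply: (@le_trans _ _ (\int[mu]_(y in `[Y0, +oo[) (g y)%:E)%E).
    apply: ge0_le_integral => //; first by move=> y _; rewrite lee_fin ltW.
    - by apply/measurable_EFinP; exact: measurable_funTS.
    - by move=> y /=; rewrite in_itv /= andbT lee_fin => /big.
  apply: ge0_subset_integral => //; first by apply/measurable_EFinP.
  by move=> y _; rewrite lee_fin.
rewrite (lebesgue_measure_itv `[Y0, +oo[%R) /= ltry /= addye // gt0_muley ?lte_fin // => h.
by move: (le_lt_trans h gfin); rewrite ltxx.
Qed.

Lemma ae_dense (P : R -> Prop) (a b : R) : {ae mu, forall x, P x} -> a < b ->
  exists2 x, a < x < b & P x.
Proof.
move=> [N [mN N0 sub]] ab; apply: contrapT => H.
have : (mu `]a, b[%classic <= mu N)%E.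
  apply: le_measure; rewrite ?inE //.
  move=> x /=; rewrite in_itv /= => xab; apply: sub => Px; apply: H; by exists x.
by rewrite N0 lebesgue_measure_itv /= lte_fin ab -EFinD lee_fin leNgt subr_gt0 ab.
Qed.

(** The marginals of the Bergman integral may take the value [+oo]; capping at 1 makes them real,
    and at values up to [1 / 2] the cap is invisible. *)
Lemma trunc_fin (g : R -> \bar R) : measurable_fun setT g -> (forall y, 0 <= g y)%E ->
  (\int[mu]_y g y < +oo)%E -> let f := fun y => fine (mine (g y) 1%:E) in
  [/\ measurable_fun setT f, forall y, 0 <= f y, (\int[mu]_y (f y)%:E < +oo)%E &
     forall y, f y <= 2^-1 -> (g y <= 2^-1%:E)%E].
Proof.
move=> mg g0 gf f.
have m0 y : (0 <= mine (g y) 1%:E)%E by rewrite le_min g0 lee01.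
have fE y : (f y)%:E = mine (g y) 1%:E.
  by rewrite /f fineK // ge0_fin_numE // gt_min ltry orbT.
split.
- apply: (measurableT_comp (@fine_measurable R setT measurableT)); exact: measurable_mine.
- by move=> y; rewrite -lee_fin fE.
- apply: le_lt_trans gf; apply: ge0_le_integral => //.
  + by move=> y _; rewrite fE.
  + by rewrite (funext fE); exact: measurable_mine.
  + by move=> y _; rewrite fE ge_min lexx.
- move=> y; rewrite -lee_fin fE ge_min => /orP[//|]; rewrite lee_fin => h.
  by exfalso; move: h; lra.
Qed.

Variables (alpha a : R) (F : R[i] -> R[i]).
Hypotheses (alpha0 : 0 <= alpha) (a0 : 0 < a).
Hypothesis hF : holomorphic_rhp F.
Hypothesis finF : (bergman_norm alpha F < +oo)%E.

(** Each property of this factor has its use: modulus at most 1 preserves square integrability, a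
    bound by the Poisson kernel makes [F * b] integrable on lines, decay of order [a / |y|] at
    height [y] kills the horizontal sides, and convergence to 1 as [a] grows removes the factor in
    the end. *)
Let b z : R[i] := a%:C * (a%:C + z)^-1.

Let b_neq0 z : rhp z -> a%:C + z != 0.
Proof.
move=> zr; apply/negP => /eqP /(congr1 (@complex.Re R)); rewrite !ReImE /=.
by apply/eqP; rewrite gt_eqF // addr_gt0.
Qed.

Let normc_b z : rhp z -> nc (b z) * nc (a%:C + z) = a.
Proof.
move=> zr; rewrite -normcM /b -mulrA mulVf ?b_neq0 // mulr1.
by rewrite /ComplexField.Normc.normc /= expr0n addr0 sqrtr_sqr gtr0_norm.
Qed.

Let normc_az z : rhp z -> a ^+ 2 + complex.Im z ^+ 2 <= nc (a%:C + z) ^+ 2.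
Proof.
move=> zr; rewrite normc_sqr !ReImE /= add0r lerD2r lerXn2r ?nnegrE //; first exact: ltW.
  by rewrite addr_ge0 // ltW.
by rewrite lerDl ltW.
Qed.

Let normc_b2 z : rhp z -> nc (b z) ^+ 2 <= a * poisson a (complex.Im z).
Proof.
move=> zr; have h := normc_az zr; have p := @poisson_den R a (complex.Im z) a0.
rewrite /poisson mulrA ler_pdivlMr // -expr2 -[X in _ <= X ^+ 2](normc_b zr) exprMn.
by rewrite ler_wpM2l ?sqr_ge0.
Qed.

Lemma normc_cayley_le1 z : rhp z -> nc (b z) <= 1.
Proof.
move=> zr; have h := normc_b zr.
have : a <= nc (a%:C + z).
  apply: le_trans (normRe_le _); rewrite !ReImE /=; apply: le_trans (ler_norm _).
  by rewrite lerDl ltW.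
move=> az; rewrite -(ler_pM2r a0) mul1r -[leRHS]h.
by rewrite ler_wpM2l ?normc_ge0.
Qed.

Lemma normc_cayley_sub1 z : rhp z -> nc (b z - 1) * a <= nc z.
Proof.
move=> zr; have az : a <= nc (a%:C + z).
  apply: le_trans (normRe_le _); rewrite !ReImE /=; apply: le_trans (ler_norm _).
  by rewrite lerDl ltW.
apply: le_trans (ler_wpM2l (normc_ge0 _) az) _; rewrite -normcM /b mulrBl mul1r.
by rewrite -mulrA mulVf ?b_neq0 // mulr1 opprD addNKr normc_opp.
Qed.

Let normc_bY z : rhp z -> nc (b z) * `|complex.Im z| <= a.
Proof.
move=> zr; rewrite -[leRHS](normc_b zr) ler_wpM2l ?normc_ge0 //.
by apply: le_trans (normIm_le _); rewrite !ReImE /= add0r.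
Qed.

Let G z := F z * b z.

Let hG : holomorphic_rhp G.
Proof.
apply: (holomorphicM hF); apply: (holomorphicM (@holomorphic_cst R _)) => z zr.
apply: derivableV; first exact: b_neq0.
by apply: derivableD; [exact: derivable_cst|exact: derivable_id].
Qed.

Let cF := holomorphic_continuous hF.

Let k (p : R * R) : \bar R := (p.1 `^ alpha * rhp_sqr F p)%:E.

Let mk : measurable_fun setT k.
Proof.
apply/measurable_EFinP; apply: measurable_funM; last exact: measurable_rhp_sqr.
by apply: (@measurable_of_fst _ (fun x => x `^ alpha)); exact: measurable_powR.
Qed.

Let k0 p : (0 <= k p)%E.
Proof. by rewrite lee_fin mulr_ge0 ?powR_ge0 ?rhp_sqr_ge0. Qed.

(** Marginals of the Bergman integral: [kx] selects good vertical lines, [ky] good heights for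
    horizontal sides. *)
Let kx x : \bar R := \int[mu]_y k (x, y).
Let ky y : \bar R := \int[mu]_x k (x, y).

Let mkx : measurable_fun setT kx.
Proof. exact: (@measurable_fun_fubini_tonelli_F _ _ _ _ R mu k mk k0). Qed.

Let mky : measurable_fun setT ky.
Proof. exact: (@measurable_fun_fubini_tonelli_G _ _ _ _ R mu k mk k0). Qed.

Let kx0 x : (0 <= kx x)%E. Proof. by apply: integral_ge0. Qed.
Let ky0 y : (0 <= ky y)%E. Proof. by apply: integral_ge0. Qed.

Let kfin : (\int[mu \x mu]_p k p < +oo)%E.
Proof.
move: finF; rewrite bergman_normE ltNge leye_eq => H.
rewrite ltNge leye_eq; apply/negP => /eqP E; move: H; rewrite -/k.
have -> : (\int[mu \x mu]_p (p.1 `^ alpha * rhp_sqr F p)%:E = \int[mu \x mu]_p k p)%E by [].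
by rewrite E gt0_muley ?lte_fin ?invr_gt0 ?pi_gt0 // eqxx.
Qed.

Let kxfin : (\int[mu]_x kx x < +oo)%E.
Proof. by have H := kfin; rewrite fubini_tonelli1 in H; [exact: H|exact: mk|exact: k0]. Qed.

Let kyfin : (\int[mu]_y ky y < +oo)%E.
Proof. by have H := kfin; rewrite fubini_tonelli2 in H; [exact: H|exact: mk|exact: k0]. Qed.

Let LF2 x : 0 < x -> (kx x < +oo)%E -> L1 (fun y => nc (F (x +i* y)) ^+ 2) /\
  (RI (fun y => nc (F (x +i* y)) ^+ 2))%:E = ((x `^ alpha)^-1%:E * kx x)%E.
Proof.
move=> x0 kf; have xa : 0 < x `^ alpha by exact: powR_gt0.
have mF : measurable_fun setT (fun y => nc (F (x +i* y)) ^+ 2).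
  apply: measurable_funX; apply: continuous_measurable_fun.
  exact: (continuous_rhp_line cF normc_dist x0).
have E : (\int[mu]_y (nc (F (x +i* y)) ^+ 2)%:E = (x `^ alpha)^-1%:E * kx x)%E.
  rewrite /kx /k -ge0_integralZl //=; first last.
  - by rewrite lee_fin invr_ge0 ltW.
  - by move=> y _; rewrite lee_fin mulr_ge0 ?powR_ge0 ?rhp_sqr_ge0.
  - apply/measurable_EFinP; apply: measurable_funM => //.
    exact: (measurableT_comp (measurable_rhp_sqr cF) (pair1_measurable x)).
  apply: eq_integral => y _; rewrite -EFinM mulrA mulVf ?gt_eqF // mul1r.
  by rewrite /rhp_sqr /= x0.
have L : L1 (fun y => nc (F (x +i* y)) ^+ 2).
  apply/L1_ge0P => //; first by move=> y; exact: sqr_ge0.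
  rewrite E; move: kf (kx0 x); case: (kx x) => [r| |] //= _ _.
  by rewrite -EFinM ltry.
by split => //; rewrite -RIE.
Qed.

(** The product [|F| |b|] is at most half of [|F|^2 + |b|^2], and [|b|^2] lies below [a] times a
    Poisson kernel, with integral [a * pi] whatever the abscissa. *)
Let LG x : 0 < x -> (kx x < +oo)%E -> good_line G x /\
  RI (fun y => nc (G (x +i* y))) <= (RI (fun y => nc (F (x +i* y)) ^+ 2) + a * pi) / 2.
Proof.
move=> x0 kf; have [LF EF] := LF2 x0 kf.
have [Lp Rp] := RI_poisson a0.
have mG : measurable_fun setT (fun y => nc (G (x +i* y))).
  apply: continuous_measurable_fun.
  exact: (continuous_rhp_line (holomorphic_continuous hG) normc_dist x0).
have xr y : rhp (x +i* y) by [].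
have Lb := L1Z 2^-1 (L1D LF (L1Z a Lp)).
have bound y : nc (G (x +i* y)) <= 2^-1 * (nc (F (x +i* y)) ^+ 2 + a * poisson a y).
  have amgm (u v t : R) : v ^+ 2 <= t -> u * v <= 2^-1 * (u ^+ 2 + t).
    by move=> h; have := sqr_ge0 (u - v); lra.
  by rewrite /G normcM; apply: amgm; exact: (normc_b2 (xr y)).
have LG1 : L1 (fun y => nc (G (x +i* y))).
  apply: L1_le Lb => // y; rewrite ger0_norm ?normc_ge0 //; exact: bound.
split.
  split => //; apply: L1_le LF; first exact: measurable_funX.
  move=> y; rewrite ger0_norm ?sqr_ge0 // /G normcM exprMn ler_piMr ?sqr_ge0 //.
  by rewrite expr_le1 ?normc_ge0 // normc_cayley_le1.
apply: le_trans (le_RI LG1 Lb bound) _.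
by rewrite (RIZ _ (L1D LF (L1Z a Lp))) (RID LF (L1Z a Lp)) (RIZ _ Lp) Rp mulrC.
Qed.

Let dense_good (s t : R) : 0 <= s < t -> exists2 x, s < x < t & good_line G x.
Proof.
move=> /andP[s0 st].
have H : {ae mu, forall x, (kx x < +oo)%E}.
  have : mu.-integrable setT kx.
    apply/integrableP; split => //.
    have -> : (\int[mu]_x `|kx x| = \int[mu]_x kx x)%E; last exact: kxfin.
    by apply: eq_integral => x _; rewrite gee0_abs.
  move=> /(integrable_ae measurableT); apply: ae_mono => x /(_ I) h.
  by rewrite ltNge leye_eq; apply/negP => /eqP E; move: h; rewrite E.
have [x xst kf] := ae_dense H st; exists x => //.
have x0 : 0 < x by case/andP: xst => sx _; exact: le_lt_trans sx.
by have [] := LG x0 kf.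
Qed.

(** [kx] is integrable, so it is at most [1 / 2] at arbitrarily large abscissas; for [x >= 1] the
    weight [x ^ alpha] is at least 1, which passes the bound on to the integral of [|F|^2]. *)
Let bounded_good : exists C : R, forall X : R, exists x : R,
  [/\ X <= x, good_line G x & RI (fun y => nc (G (x +i* y))) <= C].
Proof.
exists ((1 + a * pi) / 2) => X.
have [mf f0 ff fH] := trunc_fin mkx kx0 kxfin.
have h2 : (0 : R) < 2^-1 by [].
have [x xX /fH kh] := exists_small mf f0 ff (Num.max X 1) h2.
have Xx : X <= x by apply: le_trans xX; rewrite le_max lexx.
have x1 : 1 <= x by apply: le_trans xX; rewrite le_max lexx orbT.
have x0 : 0 < x by exact: lt_le_trans x1.
have kf : (kx x < +oo)%E by apply: le_lt_trans kh _; rewrite ltry.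
have [gx bx] := LG x0 kf; exists x; split => //; apply: le_trans bx _.
rewrite ler_pM2r // lerD2r -lee_fin (LF2 x0 kf).2.
have xa : 1 <= x `^ alpha.
  have -> : (1 : R) = 1 `^ alpha by rewrite powR1.
  by rewrite ge0_ler_powR // nnegrE // ltW.
apply: (@le_trans _ _ (1%:E * kx x)%E).
  by apply: lee_wpmul2r => //; rewrite lee_fin invf_le1 // (lt_le_trans ltr01 xa).
by rewrite mul1e; apply: le_trans kh _; rewrite lee_fin; lra.
Qed.

(** On a horizontal side at height [Y], [|b|] is at most [a / Y] and [|F|] at most [1 + |F|^2],
    whose integral across the strip is controlled by [ky], the weight being at least [x1 ^ alpha]
    there. *)
Let decay_good (x1 x2 : R) : 0 < x1 <= x2 -> strip_decay G x1 x2.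
Proof.
move=> /andP[x10 x12] eta Y0 eta0.
have [f [mf f0 ff fH]] : exists f : R -> R, [/\ measurable_fun setT f, forall y, 0 <= f y,
    (\int[mu]_y (f y)%:E < +oo)%E & forall y, f y <= 2^-1 -> (ky y <= 2^-1%:E)%E].
  by eexists; exact: (trunc_fin mky ky0 kyfin).
have mfN : measurable_fun setT (fun y : R => f (- y)) by exact: (measurableT_comp mf).
(* Symmetrized, so that a single small value controls the heights [Y] and [- Y] together. *)
pose g := on_pos (fun y => f y + f (- y)).
have mg : measurable_fun setT g.
  by apply: measurable_on_pos; apply: measurable_funTS; exact: measurable_funD.
have g0 y : 0 <= g y by rewrite /g on_posE; case: ifP => // _; apply: addr_ge0; exact: f0.
have gf : (\int[mu]_y (g y)%:E < +oo)%E by rewrite -ge0_integral_symmetrize.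
pose c := (x1 `^ alpha)^-1.
have xa : 0 < x1 `^ alpha by exact: powR_gt0.
have c0 : 0 < c by rewrite invr_gt0.
(* The denominator bounds the integral of [1 + |F|^2] along the side. *)
pose delta := eta / ((x2 - x1) + c).
have den0 : 0 < (x2 - x1) + c by rewrite ltr_wpDl // subr_ge0.
have d0 : 0 < delta by rewrite divr_gt0.
have h2 : (0 : R) < 2^-1 by [].
have [Y YY gY] := exists_small mg g0 gf (Num.max Y0 (a / delta)) h2.
have Y1 : Y0 <= Y by apply: le_trans YY; rewrite le_max lexx.
have Y2 : a / delta <= Y by apply: le_trans YY; rewrite le_max lexx orbT.
have Ypos : 0 < Y by apply: lt_le_trans Y2; rewrite divr_gt0.
have [fY fNY] : f Y <= 2^-1 /\ f (- Y) <= 2^-1.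
  by move: gY; rewrite /g on_posE Ypos; have := f0 Y; have := f0 (- Y); lra.
suff H y : (ky y <= 2^-1%:E)%E -> `|y| = Y ->
    RI (seg x1 x2 (fun x => nc (G (x +i* y)))) <= eta.
  exists Y; split => //; apply: H; rewrite ?normrN ?gtr0_norm //; exact: fH.
move=> kyy yY.
have L2 : L1 (seg x1 x2 (fun x => nc (F (x +i* y)) ^+ 2)).
  apply: L1_seg => t /andP[t1 _]; have t0 := lt_le_trans x10 t1.
  rewrite (_ : (fun x => nc (F (x +i* y)) ^+ 2) = (fun x => nc (F (x +i* y)) * nc (F (x +i* y)))) //.
  by apply: cvgM; exact: (continuous_rhp_row cF normc_dist t0).
have LR := L1Z delta (L1D (L1_seg_cst x1 x2 1) L2).
have b1 : RI (seg x1 x2 (fun x => nc (G (x +i* y)))) <=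
    delta * ((x2 - x1) + RI (seg x1 x2 (fun x => nc (F (x +i* y)) ^+ 2))).
  apply: le_trans (le_RI (seg_normc_L1 x2 y hG x10) LR _) _.
    move=> x; rewrite !segE; case: ifP => [/andP[xx1 xx2]|_]; last by rewrite addr0 mulr0.
    have xr : rhp (x +i* y) by rewrite /rhp /=; exact: lt_le_trans xx1.
    rewrite /G normcM mulrC /=.
    have bd : nc (b (x +i* y)) <= delta.
      have := normc_bY xr; rewrite /= yY => h.
      have : a <= delta * Y by rewrite mulrC -ler_pdivrMr.
      by move=> h3; rewrite -(ler_pM2r Ypos); apply: le_trans h _.
    apply: ler_pM; rewrite ?normc_ge0 //.
    by have := sqr_ge0 (nc (F (x +i* y)) - 1); have := normc_ge0 (F (x +i* y)); lra.
  rewrite RIZ ?RID ?RI_seg_cst ?mul1r //; first exact: L1_seg_cst.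
  by apply: L1D => //; exact: L1_seg_cst.
have b2 : RI (seg x1 x2 (fun x => nc (F (x +i* y)) ^+ 2)) <= c.
  rewrite -lee_fin -RIE //; apply: (@le_trans _ _ (c%:E * ky y)%E); last first.
    rewrite -[leRHS]mule1; apply: lee_wpmul2l; first by rewrite lee_fin ltW.
    by apply: le_trans kyy _; rewrite lee_fin; lra.
  have m2 : measurable_fun setT (fun x => k (x, y)).
    exact: (measurableT_comp mk (pair2_measurable y)).
  rewrite -ge0_integralZl //=; last by rewrite lee_fin ltW.
  apply: ge0_le_integral => //.
  - by move=> x _; rewrite lee_fin segE; case: ifP => // _; exact: sqr_ge0.
  - by apply: measurable_EFin; exact: L1_measurable.
  - by apply: measurable_funeM.
  - move=> x _; rewrite -EFinM lee_fin segE /=; case: ifP => [/andP[xx1 xx2]|_]; last first.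
      by rewrite mulr_ge0 ?(ltW c0) // mulr_ge0 ?powR_ge0 ?rhp_sqr_ge0.
    have x0 : 0 < x by exact: lt_le_trans xx1.
    rewrite /rhp_sqr /= x0 mulrA ler_peMl ?sqr_ge0 // /c mulrC ler_pdivlMr // mul1r.
    by rewrite ge0_ler_powR // nnegrE ltW.
apply: le_trans b1 _.
rewrite /delta mulrAC ler_pdivrMr // ler_pM2l // lerD2l //.
Qed.

Lemma bergman_laplace : exists2 f : R -> R[i], laplace_class f &
  forall z, rhp z -> laplace f z = F z * (a%:C * (a%:C + z)^-1).
Proof. exact: (paley_wiener hG dense_good bounded_good decay_good). Qed.

End BergmanLaplace.

(** * Layer-cake decomposition of a weight *)

Section LayerCake.
Context {R : realType}.
Notation mu := (@lebesgue_measure R).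
Notation nc := (@ComplexField.Normc.normc R).
Implicit Types (f g : R -> R[i]) (v rho : R -> R) (D : R -> bool).

Definition cmeasurable f : Prop :=
  measurable_fun (`]0, +oo[%classic : set R) (fun t => complex.Re (f t)) /\
  measurable_fun (`]0, +oo[%classic : set R) (fun t => complex.Im (f t)).

Definition cut_off D f : R -> R[i] := fun t => if D t then f t else 0.

Lemma cmeasurable_cut_off D f : measurable_fun (`]0, +oo[%classic : set R) D ->
  cmeasurable f -> cmeasurable (cut_off D f).
Proof.
have mI : measurable (`]0, +oo[%classic : set R) by exact: measurable_itv.
move=> mD [m1 m2]; split.
- apply: (eq_measurable_fun (fun t => if D t then complex.Re (f t) else 0)).
    by move=> t _; rewrite /cut_off; case: ifP.
  by apply: measurable_fun_if => //; apply: measurable_funS m1 => // t [].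
- apply: (eq_measurable_fun (fun t => if D t then complex.Im (f t) else 0)).
    by move=> t _; rewrite /cut_off; case: ifP.
  by apply: measurable_fun_if => //; apply: measurable_funS m2 => // t [].
Qed.

Lemma le_weighted_sqr v f g : measurable_fun (`]0, +oo[%classic : set R) v ->
  (forall t, 0 < t -> 0 <= v t) -> cmeasurable f -> cmeasurable g ->
  {ae mu, forall t, 0 < t -> nc (f t) <= nc (g t)} ->
  (weighted_sqr v f <= weighted_sqr v g)%E.
Proof.
move=> mv v0 [f1 f2] [g1 g2] fg.
have p0 u t : (0 <= (on_pos (fun t => nc (u t) ^+ 2 * v t) t)%:E)%E.
  rewrite lee_fin on_posE; case: ifP => // t0.
  by apply: mulr_ge0; [exact: sqr_ge0|exact: v0].
apply: ae_ge0_le_integral => //.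
- by apply: measurable_EFin; exact: measurable_weighted.
- by apply: measurable_EFin; exact: measurable_weighted.
- apply: ae_mono fg => t H _; rewrite lee_fin !on_posE; case: ifP => // t0.
  by rewrite ler_wpM2r ?v0 // lerXn2r ?nnegrE ?normc_ge0 // H.
Qed.

Lemma eq_weighted_sqr v v' f g : (forall t, 0 < t -> v t = v' t /\ f t = g t) ->
  weighted_sqr v f = weighted_sqr v' g.
Proof.
move=> H; apply: eq_integral => t _; congr EFin; apply: eq_on_pos => t0.
by have [-> ->] := H t t0.
Qed.

(** Since [rho t] is the length of []0, rho t[], Tonelli writes the weight [v t * rho t] as an
    integral over levels [s] of [v] restricted to superlevel sets of [rho]. The test [0 < s] removes
    the negative levels from an integral over the whole line. *)
Lemma layer_cake v rho f : measurable_fun (`]0, +oo[%classic : set R) v ->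
  (forall t, 0 < t -> 0 <= v t) -> measurable_fun (`]0, +oo[%classic : set R) rho ->
  (forall t, 0 < t -> 0 <= rho t) -> cmeasurable f ->
  let g s := weighted_sqr v (cut_off (fun t => (0 < s) && (s < rho t)) f) in
  measurable_fun setT g /\ weighted_sqr (fun t => v t * rho t) f = (\int[mu]_s g s)%E.
Proof.
move=> mv v0 mr r0 [f1 f2] G.
pose g := on_pos (fun t => nc (f t) ^+ 2 * v t).
have mg : measurable_fun setT g by exact: measurable_weighted.
have g0 t : 0 <= g t.
  by rewrite /g on_posE; case: ifP => // t0; apply: mulr_ge0; [exact: sqr_ge0|exact: v0].
pose r := on_pos rho; have mr' : measurable_fun setT r by exact: measurable_on_pos.
have rp t : 0 <= r t by rewrite /r on_posE; case: ifP => // t0; exact: r0.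
pose b (p : R * R) : bool := (0 < p.2) && (p.2 < r p.1).
have mb : measurable_fun setT b.
  apply: measurable_and; apply: measurable_fun_ltr => //.
  exact: (measurable_of_fst mr').
pose k (p : R * R) : \bar R := (g p.1 * (if b p then 1 else 0))%:E.
have mk : measurable_fun setT k.
  apply/measurable_EFinP; apply: measurable_funM; first exact: (measurable_of_fst mg).
  exact: measurable_fun_ifT.
have k0 p : (0 <= k p)%E by rewrite lee_fin mulr_ge0 //; case: ifP.
have kE s : (\int[mu]_t k (t, s) = G s)%E.
  apply: eq_integral => t _.
  rewrite /k /b /g /r /cut_off /= !on_posE; case: ifP => _; last by rewrite mul0r.
  by case: ifP => _; rewrite ?mulr1 // mulr0 normc0 expr0n mul0r.
split.
  rewrite -(funext kE).
  exact: (@measurable_fun_fubini_tonelli_G _ _ _ _ R mu k mk k0).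
have <- : (\int[mu]_t \int[mu]_s k (t, s) = weighted_sqr (fun t => (v t * rho t)%R) f)%E.
  apply: eq_integral => t _.
  transitivity ((g t)%:E * \int[mu]_s (\1_(`]0, r t[%classic) s)%:E)%E.
    rewrite -ge0_integralZl //=; first last.
    - by rewrite lee_fin.
    - by apply/measurable_EFinP; apply: measurable_indic; exact: measurable_itv.
    apply: eq_integral => s _; rewrite /k /b /= -EFinM indicE mem_setE in_itv /=.
    by case: ifP.
  have -> : (\int[mu]_s (\1_(`]0, r t[%classic) s)%:E = (r t)%:E)%E.
    have M : mu (`]0, r t[%classic : set R) = (r t)%:E.
      rewrite lebesgue_measure_itv /= lte_fin.
      by have := rp t; rewrite le_eqVlt => /orP[/eqP <-|->]; rewrite ?ltxx ?sube0.
    by rewrite integral_indic // setIT; exact: M.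
  rewrite -EFinM /g /r; congr EFin; rewrite !on_posE; case: ifP => _; last by rewrite mul0r.
  by rewrite mulrA.
rewrite (fubini_tonelli (m1 := mu) (m2 := mu) k); first last.
- exact: k0.
- exact: mk.
by apply: eq_integral => s _; exact: kE.
Qed.

Lemma weighted_sqrZ v (c : R) f : 0 <= c -> measurable_fun (`]0, +oo[%classic : set R) v ->
  (forall t, 0 < t -> 0 <= v t) -> cmeasurable f ->
  weighted_sqr v (fun t => c%:C * f t) = ((c ^+ 2)%:E * weighted_sqr v f)%E.
Proof.
move=> c0 mv v0 [f1 f2]; rewrite /weighted_sqr -ge0_integralZl //=; first last.
- by rewrite lee_fin sqr_ge0.
- move=> t _; rewrite lee_fin on_posE; case: ifP => // t0.
  by apply: mulr_ge0; [exact: sqr_ge0|exact: v0].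
- by apply: measurable_EFin; exact: measurable_weighted.
apply: eq_integral => t _; rewrite -EFinM; congr EFin; rewrite !on_posE.
case: ifP => _; last by rewrite mulr0.
have nC : nc c%:C = c.
  by rewrite /ComplexField.Normc.normc /= expr0n addr0 sqrtr_sqr ger0_norm.
by rewrite normcM exprMn nC -[LHS]mulrA.
Qed.

Lemma sqrte_lty (x : \bar R) : (sqrte x < +oo)%E = (x < +oo)%E.
Proof. by case: x => [r| |] //=; rewrite !ltry. Qed.

Lemma lee_sqrteM (x y : \bar R) (c : R) : (0 <= y)%E -> 0 <= c ->
  (sqrte x <= c%:E * sqrte y)%E = (x <= (c ^+ 2)%:E * y)%E.
Proof.
move=> y0 c0; have -> : (c%:E * sqrte y = sqrte ((c ^+ 2)%:E * y))%E.
  by rewrite sqrteM ?lee_fin ?sqr_ge0 // [sqrte (c ^+ 2)%:E]/= sqrtr_sqr ger0_norm.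
by rewrite lee_sqrt // mule_ge0 // lee_fin sqr_ge0.
Qed.

End LayerCake.

(** * Causal operators *)

Section Causal.
Context {R : realType}.
Notation mu := (@lebesgue_measure R).
Notation nc := (@ComplexField.Normc.normc R).
Implicit Types (f g : R -> R[i]) (v rho : R -> R) (D : R -> bool).
Variables (nu : {measure set (measurableTypeR R) -> \bar R}) (w : R -> R).
Variables (h phi : R[i] -> R[i]).
Hypothesis Hnu : zen_measure nu.
Hypothesis w0 : forall t, 0 < t -> 0 < w t.
Hypothesis wE : forall t, 0 < t -> zen_weight nu t = (w t)%:E.
Hypothesis wanti : forall s t, 0 < s <= t -> w t <= w s.
Hypothesis wexp : forall x, 0 < x -> exists2 c : R, 0 < c &
  forall t, 0 < t -> c * expR (- (2 * x * t)) <= w t.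
Hypothesis Hsurj : laplace_surjective nu.
Hypothesis hphi : forall z, rhp z -> rhp (phi z).
Let W := weighted_composition h phi.
Hypothesis Wbound : bounded_operator (zen_space nu) (zen_norm nu) W.
Hypothesis Wcausal : causal_zen nu W.

Let A f := laplace_inv nu (W (laplace f)).

Let mw : measurable_fun (`]0, +oo[%classic : set R) w := measurable_nonincreasing_pos wanti.
Let w0' t : 0 < t -> 0 <= w t. Proof. by move=> /w0/ltW. Qed.

Let LC f : L2w nu f -> laplace_class f := L2w_laplace_class w0 wE wanti wexp (f := f).

Let L2wP f : L2w nu f <-> cmeasurable f /\ (weighted_sqr w f < +oo)%E.
Proof.
split; first by move=> [m1 m2]; rewrite (L2w_normE wE) sqrte_lty.
by move=> [[m1 m2] H]; split => //; rewrite (L2w_normE wE) sqrte_lty.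
Qed.

Let zen_laplaceE f : L2w nu f -> zen_norm nu (laplace f) = sqrte (weighted_sqr w f).
Proof. by move=> /LC; exact: zen_norm_laplace. Qed.

Lemma laplace_zen_space f : L2w nu f -> zen_space nu (laplace f).
Proof.
move=> Hf; split; first exact: laplace_holomorphic (LC Hf).
by rewrite zen_laplaceE // sqrte_lty; have [_] := (L2wP f).1 Hf.
Qed.

Lemma laplace_invP f : L2w nu f -> L2w nu (A f) /\ forall z, rhp z -> laplace (A f) z = W (laplace f) z.
Proof.
move=> Hf; have [Wz _] := Wbound.
have [g Hg gE] := Hsurj (Wz _ (laplace_zen_space Hf)).
by apply: (@xgetPex _ _ [set g | L2w nu g /\ _]); exists g.
Qed.

Lemma laplaceZ (c : R[i]) f z : laplace_class f -> rhp z ->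
  laplace (fun t => c * f t) z = c * laplace f z.
Proof.
move=> Hf zr; rewrite !laplaceE -(CIZ c (L1c_laplace Hf zr)).2.
by apply: eq_CI => t _; rewrite mulrCA.
Qed.

Lemma L2wZ (c : R) f : 0 <= c -> L2w nu f -> L2w nu (fun t => c%:C * f t).
Proof.
move=> c0 /L2wP[[m1 m2] Hf]; apply/L2wP; split.
  split; [apply: (eq_measurable_fun (fun t => c * complex.Re (f t)))|
    apply: (eq_measurable_fun (fun t => c * complex.Im (f t)))];
    by [move=> t _; rewrite !ReImE /= mul0r ?subr0 ?addr0|exact: measurable_funM].
rewrite weighted_sqrZ //; move: Hf (weighted_sqr_ge0 f w0').
by case: (weighted_sqr w f) => [r| |] // _ _; rewrite -EFinM ltry.
Qed.

(** Homogeneity is read on the other side of the isometry, where it is the scaling of one integral;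
    surjectivity provides the preimage. *)
Lemma zen_normZ (c : R) (u : R[i] -> R[i]) : 0 <= c -> zen_space nu u ->
  zen_space nu (fun z => c%:C * u z) /\
  zen_norm nu (fun z => c%:C * u z) = (c%:E * zen_norm nu u)%E.
Proof.
move=> c0 zu; have [f Hf fE] := Hsurj zu.
have E : zen_norm nu (fun z => c%:C * u z) = zen_norm nu (laplace (fun t => c%:C * f t)).
  by apply: eq_rhp_zen_norm => z zr; rewrite laplaceZ ?fE //; exact: LC.
have E2 : zen_norm nu (fun z => c%:C * u z) = (c%:E * zen_norm nu u)%E.
  rewrite E zen_laplaceE; last exact: L2wZ.
  have -> : zen_norm nu u = sqrte (weighted_sqr w f).
    by rewrite -(zen_laplaceE Hf); apply: eq_rhp_zen_norm => z zr; rewrite fE.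
  have [m _] := (L2wP f).1 Hf.
  rewrite weighted_sqrZ // sqrteM ?lee_fin ?sqr_ge0 // [sqrte (c ^+ 2)%:E]/=.
  by rewrite sqrtr_sqr ger0_norm.
split => //; split; last first.
  rewrite E2; have [_] := zu; have : (0 <= zen_norm nu u)%E by exact: sqrte_ge0.
  by case: (zen_norm nu u) => [r| |] // _ _; rewrite -EFinM ltry.
have [hu _] := zu; exact: (holomorphicM (@holomorphic_cst R _) hu).
Qed.

(** The operator norm is a supremum over the unit ball, so the inequality for every [u] comes from
    rescaling; when the norm of [u] is 0 the a priori bound [M0] takes over. *)
Lemma zen_operator_norm : exists m : R, [/\ 0 <= m,
  operator_norm (zen_space nu) (zen_norm nu) W = m%:E &
  forall u, zen_space nu u -> (zen_norm nu (W u) <= m%:E * zen_norm nu u)%E].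
Proof.
have [Wz [M0 M00 HM]] := Wbound.
set op := operator_norm _ _ _.
have opM : (op <= M0%:E)%E.
  apply: ge_ereal_sup => _ [u [zu nu1] <-]; apply: le_trans (HM u zu) _.
  by rewrite -[leRHS]mule1 lee_wpmul2l // lee_fin.
have n0 : zen_norm nu (fun=> 0) = 0%E.
  rewrite /zen_norm (_ : [set _ | _ in _] = [set 0%E]) ?ereal_sup1 ?sqrte0 //.
  have nz : nc 0 ^+ 2 = 0 by rewrite normc0 expr0n.
  apply/seteqP; split => [_ [e _ <-]|_ ->].
    by rewrite /= integral0_eq // => p _; exact: (congr1 EFin nz).
  by exists 1 => //=; rewrite integral0_eq // => p _; exact: (congr1 EFin nz).
have z0 : zen_space nu (fun=> 0) by split; [exact: holomorphic_cst|rewrite n0].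
have op0 : (0 <= op)%E.
  apply: (@le_trans _ _ (zen_norm nu (W (fun=> 0)))); first exact: sqrte_ge0.
  apply: ereal_sup_ubound; exists (fun=> 0) => //; split => //.
  by rewrite n0 lee_fin.
have [m mE] : exists m : R, op = m%:E.
  by move: op0 opM; case: op => [r| |] //; exists r.
exists m; split => //; first by rewrite mE lee_fin in op0.
move=> u zu; have [_ uoo] := zu.
have [r rE] : exists r : R, zen_norm nu u = r%:E.
  have : (0 <= zen_norm nu u)%E by exact: sqrte_ge0.
  by move: uoo; case: (zen_norm nu u) => [r| |] //; exists r.
have r0 : 0 <= r by rewrite -lee_fin -rE; exact: sqrte_ge0.
rewrite rE; move: r0; rewrite le_eqVlt => /orP[/eqP r0|r0].
  by have := HM u zu; rewrite rE -r0 !mule0.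
have ri0 : 0 <= r^-1 by rewrite invr_ge0 ltW.
have [zu' nu'] := zen_normZ ri0 zu.
have [_ nWu'] := zen_normZ ri0 (Wz u zu).
have : (zen_norm nu (W (fun z => (r^-1%:C * u z)%R)) <= m%:E)%E.
  rewrite -mE; apply: ereal_sup_ubound; exists (fun z => r^-1%:C * u z) => //; split => //.
  by rewrite nu' rE -EFinM mulVf ?gt_eqF.
have -> : W (fun z => r^-1%:C * u z) = (fun z => r^-1%:C * W u z).
  by apply/funext => z; rewrite /W /weighted_composition mulrCA.
rewrite nWu' => H.
have := @lee_wpmul2l _ r%:E _ _ _ H; rewrite lee_fin (ltW r0) => /(_ isT).
by rewrite muleA -EFinM mulfV ?gt_eqF // mul1e muleC.
Qed.

Variable m : R.
Hypothesis m0 : 0 <= m.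
Hypothesis Wm : forall u, zen_space nu u -> (zen_norm nu (W u) <= m%:E * zen_norm nu u)%E.

Let A_le f : L2w nu f -> (weighted_sqr w (A f) <= (m ^+ 2)%:E * weighted_sqr w f)%E.
Proof.
move=> Hf; have [HA AE] := laplace_invP Hf.
have := Wm (laplace_zen_space Hf); rewrite -(eq_rhp_zen_norm nu AE) !zen_laplaceE //.
by rewrite lee_sqrteM //; exact: weighted_sqr_ge0.
Qed.

(** Preimages are chosen independently of one another, so additivity is recovered from the Laplace
    side, where [W] is linear, and injectivity returns it almost everywhere. *)
Let A_add f f1 f2 : L2w nu f -> L2w nu f1 -> L2w nu f2 ->
  (forall t, 0 < t -> f t = f1 t + f2 t) ->
  {ae mu, forall t, 0 < t -> A f t = A f1 t + A f2 t}.
Proof.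
move=> Hf H1 H2 fE.
have [HA AE] := laplace_invP Hf; have [HA1 AE1] := laplace_invP H1; have [HA2 AE2] := laplace_invP H2.
have L12 := laplace_classD (LC HA1) (LC HA2).
have Lg := laplace_classD (LC HA) (laplace_classN L12).
have fsum z : rhp z -> laplace f z = laplace f1 z + laplace f2 z.
  move=> zr; rewrite -laplaceD //; [|exact: LC|exact: LC].
  by rewrite !laplaceE; apply: eq_CI => t t0; rewrite fE.
have : forall z, rhp z -> laplace (fun t => A f t + - (A f1 t + A f2 t)) z = 0.
  move=> z zr; rewrite (laplaceD (LC HA) (laplace_classN L12) zr) (laplaceN L12 zr).
  rewrite (laplaceD (LC HA1) (LC HA2) zr) AE // AE1 // AE2 //.
  by rewrite /W /weighted_composition fsum ?mulrDr ?subrr //; exact: hphi.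
move=> /(laplace_eq0 Lg); apply: ae_mono => t H t0.
by apply/eqP; rewrite -subr_eq0; apply/eqP; exact: H.
Qed.

Let L2w_cut_off D f : measurable_fun (`]0, +oo[%classic : set R) D -> L2w nu f ->
  L2w nu (cut_off D f).
Proof.
move=> mD /L2wP[mf Hf]; apply/L2wP; have mc := cmeasurable_cut_off mD mf.
split => //; apply: le_lt_trans Hf; apply: le_weighted_sqr => //.
apply: aeW => t _; rewrite /cut_off; case: ifP => // _.
by rewrite normc0 normc_ge0.
Qed.

(** Causality in quantitative form. [D] is an initial segment; the part of [f] outside it is sent to
    a function vanishing almost everywhere on it, so on [D] the function [A f] agrees with [A] of
    the truncation, to which the norm bound applies. *)
Let A_cut_off D f : measurable_fun (`]0, +oo[%classic : set R) D ->
  (forall s t, 0 < s < t -> D t -> D s) -> L2w nu f ->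
  (weighted_sqr w (cut_off D (A f)) <= (m ^+ 2)%:E * weighted_sqr w (cut_off D f))%E.
Proof.
move=> mD Ddown Hf; have [HA _] := laplace_invP Hf.
have [mA _] := (L2wP _).1 HA.
have [allD|] := pselect (forall t, 0 < t -> D t).
  rewrite (@eq_weighted_sqr _ w w (cut_off D (A f)) (A f)); last first.
    by move=> t t0; rewrite /cut_off allD.
  rewrite (@eq_weighted_sqr _ w w (cut_off D f) f); last first.
    by move=> t t0; rewrite /cut_off allD.
  exact: A_le.
move=> /existsNP[t2 /not_implyP[t20 /negP nDt2]].
have [noD|] := pselect (forall t, 0 < t -> ~~ D t).
  have -> : weighted_sqr w (cut_off D (A f)) = 0%E.
    apply: integral0_eq => t _; rewrite on_posE; case: ifP => // t0.
    by rewrite /cut_off (negbTE (noD t t0)) normc0 expr0n mul0r.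
  by rewrite mule_ge0 ?lee_fin ?sqr_ge0 // weighted_sqr_ge0.
move=> /existsNP[t1 /not_implyP[t10 /negP/negPn Dt1]].
pose S : set R := [set t | 0 < t /\ D t].
have ubS t : S t -> t <= t2.
  move=> [t0 Dt]; rewrite leNgt; apply/negP => tt2.
  by move/negP: nDt2; apply; apply: Ddown Dt; rewrite t20.
have hS : has_sup S by split; [exists t1|exists t2].
(* [D] is now [(0, T)] with or without its right end; the cases of all of (0, oo) and of nothing
   were set aside because causality speaks of finite positive [T]. *)
pose T := sup S.
have T1 : t1 <= T by apply: ub_le_sup; [case: hS|].
have T0 : 0 < T by exact: lt_le_trans T1.
have DT t : 0 < t < T -> D t.
  move=> /andP[t0 tT]; have e0 : 0 < T - t by rewrite subr_gt0.
  have [e [e0' De] he] := sup_adherent e0 hS.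
  by apply: Ddown De; rewrite t0 /=; move: he; rewrite -/T; lra.
have nDT t : 0 < t -> D t -> t <= T by move=> t0 Dt; apply: ub_le_sup; [case: hS|].
pose D' t := ~~ D t.
have mD' : measurable_fun (`]0, +oo[%classic : set R) D' by exact: measurable_neg.
have H1 := L2w_cut_off mD Hf; have H2 := L2w_cut_off mD' Hf.
have fE t : 0 < t -> f t = cut_off D f t + cut_off D' f t.
  by move=> _; rewrite /cut_off /D'; case: (D t); rewrite /= ?addr0 ?add0r.
have Hadd := A_add Hf H1 H2 fE.
have H2T : L2w_from nu T (cut_off D' f).
  by split => //; apply: aeW => t tT; rewrite /cut_off /D' DT.
have [_ A2] := Wcausal T0 H2T.
have [mA1 _] := (L2wP _).1 (laplace_invP H1).1.
apply: le_trans (A_le H1); apply: le_weighted_sqr => //; first exact: cmeasurable_cut_off.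
(* The end [T] may belong to [D], and causality says nothing about the value there; a single point
   is negligible. *)
have neT : {ae mu, forall t : R, t != T}.
  exists [set T]; split => //; first exact: lebesgue_measure_set1.
  by move=> t /= /negP/negPn/eqP.
have : {ae mu, forall t : R, [/\ t != T, 0 < t -> A f t = A (cut_off D f) t + A (cut_off D' f) t
    & 0 < t < T -> A (cut_off D' f) t = 0]}.
  have [N1 [m1 n1 s1]] := neT; have [N2 [m2 n2 s2]] := Hadd; have [N3 [m3 n3 s3]] := A2.
  exists (N1 `|` N2 `|` N3); split.
  - by apply: measurableU => //; exact: measurableU.
  - apply: null_set_setU => //; first exact: measurableU.
    exact: null_set_setU.
  - move=> t H; apply: contrapT => nN; apply: H; split.
    + by apply: contrapT => H; apply: nN; left; left; exact: s1.
    + by apply: contrapT => H; apply: nN; left; right; exact: s2.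
    + by apply: contrapT => H; apply: nN; right; exact: s3.
apply: ae_mono => t [tT Ht Ht2] t0; rewrite {1}/cut_off; case: ifP => Dt.
  by rewrite Ht // Ht2 ?addr0 // t0 lt_neqAle tT nDT.
by rewrite normc0 normc_ge0.
Qed.

(** At each level the superlevel set of the nonincreasing [rho] is an initial segment; [A_cut_off]
    is integrated over the levels. *)
Lemma causal_weighted_le rho f : measurable_fun (`]0, +oo[%classic : set R) rho ->
  (forall t, 0 < t -> 0 <= rho t) -> (forall s t, 0 < s <= t -> rho t <= rho s) ->
  L2w nu f ->
  (weighted_sqr (fun t => (w t * rho t)%R) (laplace_inv nu (W (laplace f))) <=
   (m ^+ 2)%:E * weighted_sqr (fun t => (w t * rho t)%R) f)%E.
Proof.
move=> mr r0 ranti Hf; rewrite -/(A f); have [HA _] := laplace_invP Hf.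
have [mA _] := (L2wP _).1 HA; have [mf _] := (L2wP _).1 Hf.
have [mG1 ->] := layer_cake mw w0' mr r0 mA; have [mG2 ->] := layer_cake mw w0' mr r0 mf.
have G0 D g : (0 <= weighted_sqr w (cut_off D g))%E by exact: weighted_sqr_ge0.
rewrite -ge0_integralZl //=; last by rewrite lee_fin sqr_ge0.
apply: ge0_le_integral => //.
- by apply: measurable_funeM; exact: mG2.
- move=> s _; apply: A_cut_off => //.
    apply: measurable_and; first exact: measurable_cst.
    by apply: measurable_fun_ltr.
  move=> t t' /andP[t0 tt'] /andP[s0 st']; rewrite s0 /=.
  by apply: lt_le_trans st' _; apply: ranti; rewrite t0 ltW.
Qed.

End Causal.

(** * Pointwise limits, and Fatou's lemma for the Bergman norm *)

Section Limits.
Context {R : realType}.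
Notation mu := (@lebesgue_measure R).
Notation nc := (@ComplexField.Normc.normc R).
Implicit Types (u : nat -> R[i]) (F G : R[i] -> R[i]) (f : R -> R[i]).

Definition ccvg u (l : R[i]) : Prop :=
  complex.Re (u n) @[n --> \oo] --> complex.Re l /\
  complex.Im (u n) @[n --> \oo] --> complex.Im l.

Lemma ccvgM (c : R[i]) u l : ccvg u l -> ccvg (fun n => c * u n) (c * l).
Proof.
move=> [ur ui]; split.
  rewrite (_ : (fun n => _) = (fun n => complex.Re c * complex.Re (u n) - complex.Im c * complex.Im (u n))).
    by rewrite ReM; apply: cvgB; apply: cvgMr.
  by apply/funext => n; rewrite ReM.
rewrite (_ : (fun n => _) = (fun n => complex.Re c * complex.Im (u n) + complex.Im c * complex.Re (u n))).
  by rewrite ImM; apply: cvgD; apply: cvgMr.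
by apply/funext => n; rewrite ImM.
Qed.

Lemma ccvg_harmonic u l (c : R) : (forall n, nc (u n - l) <= c * n.+1%:R^-1) -> ccvg u l.
Proof.
move=> H.
have K (p : R[i] -> R) : (forall z w, `|p z - p w| <= nc (z - w)) -> p (u n) @[n --> \oo] --> p l.
  move=> pl; apply/cvgrPdist_le => eta eta0.
  have c0 : 0 < eta / (`|c| + 1) by rewrite divr_gt0 // ltr_wpDl.
  have := @cvg_harmonic R => /cvgrPdist_lt /(_ _ c0); apply: filterS => n.
  rewrite sub0r normrN gtr0_norm ?invr_gt0 // => nt.
  rewrite distrC; apply: le_trans (pl _ _) _; apply: le_trans (H n) _.
  have n0 : 0 <= n.+1%:R^-1 :> R by rewrite invr_ge0.
  apply: le_trans (ler_wpM2r n0 (ler_norm c)) _.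
  move: nt; rewrite ltr_pdivlMr ?ltr_wpDl // => /ltW; apply: le_trans.
  by rewrite mulrC ler_wpM2l // lerDl.
by split; apply: K; [exact: normRe_dist|exact: normIm_dist].
Qed.

Lemma le_bergman_norm alpha F G : continuous_rhp F -> continuous_rhp G ->
  (forall z, rhp z -> nc (F z) <= nc (G z)) -> (bergman_norm alpha F <= bergman_norm alpha G)%E.
Proof.
move=> cF cG FG; rewrite !bergman_normE.
have k0 K p : (0 <= (p.1 `^ alpha * rhp_sqr K p)%:E :> \bar R)%E.
  by rewrite lee_fin mulr_ge0 ?powR_ge0 ?rhp_sqr_ge0.
have mk K : continuous_rhp K -> measurable_fun setT (fun p : R * R => (p.1 `^ alpha * rhp_sqr K p)%:E).
  move=> cK; apply/measurable_EFinP; apply: measurable_funM; last exact: measurable_rhp_sqr.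
  by apply: (@measurable_of_fst _ (fun x => x `^ alpha)); exact: measurable_powR.
rewrite lee_sqrt; last by rewrite mule_ge0 ?lee_fin ?invr_ge0 ?pi_ge0 // integral_ge0.
rewrite lee_wpmul2l ?lee_fin ?invr_ge0 ?pi_ge0 //.
apply: ge0_le_integral => //; [exact: mk|exact: mk|].
move=> p _; rewrite lee_fin ler_wpM2l ?powR_ge0 // /rhp_sqr; case: ifP => // p0.
by rewrite lerXn2r ?nnegrE ?normc_ge0 // FG.
Qed.

Lemma bergman_norm_fatou alpha (Fn : nat -> R[i] -> R[i]) G (b : R) : 0 <= b ->
  (forall n, continuous_rhp (Fn n)) -> (forall z, rhp z -> ccvg (Fn^~ z) (G z)) ->
  (forall n, bergman_norm alpha (Fn n) <= b%:E)%E -> (bergman_norm alpha G <= b%:E)%E.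
Proof.
move=> b0 cF FG Fb; have p0 : 0 < pi :> R by exact: pi_gt0.
pose k K (p : R * R) : \bar R := (p.1 `^ alpha * rhp_sqr K p)%:E.
have k0 K p : (0 <= k K p)%E by rewrite lee_fin mulr_ge0 ?powR_ge0 ?rhp_sqr_ge0.
have E K : (bergman_norm alpha K <= b%:E)%E = (\int[mu \x mu]_p k K p <= (pi * b ^+ 2)%:E)%E.
  rewrite bergman_normE -[b%:E]mule1 (_ : 1%E = sqrte (1%:E : \bar R)); last by rewrite /= sqrtr1.
  rewrite lee_sqrteM ?lee_fin // mule1 -/(k K).
  by rewrite lee_pdivrMl // -EFinM.
rewrite E.
have mk n : measurable_fun setT (k (Fn n)).
  apply/measurable_EFinP; apply: measurable_funM; last exact: measurable_rhp_sqr.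
  by apply: (@measurable_of_fst _ (fun x => x `^ alpha)); exact: measurable_powR.
have kc p : k (Fn n) p @[n --> \oo] --> k G p.
  apply: cvg_EFin; first exact: nearW.
  apply: cvgMr; rewrite /rhp_sqr; case: ifP => p1; last exact: cvg_cst.
  have [cr ci] := FG (p.1 +i* p.2) p1.
  rewrite normc_sqr; under eq_fun do rewrite normc_sqr.
  by apply: cvgD; rewrite expr2; under eq_fun do rewrite expr2; apply: cvgM.
have -> : (\int[mu \x mu]_p k G p = \int[mu \x mu]_p limn_einf (fun n => k (Fn n) p))%E.
  by apply: eq_integral => p _; rewrite (cvg_limn_einf_sup (kc p)).1.
apply: (le_trans (@fatou _ _ _ (mu \x mu)%E setT measurableT (fun n => k (Fn n)) mk (fun n p _ => k0 (Fn n) p))).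
rewrite limn_einf_lim; apply: lime_le; first exact: is_cvg_einfs.
apply: nearW => n; apply: (@le_trans _ _ (\int[mu \x mu]_p k (Fn n) p)%E); last by rewrite -E.
by apply: ereal_inf_lbound; exists n => /=.
Qed.

Lemma laplace_cut_off_cvg f z : laplace_class f -> rhp z ->
  ccvg (fun n => laplace (cut_off (fun t => t < n%:R) f) z) (laplace f z).
Proof.
move=> Hf zr; have [Lr Li] := L1c_laplace Hf zr.
pose e t := cexp (- (t%:C * z)) * f t.
have H (p : R[i] -> R) : p 0 = 0 -> L1 (on_pos (fun t => p (e t))) ->
  RI (on_pos (fun t => p (cexp (- (t%:C * z)) * cut_off (fun t => t < n%:R) f t))) @[n --> \oo] -->
  RI (on_pos (fun t => p (e t))).
  move=> p0 Lp.
  have E n t : on_pos (fun t => p (cexp (- (t%:C * z)) * cut_off (fun t => t < n%:R) f t)) t =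
      if t < n%:R then on_pos (fun t => p (e t)) t else 0.
    rewrite !on_posE /cut_off /e; case: ifP => _; case: ifP => // _.
    by rewrite mulr0 p0.
  apply: (proj2 (@RI_dct _ _ _ (fun t => `|on_pos (fun t => p (e t)) t|) _ (L1_norm Lp) _ _)).
  - move=> n; rewrite (funext (E n)); apply: measurable_fun_ifT => //.
      exact: measurable_fun_ltr.
    exact: L1_measurable.
  - by move=> n t; rewrite E; case: ifP => // _; rewrite normr0.
  - move=> t; apply: cvg_near_cst; exists (Num.bound `|t|) => //= n /= nt; rewrite E.
    suff -> : t < n%:R by [].
    apply: le_lt_trans (ler_norm t) _; apply: lt_le_trans (archi_boundP (normr_ge0 t)) _.
    by rewrite ler_nat.
rewrite laplaceE (_ : (fun n => laplace _ z) = (fun n : nat =>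
    CI (fun t => cexp (- (t%:C * z)) * cut_off (fun t => t < n%:R) f t))); last first.
  by apply/funext => n; rewrite laplaceE.
by split; [exact: (H (@complex.Re R))|exact: (H (@complex.Im R))].
Qed.

Lemma holomorphic_weighted_composition (h phi F : R[i] -> R[i]) : holomorphic_rhp h ->
  holomorphic_rhp phi -> (forall z, rhp z -> rhp (phi z)) -> holomorphic_rhp F ->
  holomorphic_rhp (weighted_composition h phi F).
Proof.
move=> hh hp pr hF; apply: (holomorphicM hh) => z zr.
have /derivable1_diffP d1 := hp z zr; have /derivable1_diffP d2 := hF _ (pr z zr).
exact/derivable1_diffP/(differentiable_comp d1 d2).
Qed.

End Limits.

(** * Transfer to Bergman spaces *)

Section Transfer.
Context {R : realType}.
Notation mu := (@lebesgue_measure R).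
Notation nc := (@ComplexField.Normc.normc R).
Implicit Types (f g : R -> R[i]).
Variables (nu : {measure set (measurableTypeR R) -> \bar R}) (w : R -> R) (C : nat).
Variables (h phi : R[i] -> R[i]).
Hypothesis Hnu : zen_measure nu.
Hypothesis w0 : forall t, 0 < t -> 0 < w t.
Hypothesis wE : forall t, 0 < t -> zen_weight nu t = (w t)%:E.
Hypothesis wanti : forall s t, 0 < s <= t -> w t <= w s.
Hypothesis wexp : forall x, 0 < x -> exists2 c : R, 0 < c &
  forall t, 0 < t -> c * expR (- (2 * x * t)) <= w t.
Hypothesis wC : forall s t, 0 < s <= t -> s ^+ C * w s <= t ^+ C * w t.
Hypothesis Hsurj : laplace_surjective nu.
Hypothesis hh : holomorphic_rhp h.
Hypothesis hphi : holomorphic_rhp phi.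
Hypothesis phi_rhp : forall z, rhp z -> rhp (phi z).
Let W := weighted_composition h phi.
Hypothesis Wbound : bounded_operator (zen_space nu) (zen_norm nu) W.
Hypothesis Wcausal : causal_zen nu W.
Variable m : R.
Hypothesis m0 : 0 <= m.
Hypothesis Wm : forall u, zen_space nu u -> (zen_norm nu (W u) <= m%:E * zen_norm nu u)%E.
Variable alpha : R.
Hypothesis alphaC : C%:R <= alpha.

Let alpha0 : 0 <= alpha. Proof. exact: le_trans alphaC. Qed.

Let hW F : holomorphic_rhp F -> holomorphic_rhp (W F).
Proof. exact: holomorphic_weighted_composition. Qed.

(** [alpha + 1] exceeds [C] by a nonnegative amount, so the power splits into a nondecreasing factor
    and the one governed by [wC]. *)
Let power_weight_incr s t : 0 < s <= t -> s `^ (alpha + 1) * w s <= t `^ (alpha + 1) * w t.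
Proof.
move=> st; have /andP[s0 lest] := st; have t0 := lt_le_trans s0 lest.
have E x : 0 < x -> x `^ (alpha + 1) = x `^ (alpha + 1 - C%:R) * x ^+ C.
  move=> x0; rewrite -powR_mulrn ?(ltW x0) // -powRD; first by rewrite subrK.
  by apply/implyP => _; rewrite gt_eqF.
rewrite !E // -!mulrA; apply: ler_pM.
- exact: powR_ge0.
- by rewrite mulr_ge0 ?exprn_ge0 // ltW // w0.
- apply: ge0_ler_powR => //; rewrite ?nnegrE ?(ltW s0) ?(ltW t0) //.
  by rewrite -addrA addrCA addr_ge0 // subr_ge0 //.
- exact: wC.
Qed.

(** The constant [m] survives both limits because no approximant has a larger Bergman norm than [F]:
    neither damping nor truncation of the preimage increases it. *)
Lemma weighted_composition_bergman F : bergman_space alpha F ->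
  bergman_space alpha (W F) /\ (bergman_norm alpha (W F) <= m%:E * bergman_norm alpha F)%E.
Proof.
move=> [hF finF]; have [c c0 cE] := bergman_norm_laplace alpha0.
pose v t := c * t `^ (- (alpha + 1)); pose rho t := v t / w t.
have v0 t : 0 < t -> 0 < v t by move=> t0; rewrite mulr_gt0 // powR_gt0.
have rho0 t : 0 < t -> 0 < rho t by move=> t0; rewrite divr_gt0 ?v0 ?w0.
have vE t : 0 < t -> w t * rho t = v t.
  by move=> t0; rewrite /rho mulrC divfK // gt_eqF // w0.
have rho_anti s t : 0 < s <= t -> rho t <= rho s.
  move=> st; have /andP[s0 lest] := st; have t0 := lt_le_trans s0 lest.
  have E x : 0 < x -> rho x = c / (x `^ (alpha + 1) * w x).
    move=> x0; rewrite /rho /v powRN invfM mulrA //.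
  rewrite !E // ler_pM2l // lef_pV2 ?posrE ?mulr_gt0 ?powR_gt0 ?w0 //.
  exact: power_weight_incr.
have mrho := measurable_nonincreasing_pos rho_anti.
have mw := measurable_nonincreasing_pos wanti.
have mv : measurable_fun (`]0, +oo[%classic : set R) v.
  by apply: measurable_funM => //; apply: measurable_funTS; exact: measurable_powR.
have v0' t : 0 < t -> 0 <= v t by move=> /v0/ltW.
have w0' t : 0 < t -> 0 <= w t by move=> /w0/ltW.
have rho0' t : 0 < t -> 0 <= rho t by move=> /rho0/ltW.
have LC := L2w_laplace_class w0 wE wanti wexp.
(* On transforms of [L2w] functions [W] is represented by its conjugate, and [causal_weighted_le]
   with [rho = v / w] replaces the weight [w] by [v]. *)
have L2w_bound f : L2w nu f ->
    (bergman_norm alpha (W (laplace f)) <= m%:E * bergman_norm alpha (laplace f))%E.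
  move=> Hf; have [HA AE] := laplace_invP Hnu w0 wE wanti wexp Hsurj Wbound Hf.
  rewrite -(eq_rhp_bergman_norm alpha AE) !cE; [|exact: LC|exact: LC].
  rewrite lee_sqrteM //; last exact: weighted_sqr_ge0.
  have := causal_weighted_le Hnu w0 wE wanti wexp Hsurj phi_rhp Wbound Wcausal m0 Wm mrho rho0' rho_anti Hf.
  have wv g : weighted_sqr (fun t => w t * rho t) g = weighted_sqr v g.
    by apply: eq_weighted_sqr => t t0; rewrite vE.
  by rewrite !wv.
have [r rE] : exists r : R, bergman_norm alpha F = r%:E.
  have : (0 <= bergman_norm alpha F)%E by exact: sqrte_ge0.
  by move: finF; case: (bergman_norm alpha F) => [r| |] //; exists r.
have r0 : 0 <= r by rewrite -lee_fin -rE; exact: sqrte_ge0.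
pose b (n : nat) z : R[i] := n.+1%:R%:C * (n.+1%:R%:C + z)^-1.
have n0 (n : nat) : (0 : R) < n.+1%:R by rewrite ltr0n.
have /choice[f Hf] : forall n, exists f : R -> R[i], laplace_class f /\
    forall z, rhp z -> laplace f z = F z * b n z.
  by move=> n; have [f Lf fE] := bergman_laplace alpha0 (n0 n) hF finF; exists f.
have fr n : (bergman_norm alpha (laplace (f n)) <= r%:E)%E.
  have [Lf fE] := Hf n; rewrite -rE; apply: le_bergman_norm.
  - exact: holomorphic_continuous (laplace_holomorphic Lf).
  - exact: holomorphic_continuous.
  - move=> z zr; rewrite fE // normcM ler_piMr ?normc_ge0 //.
    exact: normc_cayley_le1.
have step1 n : (bergman_norm alpha (W (laplace (f n))) <= (m * r)%:E)%E.
  have [Lf fE] := Hf n; have [[m1 _] [m2 _]] := Lf.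
  pose fk (k : nat) := cut_off (fun t => t < k%:R) (f n).
  have mk (k : nat) : cmeasurable (fk k).
    by apply: cmeasurable_cut_off => //; exact: measurable_fun_ltr.
  have ncut k t : nc (fk k t) <= nc (f n t).
    by rewrite /fk /cut_off; case: ifP => // _; rewrite normc0 normc_ge0.
  have wsf : (weighted_sqr v (f n) < +oo)%E.
    by rewrite -sqrte_lty -cE //; apply: le_lt_trans (fr n) _; rewrite ltry.
  have L2k k : L2w nu (fk k).
    have [mk1 mk2] := mk k; split => //; rewrite (L2w_normE wE) sqrte_lty.
    (* For [k = 0] the truncation vanishes on (0, oo); it is separated because [rho] is controlled
       at positive points only. *)
    case: k mk1 mk2 => [|k] mk1 mk2.
      rewrite /weighted_sqr integral0_eq // => t _; rewrite on_posE; case: ifP => // t0.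
      have -> : fk 0%N t = 0 by rewrite /fk /cut_off ltNge (ltW t0).
      by rewrite normc0 expr0n mul0r.
    have k0 : (0 : R) < k.+1%:R by [].
    (* On [(0, k.+1)] the weight [w] equals [v / rho], and [rho] is at least its value at the right
       end. *)
    apply: (@le_lt_trans _ _ ((rho k.+1%:R)^-1%:E * weighted_sqr v (f n))%E); last first.
      move: wsf (weighted_sqr_ge0 (f n) v0').
      by case: (weighted_sqr v (f n)) => [x| |] // _ _; rewrite -EFinM ltry.
    rewrite /weighted_sqr -ge0_integralZl //=; first last.
    - by rewrite lee_fin invr_ge0 rho0'.
    - move=> t _; rewrite lee_fin on_posE; case: ifP => // t0.
      by apply: mulr_ge0; [exact: sqr_ge0|exact: v0'].
    - by apply: measurable_EFin; exact: measurable_weighted.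
    apply: ge0_le_integral => //.
    - move=> t _; rewrite lee_fin on_posE; case: ifP => // t0.
      by apply: mulr_ge0; [exact: sqr_ge0|exact: w0'].
    - by apply: measurable_EFin; exact: measurable_weighted.
    - by apply: measurable_funeM; apply: measurable_EFin; exact: measurable_weighted.
    - move=> t _; rewrite -EFinM lee_fin !on_posE; case: ifP => t0; last by rewrite mulr0.
      rewrite /fk /cut_off; case: ifP => [tk|_]; last first.
        rewrite normc0 expr0n mul0r; apply: mulr_ge0; first by rewrite invr_ge0 rho0'.
        by apply: mulr_ge0; [exact: sqr_ge0|exact: v0'].
      rewrite [leRHS]mulrCA ler_wpM2l ?sqr_ge0 // mulrC ler_pdivlMr ?rho0 //.
      rewrite -vE // ler_wpM2l ?w0' // rho_anti // t0 ltW //.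
  apply: (@bergman_norm_fatou _ _ (fun k => W (laplace (fk k)))).
  - by rewrite mulr_ge0.
  - by move=> k; apply: holomorphic_continuous; apply: hW; exact: laplace_holomorphic (LC _ (L2k k)).
  - by move=> z zr; apply: ccvgM; apply: laplace_cut_off_cvg => //; exact: phi_rhp.
  - move=> k; apply: le_trans (L2w_bound _ (L2k k)) _; rewrite EFinM.
    rewrite lee_wpmul2l ?lee_fin //; apply: le_trans (fr n).
    rewrite !cE //; last exact: LC.
    rewrite lee_sqrt; last exact: weighted_sqr_ge0.
    by apply: le_weighted_sqr => //; apply: aeW => t _.
have WF : (bergman_norm alpha (W F) <= (m * r)%:E)%E.
  apply: (@bergman_norm_fatou _ _ (fun n => W (laplace (f n)))) => //.
  - by rewrite mulr_ge0.
  - by move=> n; apply: holomorphic_continuous; apply: hW; exact: laplace_holomorphic (Hf n).1.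
  - move=> z zr; have pz := phi_rhp zr; apply: ccvgM.
    rewrite (_ : (fun n => laplace (f n) (phi z)) = (fun n => F (phi z) * b n (phi z))); last first.
      by apply/funext => n; rewrite (Hf n).2.
    rewrite -[X in ccvg _ X]mulr1; apply: ccvgM.
    (* At [phi z] the damping factor differs from 1 by at most the modulus of [phi z] divided by
       [n.+1]. *)
    apply: (@ccvg_harmonic _ _ _ (nc (phi z))) => n.
    rewrite ler_pdivlMr //; exact: normc_cayley_sub1.
split; last by rewrite rE -EFinM.
by split; [exact: hW|apply: le_lt_trans WF _; rewrite ltry].
Qed.

End Transfer.

Unset Implicit Arguments.

Theorem theorem3 (R : realType)
    (nu : {measure set (measurableTypeR R) -> \bar R})
    (h phi : R[i] -> R[i]) :
  zen_measure nu ->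
  laplace_surjective nu ->
  holomorphic_rhp h ->
  holomorphic_rhp phi ->
  (forall z, rhp z -> rhp (phi z)) ->
  bounded_operator (zen_space nu) (zen_norm nu) (weighted_composition h phi) ->
  causal_zen nu (weighted_composition h phi) ->
  exists2 alpha' : R, 0 <= alpha' &
    forall alpha : R, alpha' <= alpha ->
      bounded_operator (bergman_space alpha) (bergman_norm alpha)
        (weighted_composition h phi) /\
      (operator_norm (bergman_space alpha) (bergman_norm alpha)
         (weighted_composition h phi)
       <= operator_norm (zen_space nu) (zen_norm nu)
            (weighted_composition h phi))%E.
Proof.
move=> Hnu Hsurj hh hp pr Wb Wc.
have [w [w0 wE wanti wexp [C wC]]] := zen_weight_properties Hnu.
have [m [m0 mE Wm]] := zen_operator_norm Hnu w0 wE wanti wexp Hsurj Wb.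
(* The exponent for which [t ^+ C * w t] is nondecreasing is the threshold; above it [v / w] is
   nonincreasing, and [alpha] is nonnegative as the Bergman constant requires. *)
exists C%:R; first exact: ler0n.
move=> alpha aC.
have T := weighted_composition_bergman Hnu w0 wE wanti wexp wC Hsurj hh hp pr Wb Wc m0 Wm aC.
split.
  split; first by move=> u /T[].
  by exists m => // u /T[].
rewrite mE; apply: ge_ereal_sup => _ [u [Bu u1] <-].
have [_ Wu] := T u Bu; apply: le_trans Wu _.
by rewrite -[leRHS]mule1 lee_wpmul2l.
Qed.
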